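(* Let $k$ be an algebraically closed field of characteristic $0$ and let $H$ be a cocommutative Hopf algebra over $k$. Let $G$ be the group of grouplike elements of $H$ and $\mathfrak{g}$ the Lie algebra of primitive elements of $H$, and identify the subalgebra of $H$ generated by $\mathfrak g$ with the universal enveloping algebra $U(\mathfrak g)$. Then $$H_{par}\cong U(\mathfrak{g})\#_{\mathcal{T}}k_{par}G$$ as algebras, where $$\mathcal{T}:k_{par}G\otimes U(\mathfrak{g})\to U(\mathfrak{g})\otimes k_{par}G,\qquad [g_1]\cdots[g_n]\otimes x\mapsto g_1\cdots g_n\,x\,g_n^{-1}\cdots g_1^{-1}\otimes[g_1]\cdots[g_n]$$ (the conjugation being computed in $H$).
   Context: For a Hopf algebra $L$ with antipode $S$ and $\Delta(h)=h_{(1)}\otimes h_{(2)}$, $L_{par}$ is the quotient of the tensor algebra $T(L)$ by the relations $1_L = 1_{T(L)}$, $h\otimes k_{(1)}\otimes S(k_{(2)}) = hk_{(1)}\otimes S(k_{(2)})$, $h_{(1)}\otimes S(h_{(2)})\otimes k = h_{(1)}\otimes S(h_{(2)})k$ ($h,k\in L$); $[h]$ is the class of $h\in L$. One writes $k_{par}G=(kG)_{par}$ for the group algebra $kG$. For algebras $U,C$ and a linear map $\mathcal T:C\otimes U\to U\otimes C$, written $\mathcal T(c\otimes u)=u^{\mathcal T}\otimes c^{\mathcal T}$ (summation understood), $U\#_{\mathcal T}C$ denotes $U\otimes C$ with product $(u\#c)(u'\#c')=u\,u'^{\mathcal T}\#c^{\mathcal T}c'$; for the $\mathcal T$ above this is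 an associative algebra with unit $1\#1$. *)

(* Defs.v *)
(* MathComp, with boolp to decide the congruences defining quotients. *)
From HB Require Import structures.
From mathcomp Require Import all_boot all_order all_algebra.
From mathcomp Require Import finmap monalg boolp.

Set Implicit Arguments.
Unset Strict Implicit.
Unset Printing Implicit Defensive.

Import GRing.Theory.

Local Open Scope ring_scope.
Local Open Scope quotient_scope.

Reserved Notation "U ⊗ V" (at level 40, left associativity).
Reserved Notation "u ⊗t v" (at level 40, left associativity).

HB.lock Definition free_ext (k : fieldType) (X : choiceType) (W : lmodType k)
    (f : X -> W) (g : {malg k[X]}) : W :=
  \sum_(x <- msupp g) g@_x *: f x.
Arguments free_ext {k X W} f g.

Section FreeModule.
Context {k : fieldType} {X : choiceType} {W : lmodType k}.
Implicit Types (f : X -> W) (g : {malg k[X]}).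

Lemma free_extw f g (d : {fset X}) : (msupp g `<=` d)%fset ->
  free_ext f g = \sum_(x <- d) g@_x *: f x.
Proof.
move=> le_d; rewrite free_ext.unlock (big_fset_incl _ le_d) //= => x _.
by move/mcoeff_outdom=> ->; rewrite scale0r.
Qed.

Fact free_ext_is_linear f : linear (free_ext f).
Proof.
move=> a g h; pose d := (msupp g `|` msupp h `|` msupp (a *: g + h))%fset.
rewrite !(@free_extw f _ d); do ?by
  apply/fsubsetP=> x; rewrite !inE => ->; rewrite ?orbT.
rewrite scaler_sumr -big_split; apply: eq_bigr => x _ /=.
by rewrite mcoeffD mcoeffZ scalerDl scalerA.
Qed.

HB.instance Definition _ f :=
  GRing.isLinear.Build k {malg k[X]} W *:%R (free_ext f) (free_ext_is_linear f).

Lemma free_extU f x : free_ext f << x >> = f x.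
Proof.
by rewrite (free_extw f (d := [fset x]%fset) msuppU_le) big_seq_fset1 mcoeffUU scale1r.
Qed.

Lemma eq_free_ext f1 f2 g : f1 =1 f2 -> free_ext f1 g = free_ext f2 g.
Proof. by move=> eqf; rewrite free_ext.unlock; apply: eq_bigr => x _; rewrite eqf. Qed.

Lemma free_extP f f1 f2 a g : (forall x, f x = a *: f1 x + f2 x) ->
  free_ext f g = a *: free_ext f1 g + free_ext f2 g.
Proof.
move=> fE; rewrite free_ext.unlock scaler_sumr -big_split; apply: eq_bigr => x _.
by rewrite fE scalerDr !scalerA mulrC.
Qed.

Lemma malg_scaleE g : g = \sum_(x <- msupp g) g@_x *: << x >>.
Proof.
rewrite {1}[g]monalgE; apply: eq_bigr => x _; apply/malgP => y.
by rewrite mcoeffZ !mcoeffU mulr_natr.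
Qed.

Lemma malg_linear_eq (f1 f2 : {linear {malg k[X]} -> W}) :
  (forall x, f1 << x >> = f2 << x >>) -> f1 =1 f2.
Proof.
move=> eqf g; rewrite [g]malg_scaleE !linear_sum; apply: eq_bigr => x _.
by rewrite !linearZ /= eqf.
Qed.

End FreeModule.

Section FreeModuleMorphism.
Context {k : fieldType} {X : choiceType}.
Implicit Types g : {malg k[X]}.

Lemma linear_free_ext (W W' : lmodType k) (f : X -> W) (l : {linear W -> W'}) g :
  l (free_ext f g) = free_ext (fun x => l (f x)) g.
Proof.
by rewrite free_ext.unlock linear_sum; apply: eq_bigr => x _; rewrite linearZ.
Qed.

Lemma free_ext_mull (A : algType k) (f : X -> A) y g :
  y * free_ext f g = free_ext (fun x => y * f x) g.
Proof.
by rewrite free_ext.unlock mulr_sumr; apply: eq_bigr => x _; rewrite scalerAr.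
Qed.

Lemma free_ext_mulr (A : algType k) (f : X -> A) y g :
  free_ext f g * y = free_ext (fun x => f x * y) g.
Proof.
by rewrite free_ext.unlock mulr_suml; apply: eq_bigr => x _; rewrite scalerAl.
Qed.

End FreeModuleMorphism.

Section QuotientModule.
Context {k : fieldType} {V : lmodType k}.

Inductive span (S : V -> Prop) : V -> Prop :=
| SpanNil : span S 0
| SpanCons a x y : S x -> span S y -> span S (a *: x + y).

Variable S : V -> Prop.

Lemma spanS x : S x -> span S x.
Proof.
by move=> Sx; rewrite -[x]addr0 -[x]scale1r; apply: SpanCons Sx (SpanNil S).
Qed.

Lemma spanD x y : span S x -> span S y -> span S (x + y).
Proof.
move=> Sx; elim: Sx => [|a s {}x Ss _ IHx] Sy; first by rewrite add0r.
by rewrite -addrA; apply: SpanCons => //; apply: IHx.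
Qed.

Lemma spanZ a x : span S x -> span S (a *: x).
Proof.
elim=> [|b s {}x Ss _ IHx]; first by rewrite scaler0; apply: SpanNil.
by rewrite scalerDr scalerA; apply: SpanCons.
Qed.

Lemma spanN x : span S x -> span S (- x).
Proof. by rewrite -scaleN1r; apply: spanZ. Qed.

Lemma span_ker (W : lmodType k) (f : {linear V -> W}) x :
  (forall y, S y -> f y = 0) -> span S x -> f x = 0.
Proof.
move=> f0; elim=> [|a s y Ss _ IHy]; first exact: linear0.
by rewrite linearP f0 // scaler0 add0r.
Qed.

Definition quot_rel (x y : V) : bool := `[< span S (x - y) >].

Fact quot_rel_refl : reflexive quot_rel.
Proof. by move=> x; apply/asboolP; rewrite subrr; apply: SpanNil. Qed.

Fact quot_rel_sym : symmetric quot_rel.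
Proof.
by move=> x y; apply/asboolP/asboolP => /spanN; rewrite opprB.
Qed.

Fact quot_rel_trans : transitive quot_rel.
Proof.
move=> y x z /asboolP Sxy /asboolP Syz; apply/asboolP.
by have := spanD Sxy Syz; rewrite addrA subrK.
Qed.

Canonical quot_equiv :=
  EquivRel quot_rel quot_rel_refl quot_rel_sym quot_rel_trans.

Definition quotmod := {eq_quot quot_rel}.

HB.instance Definition _ := Choice.on quotmod.
HB.instance Definition _ := EqQuotient.on quotmod.

End QuotientModule.

HB.lock Definition quot_class (k : fieldType) (V : lmodType k) (S : V -> Prop)
  (x : V) : quotmod S := \pi_(quotmod S) x.
Arguments quot_class {k V} S x.

HB.lock Definition quot_opp (k : fieldType) (V : lmodType k) (S : V -> Prop)
  (p : quotmod S) : quotmod S := quot_class S (- repr p).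
Arguments quot_opp {k V S} p.

HB.lock Definition quot_add (k : fieldType) (V : lmodType k) (S : V -> Prop)
  (p q : quotmod S) : quotmod S := quot_class S (repr p + repr q).
Arguments quot_add {k V S} p q.

HB.lock Definition quot_scale (k : fieldType) (V : lmodType k) (S : V -> Prop)
  (a : k) (p : quotmod S) : quotmod S := quot_class S (a *: repr p).
Arguments quot_scale {k V S} a p.

(* Independent of the choice of representatives as soon as f is linear and
   vanishes on S. *)
HB.lock Definition quot_lift (k : fieldType) (V : lmodType k) (S : V -> Prop)
  (W : lmodType k) (f : V -> W) (q : quotmod S) : W := f (repr q).
Arguments quot_lift {k V S W} f q.

Section QuotientModuleTheory.
Context {k : fieldType} {V : lmodType k} {S : V -> Prop}.
Local Notation quotmod := (quotmod S).
Local Notation quot_class := (quot_class S).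

Lemma quot_classE x y : quot_class x = quot_class y <-> span S (x - y).
Proof.
split=> [/eqP | Sxy].
  by rewrite unlock piE => /asboolP.
by apply/eqP; rewrite unlock piE; apply/asboolP.
Qed.

Lemma quot_class_repr (q : quotmod) : quot_class (repr q) = q.
Proof. by rewrite unlock reprK. Qed.

Lemma repr_class x : span S (repr (quot_class x) - x).
Proof. by apply/quot_classE; rewrite quot_class_repr. Qed.

Let piN x : quot_opp (quot_class x) = quot_class (- x).
Proof.
by rewrite quot_opp.unlock; apply/quot_classE; rewrite -opprD; apply/spanN/repr_class.
Qed.

Let piD x y : quot_add (quot_class x) (quot_class y) = quot_class (x + y).
Proof.
rewrite quot_add.unlock; apply/quot_classE; rewrite opprD addrACA.
by apply: spanD; apply: repr_class.
Qed.

Let piZ a x : quot_scale a (quot_class x) = quot_class (a *: x).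
Proof.
by rewrite quot_scale.unlock; apply/quot_classE; rewrite -scalerBr; apply/spanZ/repr_class.
Qed.

Let ind (P : quotmod -> Prop) : (forall x, P (quot_class x)) -> forall q, P q.
Proof. by move=> Pq q; rewrite -(quot_class_repr q). Qed.

Fact quot_addA : associative (@quot_add k V S).
Proof.
by elim/ind=> x; elim/ind=> y; elim/ind=> z; rewrite !piD addrA.
Qed.

Fact quot_addC : commutative (@quot_add k V S).
Proof. by elim/ind=> x; elim/ind=> y; rewrite !piD addrC. Qed.

Fact quot_add0 : left_id (quot_class 0) (@quot_add k V S).
Proof. by elim/ind=> x; rewrite piD add0r. Qed.

Fact quot_addN : left_inverse (quot_class 0) quot_opp (@quot_add k V S).
Proof. by elim/ind=> x; rewrite piN piD addNr. Qed.

HB.instance Definition _ :=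
  GRing.isZmodule.Build quotmod quot_addA quot_addC quot_add0 quot_addN.

Fact quot_scaleA a b (q : quotmod) : quot_scale a (quot_scale b q) = quot_scale (a * b) q.
Proof. by elim/ind: q => x; rewrite !piZ scalerA. Qed.

Fact quot_scale1 : left_id 1 (@quot_scale k V S).
Proof. by elim/ind=> x; rewrite piZ scale1r. Qed.

Fact quot_scaleDr : right_distributive (@quot_scale k V S) +%R.
Proof.
move=> a; elim/ind=> x; elim/ind=> y.
have DE (p q : quotmod) : p + q = quot_add p q by [].
by rewrite !DE piD !piZ piD scalerDr.
Qed.

Fact quot_scaleDl (q : quotmod) : {morph (@quot_scale k V S)^~ q : a b / a + b}.
Proof.
move=> a b; elim/ind: q => x; rewrite !piZ scalerDl.
exact: esym (piD _ _).
Qed.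

HB.instance Definition _ := GRing.Zmodule_isLmodule.Build k quotmod
  quot_scaleA quot_scale1 quot_scaleDr quot_scaleDl.

Fact quot_class_is_linear : linear quot_class.
Proof. by move=> a x y; rewrite -piD -piZ. Qed.

HB.instance Definition _ :=
  GRing.isLinear.Build k V quotmod *:%R quot_class quot_class_is_linear.

Lemma quot_class0 x : S x -> quot_class x = 0.
Proof.
by move=> Sx; rewrite -(linear0 quot_class); apply/quot_classE; rewrite subr0;
  apply: spanS.
Qed.

Lemma quot_ind (P : quotmod -> Prop) :
  (forall x, P (quot_class x)) -> forall q, P q.
Proof. exact: ind. Qed.

Lemma quot_liftE (W : lmodType k) (f : V -> W) q : quot_lift f q = f (repr (q : quotmod)).
Proof. by rewrite quot_lift.unlock. Qed.

Lemma quot_lift_class (W : lmodType k) (f : {linear V -> W}) x :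
  (forall y, S y -> f y = 0) -> quot_lift f (quot_class x) = f x.
Proof.
move=> f0; apply/eqP; rewrite quot_liftE -subr_eq0 -linearB; apply/eqP.
exact: span_ker f0 (repr_class x).
Qed.

Lemma quot_lift_is_linear (W : lmodType k) (f : {linear V -> W}) :
  (forall y, S y -> f y = 0) -> linear (quot_lift f).
Proof.
move=> f0 a; elim/ind=> x; elim/ind=> y.
by rewrite -linearP !quot_lift_class // linearP.
Qed.

End QuotientModuleTheory.

Section QuotientAlgebra.
Context {k : fieldType} {A : algType k}.

(* span (two_sided S) is the two-sided ideal generated by S. *)
Inductive two_sided (S : A -> Prop) : A -> Prop :=
| TwoSided a x b : S x -> two_sided S (a * x * b).

Definition proper_rel (S : A -> Prop) : Prop := ~ span (two_sided S) 1.

Lemma ideal_mull (S : A -> Prop) a x :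
  span (two_sided S) x -> span (two_sided S) (a * x).
Proof.
elim=> [|c _ y [b x' b' Sx'] _ IHy]; first by rewrite mulr0; apply: SpanNil.
by rewrite mulrDr -scalerAr !mulrA; apply: SpanCons.
Qed.

Lemma ideal_mulr (S : A -> Prop) x a :
  span (two_sided S) x -> span (two_sided S) (x * a).
Proof.
elim=> [|c _ y [b x' b' Sx'] _ IHy]; first by rewrite mul0r; apply: SpanNil.
by rewrite mulrDl -scalerAl -!mulrA [b * _]mulrA; apply: SpanCons.
Qed.

Lemma two_sided_ker (S : A -> Prop) (B : algType k) (f : {lrmorphism A -> B}) :
  (forall x, S x -> f x = 0) -> forall x, two_sided S x -> f x = 0.
Proof. by move=> f0 _ [a x b Sx]; rewrite !rmorphM /= (f0 _ Sx) mulr0 mul0r. Qed.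

Lemma proper_rel_ker (S : A -> Prop) (B : algType k) (f : {lrmorphism A -> B}) :
  (forall x, S x -> f x = 0) -> proper_rel S.
Proof.
move=> f0 /(span_ker (two_sided_ker f0)) /eqP.
by rewrite rmorph1 oner_eq0.
Qed.

(* Properness is required because algType only contains nonzero rings. *)
Definition quotalg (S : A -> Prop) (properS : proper_rel S) : Type :=
  quotmod (two_sided S).

End QuotientAlgebra.

HB.lock Definition quotalg_mul (k : fieldType) (A : algType k) (S : A -> Prop)
    (properS : proper_rel S) (p q : quotalg properS) : quotalg properS :=
  quot_class (two_sided S)
    (repr (p : quotmod (two_sided S)) * repr (q : quotmod (two_sided S))).
Arguments quotalg_mul {k A S properS} p q.

Section QuotientAlgebraTheory.
Context {k : fieldType} {A : algType k}.
Variables (S : A -> Prop) (properS : proper_rel S).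
Local Notation quotalg_mul := (@quotalg_mul k A S properS).

HB.instance Definition _ := GRing.Lmodule.on (quotalg properS).

Definition alg_class (x : A) : quotalg properS := quot_class (two_sided S) x.

HB.instance Definition _ := GRing.Linear.copy alg_class (quot_class (two_sided S)).

Let piM x y : quotalg_mul (alg_class x) (alg_class y) = alg_class (x * y).
Proof.
rewrite unlock; apply/quot_classE.
set x' := repr _; set y' := repr _.
rewrite -[x' * y'](subrK (x' * y)) -mulrBr -addrA -mulrBl.
by apply: spanD; [apply: ideal_mull | apply: ideal_mulr]; apply: repr_class.
Qed.

Lemma alg_ind (P : quotalg properS -> Prop) :
  (forall x, P (alg_class x)) -> forall q, P q.
Proof. exact: quot_ind. Qed.

Fact quotalg_mulA : associative quotalg_mul.
Proof.
by elim/alg_ind=> x; elim/alg_ind=> y; elim/alg_ind=> z; rewrite !piM mulrA.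
Qed.

Fact quotalg_mul1 : left_id (alg_class 1) quotalg_mul.
Proof. by elim/alg_ind=> x; rewrite piM mul1r. Qed.

Fact quotalg_mulr1 : right_id (alg_class 1) quotalg_mul.
Proof. by elim/alg_ind=> x; rewrite piM mulr1. Qed.

Fact quotalg_mulDl : left_distributive quotalg_mul +%R.
Proof.
elim/alg_ind=> x; elim/alg_ind=> y; elim/alg_ind=> z.
by rewrite -linearD !piM mulrDl linearD.
Qed.

Fact quotalg_mulDr : right_distributive quotalg_mul +%R.
Proof.
elim/alg_ind=> x; elim/alg_ind=> y; elim/alg_ind=> z.
by rewrite -linearD !piM mulrDr linearD.
Qed.

Fact quotalg_oner_neq0 : alg_class 1 != 0.
Proof.
apply/eqP; rewrite -(linear0 alg_class) => /quot_classE.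
by rewrite subr0.
Qed.

HB.instance Definition _ := GRing.Zmodule_isNzRing.Build (quotalg properS)
  quotalg_mulA quotalg_mul1 quotalg_mulr1 quotalg_mulDl quotalg_mulDr
  quotalg_oner_neq0.

Fact alg_class_is_monoid_morphism : monoid_morphism alg_class.
Proof. by split=> // x y; rewrite -piM. Qed.

HB.instance Definition _ := GRing.isMonoidMorphism.Build A (quotalg properS)
  alg_class alg_class_is_monoid_morphism.

Fact quotalg_scaleAl (a : k) (p q : quotalg properS) :
  a *: (p * q) = (a *: p) * q.
Proof.
elim/alg_ind: p => x; elim/alg_ind: q => y.
by rewrite -rmorphM -!linearZ /= -rmorphM scalerAl.
Qed.

HB.instance Definition _ :=
  GRing.Lmodule_isLalgebra.Build k (quotalg properS) quotalg_scaleAl.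

Fact quotalg_scaleAr (a : k) (p q : quotalg properS) :
  a *: (p * q) = p * (a *: q).
Proof.
elim/alg_ind: p => x; elim/alg_ind: q => y.
by rewrite -rmorphM -!linearZ /= -rmorphM scalerAr.
Qed.

HB.instance Definition _ :=
  GRing.Lalgebra_isAlgebra.Build k (quotalg properS) quotalg_scaleAr.

Lemma alg_class0 x : S x -> alg_class x = 0.
Proof.
by move=> Sx; apply: quot_class0; rewrite -[x]mul1r -[1 * x]mulr1; constructor.
Qed.

Section Lift.
Variables (B : algType k) (f : {lrmorphism A -> B}).
Hypothesis f0 : forall x, S x -> f x = 0.

Definition alg_lift of (forall x, S x -> f x = 0) : quotalg properS -> B :=
  quot_lift f.

Lemma alg_liftE x : alg_lift f0 (alg_class x) = f x.
Proof. exact: quot_lift_class (two_sided_ker f0). Qed.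

Fact alg_lift_is_linear : linear (alg_lift f0).
Proof. exact: quot_lift_is_linear (two_sided_ker f0). Qed.

Fact alg_lift_is_monoid_morphism : monoid_morphism (alg_lift f0).
Proof.
split; first by rewrite alg_liftE rmorph1.
by elim/alg_ind=> x; elim/alg_ind=> y; rewrite -rmorphM !alg_liftE rmorphM.
Qed.

HB.instance Definition _ := GRing.isLinear.Build k (quotalg properS) B *:%R
  (alg_lift f0) alg_lift_is_linear.
HB.instance Definition _ := GRing.isMonoidMorphism.Build (quotalg properS) B
  (alg_lift f0) alg_lift_is_monoid_morphism.

End Lift.

End QuotientAlgebraTheory.

Section Tensor.
Context {k : fieldType}.
Implicit Types U V W : lmodType k.

Inductive tens_rel U V : {malg k[(U * V)%type]} -> Prop :=
| TensDl u u' v : tens_rel (<< (u + u', v) >> - << (u, v) >> - << (u', v) >>)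
| TensDr u v v' : tens_rel (<< (u, v + v') >> - << (u, v) >> - << (u, v') >>)
| TensZl a u v : tens_rel (<< (a *: u, v) >> - a *: << (u, v) >>)
| TensZr a u v : tens_rel (<< (u, a *: v) >> - a *: << (u, v) >>).

Definition tens U V : Type := quotmod (@tens_rel U V).

HB.instance Definition _ U V := GRing.Lmodule.on (tens U V).

Definition bilin U V W (f : U -> V -> W) : Prop :=
  (forall v, linear (f^~ v)) /\ (forall u, linear (f u)).

End Tensor.

HB.lock Definition tensor (k : fieldType) (U V : lmodType k) (u : U) (v : V) :
  tens U V := quot_class (@tens_rel k U V) << (u, v) >>.
Arguments tensor {k U V} u v.

(* The linear map with u ⊗ v |-> f u v; only meaningful for bilinear f. *)
HB.lock Definition tens_lift (k : fieldType) (U V W : lmodType k)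
    (f : U -> V -> W) (t : tens U V) : W :=
  quot_lift (free_ext (fun uv => f uv.1 uv.2)) t.
Arguments tens_lift {k U V W} f t.

Notation "U ⊗ V" := (tens U V) : type_scope.
Notation "u ⊗t v" := (tensor u v) : ring_scope.

Section TensorTheory.
Context {k : fieldType}.
Implicit Types (U V W : lmodType k) (A : algType k).

Lemma tensDl U V (u u' : U) (v : V) : (u + u') ⊗t v = u ⊗t v + u' ⊗t v.
Proof.
rewrite tensor.unlock; have /quot_class0 := TensDl u u' v; rewrite !linearB /= => /eqP.
by rewrite -addrA -opprD subr_eq0 => /eqP.
Qed.

Lemma tensDr U V (u : U) (v v' : V) : u ⊗t (v + v') = u ⊗t v + u ⊗t v'.
Proof.
rewrite tensor.unlock; have /quot_class0 := TensDr u v v'; rewrite !linearB /= => /eqP.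
by rewrite -addrA -opprD subr_eq0 => /eqP.
Qed.

Lemma tensZl U V a (u : U) (v : V) : (a *: u) ⊗t v = a *: (u ⊗t v).
Proof.
rewrite tensor.unlock; have /quot_class0 := TensZl a u v; rewrite linearB linearZ /= => /eqP.
by rewrite subr_eq0 => /eqP.
Qed.

Lemma tensZr U V a (u : U) (v : V) : u ⊗t (a *: v) = a *: (u ⊗t v).
Proof.
rewrite tensor.unlock; have /quot_class0 := TensZr a u v; rewrite linearB linearZ /= => /eqP.
by rewrite subr_eq0 => /eqP.
Qed.

Lemma tens_ind U V (P : U ⊗ V -> Prop) :
  P 0 -> (forall a u v t, P t -> P (a *: (u ⊗t v) + t)) -> forall t, P t.
Proof.
rewrite tensor.unlock => P0 Pcons; apply: quot_ind => g; rewrite [g]malg_scaleE linear_sum.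
elim: (enum_fset _) => [|[u v] s IHs]; first by rewrite big_nil.
rewrite big_cons [X in P (X + _)]linearZ; exact: (Pcons _ u v _ IHs).
Qed.

Lemma tens_linear_eq U V W (f g : U ⊗ V -> W) : linear f -> linear g ->
  (forall u v, f (u ⊗t v) = g (u ⊗t v)) -> f =1 g.
Proof.
move=> lf lg eqfg t; elim/tens_ind: t => [|a u v t IHt]; last first.
  by rewrite lf lg eqfg IHt.
have zero h : linear h -> h 0 = 0 :> W.
  by move=> lh; have /eqP := lh (-1) 0 0; rewrite scaler0 addr0 scaleN1r addNr => /eqP.
by rewrite !zero.
Qed.

Section Lift.
Variables (U V W : lmodType k) (f : U -> V -> W).
Hypothesis f_bilin : bilin f.

Let lift_ker x : tens_rel x -> free_ext (fun uv : U * V => f uv.1 uv.2) x = 0.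
Proof.
have fDl u u' v : f (u + u') v = f u v + f u' v.
  by have := f_bilin.1 v 1 u u'; rewrite !scale1r.
have fDr u v v' : f u (v + v') = f u v + f u v'.
  by have := f_bilin.2 u 1 v v'; rewrite !scale1r.
have f0l v : f 0 v = 0.
  by apply: (addrI (f 0 v)); rewrite -fDl !addr0.
have f0r u : f u 0 = 0.
  by apply: (addrI (f u 0)); rewrite -fDr !addr0.
case=> [u u' v | u v v' | a u v | a u v];
  rewrite !linearB ?linearZ /= !free_extU /=.
- by rewrite fDl addrAC addrK subrr.
- by rewrite fDr addrAC addrK subrr.
- by have := f_bilin.1 v a u 0; rewrite !addr0 /= f0l addr0 => ->; rewrite scalerN subrr.
- by have := f_bilin.2 u a v 0; rewrite !addr0 /= f0r addr0 => ->; rewrite scalerN subrr.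
Qed.

Lemma tens_liftE u v : tens_lift f (u ⊗t v) = f u v.
Proof. by rewrite tens_lift.unlock tensor.unlock quot_lift_class //= free_extU. Qed.

Lemma tens_lift_is_linear : linear (tens_lift f).
Proof. by rewrite tens_lift.unlock; apply: quot_lift_is_linear lift_ker. Qed.

End Lift.

Lemma tens_liftP U V W (f g h : U -> V -> W) a t :
  (forall u v, f u v = a *: g u v + h u v) ->
  tens_lift f t = a *: tens_lift g t + tens_lift h t.
Proof. by move=> fE; rewrite tens_lift.unlock !quot_liftE; apply: free_extP => -[u v]; apply: fE. Qed.

Lemma eq_tens_lift U V W (f g : U -> V -> W) t :
  (forall u v, f u v = g u v) -> tens_lift f t = tens_lift g t.
Proof. by move=> eqfg; rewrite tens_lift.unlock !quot_liftE; apply: eq_free_ext => -[u v]; apply: eqfg. Qed.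

Lemma linear_tens_lift U V W W' (f : U -> V -> W) (l : {linear W -> W'}) t :
  l (tens_lift f t) = tens_lift (fun u v => l (f u v)) t.
Proof. by rewrite tens_lift.unlock !quot_liftE linear_free_ext. Qed.

Lemma tens_lift_mull U V A (f : U -> V -> A) x t :
  x * tens_lift f t = tens_lift (fun u v => x * f u v) t.
Proof. by rewrite tens_lift.unlock !quot_liftE free_ext_mull. Qed.

Lemma tens_lift_mulr U V A (f : U -> V -> A) x t :
  tens_lift f t * x = tens_lift (fun u v => f u v * x) t.
Proof. by rewrite tens_lift.unlock !quot_liftE free_ext_mulr. Qed.

Lemma tens_bilin U V : bilin (@tensor k U V).
Proof.
by split=> [v a x y | u a x y]; rewrite ?(tensDl, tensDr) ?(tensZl, tensZr).
Qed.

Definition tens_map U V U' V' (f : U -> U') (g : V -> V') : U ⊗ V -> U' ⊗ V' :=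
  tens_lift (fun u v => f u ⊗t g v).

Lemma tens_map_bilin U V U' V' (f : {linear U -> U'}) (g : {linear V -> V'}) :
  bilin (fun u v => f u ⊗t g v).
Proof.
split=> [v a x y | u a x y]; rewrite linearP; first exact: (tens_bilin _ _).1.
exact: (tens_bilin _ _).2.
Qed.

Lemma tens_mapE U V U' V' (f : {linear U -> U'}) (g : {linear V -> V'}) u v :
  tens_map f g (u ⊗t v) = f u ⊗t g v.
Proof. exact/tens_liftE/tens_map_bilin. Qed.

HB.instance Definition _ U V U' V' (f : {linear U -> U'}) (g : {linear V -> V'}) :=
  GRing.isLinear.Build k (U ⊗ V) (U' ⊗ V') *:%R (tens_map f g)
    (tens_lift_is_linear (tens_map_bilin f g)).

Definition tens_swap U V : U ⊗ V -> V ⊗ U := tens_lift (fun u v => v ⊗t u).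

Lemma tens_swap_bilin U V : bilin (fun (u : U) (v : V) => v ⊗t u).
Proof. by have [bl br] := tens_bilin V U; split=> [v | u]; [exact: br | exact: bl]. Qed.

Lemma tens_swapE U V (u : U) (v : V) : tens_swap (u ⊗t v) = v ⊗t u.
Proof. exact/tens_liftE/tens_swap_bilin. Qed.

HB.instance Definition _ U V :=
  GRing.isLinear.Build k (U ⊗ V) (V ⊗ U) *:%R (@tens_swap U V)
    (tens_lift_is_linear (@tens_swap_bilin U V)).

Definition tens_assoc U V W : U ⊗ (V ⊗ W) -> (U ⊗ V) ⊗ W :=
  tens_lift (fun u => tens_lift (fun v w => (u ⊗t v) ⊗t w)).

Let assoc_bilin U V W (u : U) : bilin (fun (v : V) (w : W) => (u ⊗t v) ⊗t w).
Proof.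
split=> [w a x y | v a x y] /=; last exact: (tens_bilin _ _).2.
by rewrite (tens_bilin _ _).2 (tens_bilin _ _).1.
Qed.

Lemma tens_assoc_bilin U V W :
  bilin (fun u : U => tens_lift (fun (v : V) (w : W) => (u ⊗t v) ⊗t w)).
Proof.
split=> [t a x y | u] /=; last exact/tens_lift_is_linear/assoc_bilin.
by apply: tens_liftP => v w; rewrite !(tens_bilin _ _).1.
Qed.

Lemma tens_assocE U V W (u : U) (v : V) (w : W) :
  tens_assoc (u ⊗t (v ⊗t w)) = (u ⊗t v) ⊗t w.
Proof.
by rewrite /tens_assoc tens_liftE ?tens_liftE //; exact: tens_assoc_bilin.
Qed.

HB.instance Definition _ U V W :=
  GRing.isLinear.Build k (U ⊗ (V ⊗ W)) ((U ⊗ V) ⊗ W) *:%R (@tens_assoc U V W)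
    (tens_lift_is_linear (@tens_assoc_bilin U V W)).

End TensorTheory.

Arguments tens_swap {k} U V _.
Arguments tens_assoc {k} U V W _.

(* (u # c)(u' # c') = u v # d c', where v ⊗ d ranges over the terms of
   T (c ⊗ u'). *)
HB.lock Definition smash_mul (k : fieldType) (U C : algType k)
    (T : {linear C ⊗ U -> U ⊗ C}) (x y : U ⊗ C) : U ⊗ C :=
  tens_lift (fun (u : U) (c : C) =>
    tens_lift (fun (u' : U) (c' : C) =>
      tens_lift (fun (v : U) (d : C) => (u * v) ⊗t (d * c')) (T (c ⊗t u'))) y) x.
Arguments smash_mul {k U C} T x y.

Section SmashProduct.
Context {k : fieldType}.
Implicit Types A B : algType k.

Section Bilinearity.
Variables (U C : algType k) (T : {linear C ⊗ U -> U ⊗ C}).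

Let bil3 u c' : bilin (fun (v : U) (d : C) => (u * v) ⊗t (d * c')).
Proof.
split=> [d a x y | v a x y] /=.
  by rewrite mulrDr -scalerAr (tens_bilin _ _).1.
by rewrite mulrDl -scalerAl (tens_bilin _ _).2.
Qed.

Let mul3 u c u' c' :=
  tens_lift (fun (v : U) (d : C) => (u * v) ⊗t (d * c')) (T (c ⊗t u')).

Let bil2 u c : bilin (mul3 u c).
Proof.
split=> [c' a x y | u' a x y].
  by rewrite /mul3 (tens_bilin _ _).2 linearP; apply: (tens_lift_is_linear (bil3 _ _)).
by apply: tens_liftP => v d; rewrite mulrDr -scalerAr (tens_bilin _ _).2.
Qed.

Let bil1 y : bilin (fun u c => tens_lift (mul3 u c) y).
Proof.
split=> [c a x x' | u a x x'] /=; apply: tens_liftP => u' c'.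
  by apply: tens_liftP => v d; rewrite mulrDl -scalerAl (tens_bilin _ _).1.
by rewrite /mul3 (tens_bilin _ _).1 linearP; apply: (tens_lift_is_linear (bil3 _ _)).
Qed.

Lemma smash_mul_bilin : bilin (smash_mul T).
Proof.
rewrite smash_mul.unlock; split=> [y | x] /=; first exact: (tens_lift_is_linear (bil1 y)).
move=> a y y'; apply: tens_liftP => u c.
exact: (tens_lift_is_linear (bil2 u c)).
Qed.

Lemma smash_mulE u c u' c' : smash_mul T (u ⊗t c) (u' ⊗t c') =
  tens_lift (fun (v : U) (d : C) => (u * v) ⊗t (d * c')) (T (c ⊗t u')).
Proof. by rewrite smash_mul.unlock (tens_liftE (bil1 _)) (tens_liftE (bil2 _ _)). Qed.

End Bilinearity.

(* The usual product of the tensor product of two algebras. *)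
Definition tens_mul A B : A ⊗ B -> A ⊗ B -> A ⊗ B := smash_mul (tens_swap B A).

Lemma tens_mul_bilin A B : bilin (@tens_mul A B).
Proof. exact: smash_mul_bilin. Qed.

Lemma tens_mulE A B (a a' : A) (b b' : B) :
  tens_mul (a ⊗t b) (a' ⊗t b') = (a * a') ⊗t (b * b').
Proof.
rewrite /tens_mul smash_mulE /= tens_swapE tens_liftE //.
split=> [d c x y | v c x y] /=.
  by rewrite mulrDr -scalerAr (tens_bilin _ _).1.
by rewrite mulrDl -scalerAl (tens_bilin _ _).2.
Qed.

Lemma tens_mulA A B : associative (@tens_mul A B).
Proof.
have [bl br] := tens_mul_bilin A B.
have l2 (f : A ⊗ B -> A ⊗ B) x : linear f -> linear (fun y => tens_mul x (f y)).
  by move=> lf a u v; rewrite lf br.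
have l1 (f : A ⊗ B -> A ⊗ B) x : linear f -> linear (fun y => tens_mul (f y) x).
  by move=> lf a u v; rewrite lf bl.
move=> x y z; move: x.
apply: tens_linear_eq => [||a b]; [exact: l1 | by apply/l1/bl |].
move: y; apply: tens_linear_eq => [||a' b'].
- exact: (l2 (fun y => tens_mul y z) (a ⊗t b) (bl z)).
- exact: (l1 (tens_mul (a ⊗t b)) z (br _)).
move: z; apply: tens_linear_eq => [||a'' b''].
- exact: (l2 (tens_mul (a' ⊗t b')) (a ⊗t b) (br _)).
- exact: br.
by rewrite !tens_mulE !mulrA.
Qed.

Lemma tens_mul1 A B : left_id (1 ⊗t 1) (@tens_mul A B).
Proof.
apply: tens_linear_eq => [|//|a b]; first exact: (tens_mul_bilin _ _).2.
by rewrite tens_mulE !mul1r.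
Qed.

Lemma tens_mulr1 A B : right_id (1 ⊗t 1) (@tens_mul A B).
Proof.
apply: tens_linear_eq => [|//|a b]; first exact: (tens_mul_bilin _ _).1.
by rewrite tens_mulE !mulr1.
Qed.

End SmashProduct.

Section Bilinear.
Context {k : fieldType}.
Implicit Types (U V W : lmodType k) (A : algType k).

Lemma bilinC U V W (f : U -> V -> W) : bilin f -> bilin (fun v u => f u v).
Proof. by case. Qed.

Lemma bilinZ U V W (f : {linear U -> k^o}) (g : {linear V -> W}) :
  bilin (fun u v => f u *: g v).
Proof.
split=> [v a x y | u a x y]; rewrite linearP.
  by rewrite scalerDl scalerA.
by rewrite scalerDr !scalerA mulrC.
Qed.

Lemma bilinM U V A (f : {linear U -> A}) (g : {linear V -> A}) :
  bilin (fun u v => f u * g v).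
Proof.
split=> [v a x y | u a x y]; rewrite linearP.
  by rewrite mulrDl scalerAl.
by rewrite mulrDr scalerAr.
Qed.

End Bilinear.

(* {malg k[M]} only carries a product for the monoids of the class monomType,
   in which 1 has no nontrivial factorization. *)
Definition monoid_alg (k : fieldType) (M : monoidType) : Type := {malg k[M]}.

HB.instance Definition _ (k : fieldType) (M : monoidType) :=
  GRing.Lmodule.on (monoid_alg k M).

HB.lock Definition mbase (k : fieldType) (M : monoidType) (m : M) :
  monoid_alg k M := << m >>.
Arguments mbase k {M} m.

HB.lock Definition mext (k : fieldType) (M : monoidType) (W : lmodType k)
  (f : M -> W) (g : monoid_alg k M) : W := free_ext f g.
Arguments mext {k M W} f g.

HB.lock Definition monoid_alg_mul (k : fieldType) (M : monoidType)
    (g h : monoid_alg k M) : monoid_alg k M :=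
  mext (fun x => mext (fun y => mbase k (x * y)%g) h) g.
Arguments monoid_alg_mul {k M} g h.

Section MonoidAlgebra.
Context {k : fieldType} {M : monoidType}.
Local Notation monoid_alg := (monoid_alg k M).
Local Notation mbase := (mbase k).
Local Notation monoid_alg_mul := (@monoid_alg_mul k M).
Implicit Types (W : lmodType k) (x y : M).

Fact mext_is_linear W (f : M -> W) : linear (mext f).
Proof. by rewrite mext.unlock; apply: free_ext_is_linear. Qed.

HB.instance Definition _ W (f : M -> W) :=
  GRing.isLinear.Build k monoid_alg W *:%R (mext f) (mext_is_linear f).

Lemma mextE W (f : M -> W) x : mext f (mbase x) = f x.
Proof. by rewrite mext.unlock mbase.unlock free_extU. Qed.

Lemma mextP W (f f1 f2 : M -> W) a g : (forall x, f x = a *: f1 x + f2 x) ->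
  mext f g = a *: mext f1 g + mext f2 g.
Proof. by move=> fE; rewrite mext.unlock; apply: free_extP. Qed.

Let mulUU x y : monoid_alg_mul (mbase x) (mbase y) = mbase (x * y)%g.
Proof. by rewrite monoid_alg_mul.unlock !mextE. Qed.

Let mul_linl h : linear (monoid_alg_mul^~ h).
Proof. by move=> a g g'; rewrite monoid_alg_mul.unlock linearP. Qed.

Let mul_linr g : linear (monoid_alg_mul g).
Proof.
by move=> a h h'; rewrite monoid_alg_mul.unlock; apply: mextP => x; rewrite linearP.
Qed.

Lemma monoid_alg_linear_eq (W : lmodType k) (f1 f2 : monoid_alg -> W) :
  linear f1 -> linear f2 -> (forall x, f1 (mbase x) = f2 (mbase x)) -> f1 =1 f2.
Proof.
move=> lf1 lf2; pose F1 := GRing.isLinear.Build _ _ _ _ f1 lf1.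
pose F2 := GRing.isLinear.Build _ _ _ _ f2 lf2.
pose L1 : {linear {malg k[M]} -> W} := HB.pack f1 F1.
pose L2 : {linear {malg k[M]} -> W} := HB.pack f2 F2.
by rewrite mbase.unlock => /(@malg_linear_eq k M W L1 L2).
Qed.

Fact monoid_alg_mulA : associative monoid_alg_mul.
Proof.
move=> x y z; move: x; apply: monoid_alg_linear_eq => [||x].
- by move=> a u v; rewrite mul_linl.
- by move=> a u v; rewrite !mul_linl.
move: y; apply: monoid_alg_linear_eq => [||y].
- by move=> a u v; rewrite mul_linl mul_linr.
- by move=> a u v; rewrite mul_linr mul_linl.
move: z; apply: monoid_alg_linear_eq => [||z].
- by move=> a u v; rewrite !mul_linr.
- by move=> a u v; rewrite mul_linr.
by rewrite !mulUU mulgA.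
Qed.

Fact monoid_alg_mul1 : left_id (mbase (1%g : M)) monoid_alg_mul.
Proof.
by apply: monoid_alg_linear_eq => // x; rewrite mulUU mul1g.
Qed.

Fact monoid_alg_mulr1 : right_id (mbase (1%g : M)) monoid_alg_mul.
Proof.
by apply: monoid_alg_linear_eq => // x; rewrite mulUU mulg1.
Qed.

Fact monoid_alg_mulDl : left_distributive monoid_alg_mul +%R.
Proof. by move=> x y z; have := mul_linl z 1 x y; rewrite !scale1r. Qed.

Fact monoid_alg_mulDr : right_distributive monoid_alg_mul +%R.
Proof. by move=> x y z; have := mul_linr x 1 y z; rewrite !scale1r. Qed.

Fact monoid_alg_oner_neq0 : mbase (1%g : M) != 0.
Proof. by rewrite mbase.unlock monalgU_eq0 oner_eq0. Qed.

HB.instance Definition _ := GRing.Zmodule_isNzRing.Build monoid_alg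
  monoid_alg_mulA monoid_alg_mul1 monoid_alg_mulr1
  monoid_alg_mulDl monoid_alg_mulDr monoid_alg_oner_neq0.

Fact monoid_alg_scaleAl (a : k) (x y : monoid_alg) : a *: (x * y) = (a *: x) * y.
Proof.
have y0 : monoid_alg_mul 0 y = 0 := mul0r y.
by have := mul_linl y a x 0; rewrite y0 !addr0.
Qed.

HB.instance Definition _ :=
  GRing.Lmodule_isLalgebra.Build k monoid_alg monoid_alg_scaleAl.

Fact monoid_alg_scaleAr (a : k) (x y : monoid_alg) : a *: (x * y) = x * (a *: y).
Proof.
have x0 : monoid_alg_mul x 0 = 0 := mulr0 x.
by have := mul_linr x a y 0; rewrite x0 !addr0.
Qed.

HB.instance Definition _ :=
  GRing.Lalgebra_isAlgebra.Build k monoid_alg monoid_alg_scaleAr.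

Lemma mbaseM x y : mbase (x * y)%g = mbase x * mbase y.
Proof. by rewrite -mulUU. Qed.

Lemma mbase1 : mbase (1%g : M) = 1.
Proof. by []. Qed.

Lemma mext_monoid_morphism (A : algType k) (f : M -> A) :
  f 1%g = 1 -> {morph f : x y / (x * y)%g >-> x * y} -> monoid_morphism (mext f).
Proof.
move=> f1 fM; split=> [|x y]; first by rewrite -mbase1 mextE.
move: x; apply: monoid_alg_linear_eq => [||x].
- by move=> a u v; rewrite mulrDl -scalerAl linearP.
- by move=> a u v; rewrite linearP mulrDl -scalerAl.
move: y; apply: monoid_alg_linear_eq => [||y].
- by move=> a u v; rewrite mulrDr -scalerAr linearP.
- by move=> a u v; rewrite linearP mulrDr -scalerAr.
by rewrite -mbaseM !mextE fM.
Qed.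

End MonoidAlgebra.

Definition free_monoid (X : choiceType) : Type := seq X.

HB.instance Definition _ (X : choiceType) := Choice.on (free_monoid X).
HB.instance Definition _ (X : choiceType) := isMonoid.Build (free_monoid X)
  (@catA X) (@cat0s X) (@cats0 X).

Section TensorAlgebra.
Context {k : fieldType}.
Implicit Types (V : lmodType k) (A : algType k).

Definition free_alg V : Type := monoid_alg k (free_monoid V).

HB.instance Definition _ V := GRing.Algebra.on (free_alg V).

Definition free_gen V (v : V) : free_alg V := mbase k ([:: v] : free_monoid V).

Definition free_lift V A (f : V -> A) : free_alg V -> A :=
  mext (fun s : free_monoid V => \prod_(v <- s) f v).

HB.instance Definition _ V A (f : V -> A) := GRing.Linear.copy (free_lift f)
  (mext (fun s : free_monoid V => \prod_(v <- s) f v)).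

Fact free_lift_is_monoid_morphism V A (f : V -> A) : monoid_morphism (free_lift f).
Proof.
apply: mext_monoid_morphism => [|s t]; first by rewrite big_nil.
by rewrite big_cat.
Qed.

HB.instance Definition _ V A (f : V -> A) := GRing.isMonoidMorphism.Build
  (free_alg V) A (free_lift f) (free_lift_is_monoid_morphism f).

Lemma free_liftE V A (f : V -> A) v : free_lift f (free_gen v) = f v.
Proof. by rewrite /free_lift mextE big_seq1. Qed.

(* The tensor algebra, as the quotient of the free algebra on the set V that
   makes the inclusion of V linear. *)
Inductive talg_rel V : free_alg V -> Prop :=
| TalgD u v : talg_rel (free_gen (u + v) - free_gen u - free_gen v)
| TalgZ a v : talg_rel (free_gen (a *: v) - a *: free_gen v).

Fact talg_rel_ker V A (f : {linear V -> A}) x :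
  talg_rel x -> free_lift f x = 0.
Proof.
case=> [u v | a v]; rewrite !linearB ?linearZ /= !free_liftE.
  by rewrite linearD addrAC addrK subrr.
by rewrite linearZ /= ?scalerN subrr.
Qed.

Fact talg_rel_proper V : proper_rel (@talg_rel V).
Proof. exact: proper_rel_ker (@talg_rel_ker V k^o \0). Qed.

Definition talg V : Type := quotalg (@talg_rel_proper V).

HB.instance Definition _ V := GRing.Algebra.on (talg V).

Definition talg_gen V (v : V) : talg V := alg_class (@talg_rel_proper V) (free_gen v).

Fact talg_gen_is_linear V : linear (@talg_gen V).
Proof.
have genD (u v : V) : talg_gen (u + v) = talg_gen u + talg_gen v.
  have /(alg_class0 (@talg_rel_proper V)) := TalgD u v; rewrite !linearB /= => /eqP.
  by rewrite -addrA -opprD subr_eq0 => /eqP.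
have genZ a (v : V) : talg_gen (a *: v) = a *: talg_gen v.
  have /(alg_class0 (@talg_rel_proper V)) := TalgZ a v; rewrite linearB linearZ /= => /eqP.
  by rewrite subr_eq0 => /eqP.
by move=> a u v; rewrite genD genZ.
Qed.

HB.instance Definition _ V := GRing.isLinear.Build k V (talg V) *:%R
  (@talg_gen V) (@talg_gen_is_linear V).

Definition talg_lift V A (f : {linear V -> A}) : talg V -> A :=
  alg_lift (properS := @talg_rel_proper V) (@talg_rel_ker V A f).

HB.instance Definition _ V A (f : {linear V -> A}) :=
  GRing.LRMorphism.copy (talg_lift f)
    (alg_lift (properS := @talg_rel_proper V) (@talg_rel_ker V A f)).

Lemma talg_liftE V A (f : {linear V -> A}) v : talg_lift f (talg_gen v) = f v.
Proof. by rewrite /talg_lift alg_liftE /= free_liftE. Qed.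

End TensorAlgebra.

HB.mixin Record Algebra_isHopf (k : fieldType) H of GRing.Algebra k H := {
  comul : {linear H -> H ⊗ H};
  counit : {lrmorphism H -> k^o};
  antipode : {linear H -> H};
  comul1 : comul 1 = 1 ⊗t 1;
  comulM : forall x y, comul (x * y) = tens_mul (comul x) (comul y);
  comulA : forall x,
    tens_assoc H H H (tens_map idfun comul (comul x)) =
    tens_map comul idfun (comul x);
  counitl : forall x, tens_lift (fun a b => counit a *: b) (comul x) = x;
  counitr : forall x, tens_lift (fun a b => counit b *: a) (comul x) = x;
  antipodel : forall x,
    tens_lift (fun a b => antipode a * b) (comul x) = counit x *: 1;
  antipoder : forall x,
    tens_lift (fun a b => a * antipode b) (comul x) = counit x *: 1
}.

#[short(type="hopfAlgType")]
HB.structure Definition HopfAlgebra (k : fieldType) :=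
  {H of GRing.Algebra k H & Algebra_isHopf k H}.

Definition cocommutative (k : fieldType) (H : hopfAlgType k) : Prop :=
  forall x : H, tens_swap H H (comul x) = comul x.

Section GroupHopf.
Context (k : fieldType) (G : groupType).
Local Notation kG := (monoid_alg k G).
Local Notation base := (mbase k).

Definition group_comul : kG -> kG ⊗ kG := mext (fun g => base g ⊗t base g).
Definition group_counit : kG -> k^o := mext (fun _ => 1).
Definition group_antipode : kG -> kG := mext (fun g => base g^-1%g).

HB.instance Definition _ := GRing.Linear.copy group_comul
  (mext (fun g => base g ⊗t base g)).
HB.instance Definition _ := GRing.Linear.copy group_counit (mext (fun _ => 1)).
HB.instance Definition _ := GRing.Linear.copy group_antipode
  (mext (fun g => base g^-1%g)).

Fact group_counit_monoid_morphism : monoid_morphism group_counit.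
Proof. by apply: mext_monoid_morphism => // x y; rewrite mulr1. Qed.

HB.instance Definition _ := GRing.isMonoidMorphism.Build kG k^o group_counit
  group_counit_monoid_morphism.

Let comulE g : group_comul (base g) = base g ⊗t base g.
Proof. exact: mextE. Qed.
Let counitE g : group_counit (base g) = 1.
Proof. exact: mextE. Qed.
Let antipodeE g : group_antipode (base g) = base g^-1%g.
Proof. exact: mextE. Qed.

Fact group_comul1 : group_comul 1 = 1 ⊗t 1.
Proof. by rewrite -mbase1 comulE. Qed.

Fact group_comulM x y : group_comul (x * y) = tens_mul (group_comul x) (group_comul y).
Proof.
have [bl br] := @tens_mul_bilin k kG kG.
move: x; apply: monoid_alg_linear_eq => [||x].
- by move=> a u v; rewrite mulrDl -scalerAl linearP.
- by move=> a u v; rewrite linearP bl.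
move: y; apply: monoid_alg_linear_eq => [||y].
- by move=> a u v; rewrite mulrDr -scalerAr linearP.
- by move=> a u v; rewrite linearP br.
by rewrite -mbaseM !comulE tens_mulE -mbaseM.
Qed.

Fact group_comulA x :
  tens_assoc kG kG kG (tens_map idfun group_comul (group_comul x)) =
  tens_map group_comul idfun (group_comul x).
Proof.
move: x; apply: monoid_alg_linear_eq => [a u v|a u v|x]; rewrite ?linearP //.
by rewrite !comulE !tens_mapE /= !comulE tens_assocE.
Qed.

Let tens_lift_comul_linear (W : lmodType k) (f : kG -> kG -> W) :
  bilin f -> linear (fun x => tens_lift f (group_comul x)).
Proof. by move=> bf a u v; rewrite linearP; apply: tens_lift_is_linear. Qed.

Let bilinZl : bilin (fun a b : kG => group_counit a *: b).
Proof. exact: (bilinZ group_counit idfun). Qed.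

Let bilinZr : bilin (fun a b : kG => group_counit b *: a).
Proof. exact/bilinC/(bilinZ group_counit idfun). Qed.

Let bilinSl : bilin (fun a b : kG => group_antipode a * b).
Proof. exact: (bilinM group_antipode idfun). Qed.

Let bilinSr : bilin (fun a b : kG => a * group_antipode b).
Proof. exact: (bilinM idfun group_antipode). Qed.

Fact group_counitl x : tens_lift (fun a b => group_counit a *: b) (group_comul x) = x.
Proof.
move: x; apply: monoid_alg_linear_eq => [|//|x].
  exact: (tens_lift_comul_linear bilinZl).
by rewrite comulE (tens_liftE bilinZl) counitE scale1r.
Qed.

Fact group_counitr x : tens_lift (fun a b => group_counit b *: a) (group_comul x) = x.
Proof.
move: x; apply: monoid_alg_linear_eq => [|//|x].
  exact: (tens_lift_comul_linear bilinZr).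
by rewrite comulE (tens_liftE bilinZr) counitE scale1r.
Qed.

Fact group_antipodel x :
  tens_lift (fun a b => group_antipode a * b) (group_comul x) = group_counit x *: (1 : kG).
Proof.
move: x; apply: monoid_alg_linear_eq => [|a u v|x].
- exact: (tens_lift_comul_linear bilinSl).
- by rewrite linearP scalerDl scalerA.
by rewrite comulE (tens_liftE bilinSl) antipodeE counitE -mbaseM mulVg scale1r.
Qed.

Fact group_antipoder x :
  tens_lift (fun a b => a * group_antipode b) (group_comul x) = group_counit x *: (1 : kG).
Proof.
move: x; apply: monoid_alg_linear_eq => [|a u v|x].
- exact: (tens_lift_comul_linear bilinSr).
- by rewrite linearP scalerDl scalerA.
by rewrite comulE (tens_liftE bilinSr) antipodeE counitE -mbaseM mulgV scale1r.
Qed.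

HB.instance Definition _ := Algebra_isHopf.Build k (monoid_alg k G)
  group_comul1 group_comulM group_comulA group_counitl group_counitr
  group_antipodel group_antipoder.

End GroupHopf.

Section Grouplike.
Context {k : fieldType} {H : hopfAlgType k}.

Definition is_grouplike : pred H :=
  fun g => (comul g == g ⊗t g) && (counit g == 1).

Lemma grouplikeP g : reflect (comul g = g ⊗t g /\ counit g = 1) (is_grouplike g).
Proof. by apply: (iffP andP) => -[/eqP ? /eqP ?]. Qed.

Record grouplike := Grouplike { gval :> H; gvalP : is_grouplike gval }.

HB.instance Definition _ := [isSub for gval].
HB.instance Definition _ := [Choice of grouplike by <:].

Let bilinSl : bilin (fun a b : H => antipode a * b).
Proof. exact: (bilinM antipode idfun). Qed.

Let bilinSr : bilin (fun a b : H => a * antipode b).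
Proof. exact: (bilinM idfun antipode). Qed.

Let mulSg g : is_grouplike g -> antipode g * g = 1.
Proof.
by case/grouplikeP=> Dg eg; have := antipodel g; rewrite Dg tens_liftE // eg scale1r.
Qed.

Let mulgS g : is_grouplike g -> g * antipode g = 1.
Proof.
by case/grouplikeP=> Dg eg; have := antipoder g; rewrite Dg tens_liftE // eg scale1r.
Qed.

Fact grouplike1 : is_grouplike 1.
Proof. by apply/grouplikeP; rewrite comul1 rmorph1. Qed.

Fact grouplikeM g h : is_grouplike g -> is_grouplike h -> is_grouplike (g * h).
Proof.
move=> /grouplikeP[Dg eg] /grouplikeP[Dh eh]; apply/grouplikeP.
by rewrite comulM Dg Dh tens_mulE rmorphM /= eg eh mulr1.
Qed.

Fact grouplikeV g : is_grouplike g -> is_grouplike (antipode g).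
Proof.
move=> Gg; have /grouplikeP[Dg eg] := Gg; apply/grouplikeP; split; last first.
  by have := congr1 counit (mulSg Gg); rewrite rmorphM rmorph1 /= eg mulr1.
have DSg : tens_mul (comul (antipode g)) (g ⊗t g) = 1 ⊗t 1.
  by rewrite -Dg -comulM mulSg // comul1.
rewrite -[LHS]tens_mulr1 -[X in X ⊗t _](mulgS Gg) -[X in _ ⊗t X](mulgS Gg).
by rewrite -tens_mulE tens_mulA DSg tens_mul1.
Qed.

Let mul (g h : grouplike) := Grouplike (grouplikeM (gvalP g) (gvalP h)).
Let inv (g : grouplike) := Grouplike (grouplikeV (gvalP g)).

Fact grouplike_mulA : associative mul.
Proof. by move=> g h l; apply: val_inj; rewrite /= mulrA. Qed.
Fact grouplike_mul1 : left_id (Grouplike grouplike1) mul.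
Proof. by move=> g; apply: val_inj; rewrite /= mul1r. Qed.
Fact grouplike_mulr1 : right_id (Grouplike grouplike1) mul.
Proof. by move=> g; apply: val_inj; rewrite /= mulr1. Qed.
Fact grouplike_mulV : left_inverse (Grouplike grouplike1) inv mul.
Proof. by move=> g; apply: val_inj; rewrite /= mulSg ?gvalP. Qed.
Fact grouplike_mulrV : right_inverse (Grouplike grouplike1) inv mul.
Proof. by move=> g; apply: val_inj; rewrite /= mulgS ?gvalP. Qed.

HB.instance Definition _ := isGroup.Build grouplike
  grouplike_mulA grouplike_mul1 grouplike_mulr1 grouplike_mulV grouplike_mulrV.

End Grouplike.

Arguments grouplike {k} H.

HB.mixin Record Lmodule_isLie (k : fieldType) L of GRing.Lmodule k L := {
  lie_bracket : L -> L -> L;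
  lie_bilin : bilin lie_bracket;
  lie_xx : forall x, lie_bracket x x = 0;
  lie_jacobi : forall x y z,
    lie_bracket x (lie_bracket y z) + lie_bracket y (lie_bracket z x)
      + lie_bracket z (lie_bracket x y) = 0
}.

#[short(type="lieAlgType")]
HB.structure Definition LieAlgebra (k : fieldType) :=
  {L of GRing.Lmodule k L & Lmodule_isLie k L}.

Section Primitive.
Context {k : fieldType} {H : hopfAlgType k}.

Definition is_primitive : pred H :=
  fun x => comul x == x ⊗t 1 + 1 ⊗t x.

Fact primitive_submod_closed : submod_closed is_primitive.
Proof.
split=> [|a x y /eqP Dx /eqP Dy].
  by rewrite unfold_in /is_primitive linear0 -(scale0r (0 : H)) tensZl tensZr
    !scale0r addr0.
by rewrite unfold_in /is_primitive linearP Dx Dy !(tensDl, tensDr) !(tensZl, tensZr)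
  scalerDr addrACA.
Qed.

HB.instance Definition _ :=
  GRing.isSubmodClosed.Build k H is_primitive primitive_submod_closed.

Record primitive := Primitive { pval :> H; pvalP : is_primitive pval }.

HB.instance Definition _ := [isSub for pval].
HB.instance Definition _ := [Choice of primitive by <:].
HB.instance Definition _ := [SubChoice_isSubLmodule of primitive by <:].

Fact primitive_bracket (x y : primitive) : is_primitive (pval x * pval y - pval y * pval x).
Proof.
case: x y => [x /= /eqP Dx] [y /= /eqP Dy]; apply/eqP.
have [bl br] := @tens_mul_bilin k H H.
have Dl u v w : tens_mul (u + v) w = tens_mul u w + tens_mul v w :> H ⊗ H.
  by have := bl w 1 u v; rewrite !scale1r.
have Dr u v w : tens_mul w (u + v) = tens_mul w u + tens_mul w v :> H ⊗ H.
  by have := br w 1 u v; rewrite !scale1r.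
rewrite linearB !comulM Dx Dy !Dl !Dr !tens_mulE !mulr1 !mul1r.
rewrite -[- (y * x)]scaleN1r tensDl tensDr tensZl tensZr !scaleN1r.
set a := _ ⊗t 1; set b := x ⊗t y; set c := y ⊗t x; set d := 1 ⊗t _.
set a' := _ ⊗t 1; set d' := 1 ⊗t (y * x).
rewrite !opprD !addrA (AC 8%AC (1*5*4*8*2*7*3*6)%AC) /=.
by rewrite !addrK.
Qed.

Definition primitive_lie (x y : primitive) : primitive := Primitive (primitive_bracket x y).

End Primitive.

Arguments primitive {k} H.

Section PrimitiveLie.
Context {k : fieldType} {H : hopfAlgType k}.

Fact primitive_lie_bilin : bilin (@primitive_lie k H).
Proof.
split=> [z a x y | z a x y]; apply: val_inj; rewrite /= mulrDr mulrDl.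
  by rewrite -!scalerAl -!scalerAr scalerBr opprD addrACA.
by rewrite -!scalerAl -!scalerAr scalerBr opprD addrACA.
Qed.

Fact primitive_lie_xx (x : primitive H) : primitive_lie x x = 0.
Proof. by apply: val_inj; rewrite /= subrr. Qed.

Fact primitive_lie_jacobi (x y z : primitive H) :
  primitive_lie x (primitive_lie y z) + primitive_lie y (primitive_lie z x)
    + primitive_lie z (primitive_lie x y) = 0.
Proof.
apply: val_inj; rewrite /= !(mulrBl, mulrBr) !mulrA !opprB !addrA.
rewrite (AC 12%AC (1*12*7*2*3*10*5*4*11*6*9*8)%AC) /=.
by rewrite !addrK subrr.
Qed.

HB.instance Definition _ := Lmodule_isLie.Build k (primitive H)
  primitive_lie_bilin primitive_lie_xx primitive_lie_jacobi.

End PrimitiveLie.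

Section EnvelopingAlgebra.
Context {k : fieldType}.
Implicit Types (L : lieAlgType k) (A : algType k).

Inductive uea_rel L : talg L -> Prop :=
| UeaRel x y : uea_rel (talg_gen x * talg_gen y - talg_gen y * talg_gen x
                        - talg_gen (lie_bracket x y)).

Fact uea_rel_ker L A (f : {linear L -> A}) :
  (forall x y, f (lie_bracket x y) = f x * f y - f y * f x) ->
  forall t, uea_rel t -> talg_lift f t = 0.
Proof.
by move=> fL _ [x y]; rewrite !linearB /= !rmorphM /= !talg_liftE fL subrr.
Qed.

Fact uea_rel_proper L : proper_rel (@uea_rel L).
Proof.
apply: (@proper_rel_ker _ _ _ k^o (talg_lift \0)); apply: uea_rel_ker => x y /=.
by rewrite mulr0 subrr.
Qed.

Definition uea L : Type := quotalg (@uea_rel_proper L).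

HB.instance Definition _ L := GRing.Algebra.on (uea L).

Definition uea_gen L (x : L) : uea L := alg_class (@uea_rel_proper L) (talg_gen x).

HB.instance Definition _ L := GRing.Linear.copy (@uea_gen L)
  (alg_class (@uea_rel_proper L) \o @talg_gen k L).

Definition uea_lift L A (f : {linear L -> A})
    (fL : forall x y, f (lie_bracket x y) = f x * f y - f y * f x) : uea L -> A :=
  alg_lift (properS := @uea_rel_proper L) (uea_rel_ker fL).

HB.instance Definition _ L A (f : {linear L -> A}) fL :=
  GRing.LRMorphism.copy (@uea_lift L A f fL)
    (alg_lift (properS := @uea_rel_proper L) (uea_rel_ker fL)).

Lemma uea_liftE L A (f : {linear L -> A}) fL x :
  @uea_lift L A f fL (uea_gen x) = f x.
Proof. by rewrite /uea_lift alg_liftE /= talg_liftE. Qed.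

End EnvelopingAlgebra.

Section PrimitiveEnveloping.
Context {k : fieldType} (H : hopfAlgType k).

HB.instance Definition _ := GRing.Linear.copy (@pval k H) (val : primitive H -> H).

Fact pval_bracket (x y : primitive H) :
  pval (lie_bracket x y) = pval x * pval y - pval y * pval x.
Proof. by []. Qed.

(* The canonical morphism U(g) -> H extending the inclusion of g; its image is
   the subalgebra of H generated by g. *)
Definition uea_incl : uea (primitive H) -> H := uea_lift pval_bracket.

HB.instance Definition _ := GRing.LRMorphism.copy uea_incl (uea_lift pval_bracket).

End PrimitiveEnveloping.

Arguments uea_incl {k} H _.

Section PartialHopf.
Context {k : fieldType}.
Implicit Type H : hopfAlgType k.

(* In Sweedler notation, with x standing for k:
     1_H = 1,
     h ⊗ k_(1) ⊗ S(k_(2)) = h k_(1) ⊗ S(k_(2)),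
     h_(1) ⊗ S(h_(2)) ⊗ k = h_(1) ⊗ S(h_(2)) k. *)
Inductive par_rel H : talg H -> Prop :=
| ParOne : par_rel (talg_gen (1 : H) - 1)
| ParRight (h x : H) : par_rel (
    talg_gen h *
      tens_lift (fun a b => talg_gen a * talg_gen (antipode b)) (comul x)
    - tens_lift (fun a b => talg_gen (h * a) * talg_gen (antipode b)) (comul x))
| ParLeft (h x : H) : par_rel (
    tens_lift (fun a b => talg_gen a * talg_gen (antipode b)) (comul h) *
      talg_gen x
    - tens_lift (fun a b => talg_gen a * talg_gen (antipode b * x)) (comul h)).

Fact par_rel_ker H t : par_rel t -> talg_lift (@counit k H) t = 0.
Proof.
case=> [|h x|h x].
- by rewrite linearB /= talg_liftE !rmorph1 subrr.
- apply/eqP; rewrite linearB subr_eq0; apply/eqP.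
  rewrite rmorphM /= talg_liftE !linear_tens_lift tens_lift_mull.
  apply: eq_tens_lift => a b.
  by rewrite !rmorphM /= !talg_liftE !rmorphM mulrA.
- apply/eqP; rewrite linearB subr_eq0; apply/eqP.
  rewrite rmorphM /= talg_liftE !linear_tens_lift tens_lift_mulr.
  apply: eq_tens_lift => a b.
  by rewrite !rmorphM /= !talg_liftE !rmorphM mulrA.
Qed.

Fact par_rel_proper H : proper_rel (@par_rel H).
Proof. exact: proper_rel_ker (@par_rel_ker H). Qed.

Definition par_hopf H : Type := quotalg (@par_rel_proper H).

HB.instance Definition _ H := GRing.Algebra.on (par_hopf H).

Definition par_class H (h : H) : par_hopf H :=
  alg_class (@par_rel_proper H) (talg_gen h).

HB.instance Definition _ H := GRing.Linear.copy (@par_class H)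
  (alg_class (@par_rel_proper H) \o @talg_gen k H).

End PartialHopf.

Notation par_group_alg k G := (par_hopf (monoid_alg k G)).

Definition par_group_class (k : fieldType) (G : groupType) (g : G) :
  par_group_alg k G := par_class (mbase k g).

(* Main.v *)
(** Cartier-Kostant: the functionals f on H act by the locally finite commuting operators
    h |-> f(h_(1)) h_(2), whose weights are the grouplike elements, so H is the direct sum
    of its generalized weight spaces H^1 g. On H^1 the first Eulerian idempotent
    log(id) takes primitive values, whence U(g) -> H^1 is onto; it is injective because U(g)
    is spanned by the powers x^n, on which the convolution powers of a projection H -> g
    provide a left inverse. Hence H = U(g) # kG.

    In H_par the relations give [x][h] = [xh] and [h][x] = [hx] for x primitive, so the map
    psi(u # c) = u c from U(g) # k_par G to H_par is onto and turns the smash product into the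
    product of H_par. It is inverted by composing the algebra map
    H_par -> H (x) k_par G, [u g] |-> u g (x) [g], with the projection u g |-> u of H onto U(g). *)
Require Import Defs.
From HB Require Import structures.
From mathcomp Require Import all_boot all_order all_algebra.
From mathcomp Require Import finmap monalg boolp classical_sets.

Set Implicit Arguments.
Unset Strict Implicit.
Unset Printing Implicit Defensive.

Import GRing.Theory.
Local Open Scope ring_scope.
(* all_algebra also exports vector.span. *)
Local Notation span := Defs.span.

(** No bases are chosen. Functionals come from Zorn's lemma, and a tensor is tested by contracting
    its left factor with all of them. Thus [act f g = f(g) g] for every [f] says exactly that
    [comul g = g ⊗ g], which is why weights are grouplike. Algebraic closure serves to split a
    characteristic polynomial; characteristic 0 serves to compare polynomials in n through their
    values at all naturals, and to divide by n + 1 and n!. On the partial side, the words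
    [g_1]...[g_n] span k_par G but satisfy linear relations, so the formula for T cannot be taken as
    its definition. Instead T (c ⊗ u) is the image in U(g) ⊗ k_par G of the product c u formed in
    H_par, and the formula becomes a computation. The map u g |-> u g ⊗ [g] on H is in general not
    multiplicative; it satisfies the relations of H_par because the classes [g] do and because
    coproduct and antipode respect the components U(g) g. *)

Definition linear_of (k : fieldType) (U V : lmodType k) (f : U -> V)
    (lf : linear f) : {linear U -> V} :=
  HB.pack f (GRing.isLinear.Build k U V *:%R f lf).

(** * Subspaces and linear functionals *)

Section Subspaces.
Context {k : fieldType} {V : lmodType k}.
Implicit Types (P W X : V -> Prop).

Definition subspace P := P 0 /\ forall a x y, P x -> P y -> P (a *: x + y).

Lemma subspace0 P : subspace P -> P 0. Proof. by case. Qed.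

Lemma subspaceD P x y : subspace P -> P x -> P y -> P (x + y).
Proof. by case=> _ h Px Py; rewrite -[x]scale1r; apply: h. Qed.

Lemma subspaceZ P a x : subspace P -> P x -> P (a *: x).
Proof. by case=> P0 h Px; rewrite -[_ *: x]addr0; apply: h. Qed.

Lemma subspaceN P x : subspace P -> P x -> P (- x).
Proof. by move=> sP Px; rewrite -scaleN1r; apply: subspaceZ. Qed.

Lemma subspaceB P x y : subspace P -> P x -> P y -> P (x - y).
Proof. by move=> sP Px Py; apply: subspaceD => //; apply: subspaceN. Qed.

Lemma subspace_sum P (I : Type) (r : seq I) (Q : pred I) (F : I -> V) :
  subspace P -> (forall i, Q i -> P (F i)) -> P (\sum_(i <- r | Q i) F i).
Proof.
move=> sP PF; apply: (big_ind P) => //; first exact: subspace0.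
by move=> x y; apply: subspaceD.
Qed.

Lemma span_subspace P : subspace (span P).
Proof.
split=> [|a x y sx sy]; first exact: SpanNil.
by apply: spanD => //; apply: spanZ.
Qed.

Lemma span_min P W x : subspace W -> (forall y, P y -> W y) -> span P x -> W x.
Proof.
move=> sW PW; elim=> [|a y z Py _ Wz]; first exact: subspace0.
by apply: sW.2 => //; apply: PW.
Qed.

Lemma span_mono P W x : span P x -> (forall y, P y -> span W y) -> span W x.
Proof. by move=> Px PW; apply: span_min Px; first exact: span_subspace. Qed.

Lemma subspace_eq0 : subspace (fun x => x = 0).
Proof. by split=> // a x y -> ->; rewrite scaler0 addr0. Qed.

Lemma eq_subspace (U : lmodType k) (f1 f2 : {linear V -> U}) :
  subspace (fun x => f1 x = f2 x).
Proof. by split=> [|a x y Ex Ey]; rewrite ?linear0 // !linearP Ex Ey. Qed.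

Local Open Scope classical_set_scope.

(* By Zorn, W' is maximal among the subspaces containing W and meeting X trivially. *)
Lemma projection_exists X W : subspace X -> subspace W ->
    (forall x, X x -> W x -> x = 0) ->
  exists p : {linear V -> V},
    [/\ forall v, X (p v), forall x, X x -> p x = x & forall w, W w -> p w = 0].
Proof.
move=> sX sW XW0.
(* Zorn's lemma runs over generating sets [A] rather than subspaces, so a union of a chain needs no
   closure: a vector it spans is spanned by [W] alone or by one member of the chain and [W]. *)
pose ok (A : set V) := forall v, span (A `|` W) v -> X v -> v = 0.
have [|A [okA maxA]] := @Zorn_bigcup V ok.
  move=> F okF totF v sv Xv.
  have [sWv | [A FA sAv]] :
      span W v \/ exists2 A, F A & span (A `|` W) v.
  - elim: sv => [|a x y FWx _ IHy]; first by left; apply: SpanNil.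
    case: FWx => [[A FA Ax] | Wx].
      right; case: IHy => [sy | [B FB sBy]].
        exists A => //; apply: SpanCons; first by left.
        by refine (span_mono sy _) => z Wz; apply: spanS; right.
      case: (totF _ _ FA FB) => AB.
        exists B => //; apply: SpanCons => //; left; exact: AB.
      exists A => //; apply: SpanCons; first by left.
      by refine (span_mono sBy _) => z [/AB Az|Wz]; apply: spanS; [left|right].
    case: IHy => [sy | [B FB sBy]]; [left | right; exists B => //];
      by apply: SpanCons => //; right.
  - by apply: XW0 => //; apply: span_min sWv.
  - exact: okF FA v sAv Xv.
pose W' := span (A `|` W).
have sW' : subspace W' by apply: span_subspace.
(* For [v] outside [A], maximality yields a nonzero [y = c *: v + w] in [X], and [c != 0] because
   [X] meets [W'] trivially. *)
have dec v : exists x, X x /\ W' (v - x).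
  have [Av | nAv] := pselect (A v).
    exists 0; split; first exact: subspace0.
    by rewrite subr0; apply: spanS; left.
  have /existsNP[y] : ~ ok (A `|` [set v]).
    by apply: maxA; split=> [z Az|]; [left | move=> /(_ v) h; apply/nAv/h; right].
  move=> /not_implyP[sy] /not_implyP[Xy /eqP y0].
  have [c [w [yE Ww]]] : exists c w, y = c *: v + w /\ W' w.
    elim: sy => [|a x z Sx _ [c [w [-> Ww]]]].
      by exists 0, 0; rewrite scale0r addr0; split=> //; apply: SpanNil.
    case: Sx => [[Ax | ->] | Wx].
    - exists c, (a *: x + w); rewrite addrCA; split=> //.
      by apply: SpanCons => //; left.
    - by exists (a + c), w; rewrite scalerDl addrA.
    - exists c, (a *: x + w); rewrite addrCA; split=> //.
      by apply: SpanCons => //; right.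
  have c0 : c != 0.
    apply/eqP => c0; case/eqP: y0; apply: okA => //.
    by rewrite yE c0 scale0r add0r.
  exists (c^-1 *: y); split; first exact: subspaceZ.
  by rewrite yE scalerDr scalerA mulVf // scale1r opprD addrA subrr add0r;
    apply/spanN/spanZ.
have [p pP] := choice dec.
have uniq_p v x : X x -> W' (v - x) -> p v = x.
  move=> Xx Wx; have [Xp Wp] := pP v; apply/eqP; rewrite -subr_eq0; apply/eqP.
  apply: okA; last exact: subspaceB.
  have -> : p v - x = (v - x) - (v - p v) by rewrite opprB [_ - v]addrC addrACA subrr add0r addrC.
  exact: subspaceB.
have lp : linear p.
  move=> a x y; have [Xx Wx] := pP x; have [Xy Wy] := pP y.
  apply: uniq_p; first exact: sX.2.
  by rewrite opprD addrACA -scalerBr; apply: sW'.2.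
exists (linear_of lp); split=> /= [v|x Xx|w Ww].
- by have [] := pP v.
- by apply: uniq_p => //; rewrite subrr; apply: SpanNil.
- by apply: uniq_p; [exact: subspace0 | rewrite subr0; apply: spanS; right].
Qed.

(** The coordinate of a projection onto the line of [x] that kills [W]. *)
Lemma functional_exists W x : subspace W -> ~ W x ->
  exists f : {linear V -> k^o}, f x = 1 /\ forall w, W w -> f w = 0.
Proof.
move=> sW Wx; pose X y := exists a : k, y = a *: x.
have x0 : x != 0 by apply/eqP => x0; apply: Wx; rewrite x0; apply: subspace0.
have sX : subspace X.
  split=> [|a y z [b ->] [c ->]]; first by exists 0; rewrite scale0r.
  by exists (a * b + c); rewrite scalerDl scalerA.
have [|p [pX pid p0]] := projection_exists sX sW.
  move=> _ [a ->] Wax; have [-> | a0] := eqVneq a 0; first by rewrite scale0r.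
  case: Wx; rewrite -[x]scale1r -(mulVf a0) -scalerA; exact: subspaceZ.
have [f fE] := choice pX.
have injx a b : a *: x = b *: x -> a = b.
  move/eqP; rewrite -subr_eq0 -scalerBl scaler_eq0 (negPf x0) orbF subr_eq0.
  exact/eqP.
have lf : linear (f : V -> k^o).
  by move=> a y z; apply: injx; rewrite -fE linearP !fE scalerA -scalerDl.
exists (linear_of lf); split=> [|w Ww] /=; apply: injx; rewrite -fE.
  by rewrite pid ?scale1r //; exists 1; rewrite scale1r.
by rewrite p0 // scale0r.
Qed.

Lemma functional_sep x : (forall f : {linear V -> k^o}, f x = 0) -> x = 0.
Proof.
move=> f0; apply: contrapT => x0.
have [f [f1 _]] := functional_exists subspace_eq0 x0.
by have /eqP := f0 f; rewrite f1 oner_eq0.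
Qed.

Lemma functional_inj x y : (forall f : {linear V -> k^o}, f x = f y) -> x = y.
Proof.
move=> fxy; apply/eqP; rewrite -subr_eq0; apply/eqP/functional_sep => f.
by rewrite linearB fxy subrr.
Qed.

(** Applied to the left factors of [comul h], this leaves finitely many operators [act f] to study.
    The index type is nonempty because square matrices form a ring only in positive size. *)
Lemma functional_fin (s : seq V) : exists n (fs : 'I_n.+1 -> {linear V -> k^o}),
  forall f : {linear V -> k^o}, exists c : 'I_n.+1 -> k,
  forall x, x \in s -> f x = \sum_i c i *: fs i x.
Proof.
elim: s => [|x s [n [fs fsP]]].
  by exists 0%N, (fun=> \0) => f; exists (fun=> 0).
have sS := @span_subspace (fun y => y \in s).
have [sx | nsx] := pselect (span (fun y => y \in s) x).
  exists n, fs => f; have [c cP] := fsP f; exists c => y.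
  rewrite inE => /predU1P[-> | /cP //].
  have : subspace (fun y => f y = \sum_i c i *: fs i y).
    split=> [|a u v fu fv].
      by rewrite linear0 big1 // => i _; rewrite linear0 scaler0.
    rewrite linearP fu fv scaler_sumr -big_split; apply: eq_bigr => i _ /=.
    by rewrite linearP scalerDr !scalerA mulrC.
  by move/span_min => /(_ (fun y => y \in s)); apply.
have [phi [phi1 phi0]] := functional_exists sS nsx.
exists n.+1, (fun i => if unlift ord0 i is Some j then fs j else phi) => f.
have [c cP] := fsP f.
pose c0 := f x - \sum_i c i *: fs i x.
exists (fun i => if unlift ord0 i is Some j then c j else c0) => y.
have -> : \sum_(i < n.+2) (if unlift ord0 i is Some j then c j else c0) *:
     (if unlift ord0 i is Some j then fs j else phi) y =
     c0 *: phi y + \sum_i c i *: fs i y :> k^o.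
  by rewrite big_ord_recl unlift_none; congr (_ + _); apply: eq_bigr => i _; rewrite liftK.
rewrite inE => /predU1P[-> | sy].
  by rewrite phi1 /c0 [_ *: 1]mulr1 subrK.
by rewrite phi0 ?scaler0 ?add0r ?cP //; apply: spanS.
Qed.

End Subspaces.

(** * Contractions separate tensors *)

Section TensorSeparation.
Context {k : fieldType}.
Implicit Types (U V : lmodType k).

Lemma tens_seqP U V (t : U ⊗ V) :
  exists s : seq (U * V), t = \sum_(p <- s) p.1 ⊗t p.2.
Proof.
move: t; apply: tens_ind => [|a u v _ [s ->]]; first by exists [::]; rewrite big_nil.
by exists ((a *: u, v) :: s); rewrite big_cons tensZl.
Qed.

Definition contr U V (f : {linear U -> k^o}) : U ⊗ V -> V :=
  tens_lift (fun a b => f a *: b).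

Lemma contr_bilin U V (f : {linear U -> k^o}) :
  bilin (fun (a : U) (b : V) => f a *: b).
Proof. exact: (bilinZ f idfun). Qed.

HB.instance Definition _ U V f := GRing.isLinear.Build k (U ⊗ V) V *:%R
  (@contr U V f) (tens_lift_is_linear (@contr_bilin U V f)).

Lemma contrE U V (f : {linear U -> k^o}) (a : U) (b : V) :
  contr f (a ⊗t b) = f a *: b.
Proof. exact/tens_liftE/contr_bilin. Qed.

Let tsum U V (s : seq (U * V)) : U ⊗ V := \sum_(p <- s) p.1 ⊗t p.2.

(** A left factor dependent on those of [s] can be distributed over the right factors without
    lengthening [s]. *)
Let tsum_absorb U V (s : seq (U * V)) a b : span (fun x => x \in map fst s) a ->
  exists2 s', map fst s' = map fst s & a ⊗t b + tsum s = tsum s'.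
Proof.
elim=> [|e x y sx _ [s' eqs ts]].
  by exists s; rewrite // -(scale0r (0 : U)) tensZl scale0r add0r.
rewrite tensDl -addrA ts; rewrite -{}eqs {s ts} in sx *.
elim: s' sx => [|[x' b'] s IHs] //=; rewrite inE => /predU1P[-> | /IHs[s' eqs ts]].
  exists ((x', e *: b + b') :: s); rewrite // /tsum !big_cons addrA /=.
  by rewrite tensDr tensZl tensZr.
exists ((x', b') :: s'); first by rewrite /= eqs.
by rewrite /tsum !big_cons -/(tsum s') -/(tsum s) -ts addrCA.
Qed.

(** Induction on the number of pure tensors. A left factor dependent on the others is absorbed;
    otherwise a functional equal to 1 on it and 0 on the others shows that its right factor
    vanishes. *)
Lemma tens_contr_sep U V (t : U ⊗ V) :
  (forall f : {linear U -> k^o}, contr f t = 0) -> t = 0.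
Proof.
have [s ->] := tens_seqP t; rewrite -/(tsum s).
elim: {s}(size s) {-2}s (leqnn (size s)) => [|n IHn] s.
  by rewrite leqn0 => /nilP-> _; rewrite /tsum big_nil.
case: s => [|[a b] s] /=; first by rewrite /tsum big_nil.
rewrite ltnS {1 2}/tsum big_cons /= -/(tsum s) => les.
have [sa | nsa] := pselect (span (fun x => x \in map fst s) a).
  have [s' eqs ->] := tsum_absorb b sa => t0; apply: IHn => //.
  by rewrite -(size_map fst) eqs size_map.
have [f [fa f0]] := functional_exists (@span_subspace _ _ _) nsa.
move=> t0; have b0 : b = 0.
  have := t0 f; rewrite linearD /= contrE fa scale1r linear_sum big_seq big1 ?addr0 // => p sp.
  by rewrite /= contrE f0 ?scale0r //; apply: spanS; apply: map_f.
have ab0 : a ⊗t b = 0 by rewrite b0 -(scale0r (0 : V)) tensZr scale0r.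
by rewrite ab0 add0r in t0 *; apply: IHn.
Qed.

Lemma tens_contr_inj U V (s t : U ⊗ V) :
  (forall f : {linear U -> k^o}, contr f s = contr f t) -> s = t.
Proof.
move=> fst; apply/eqP; rewrite -subr_eq0; apply/eqP/tens_contr_sep => f.
by rewrite linearB /= fst subrr.
Qed.

End TensorSeparation.

Section NatPolynomials.
Context {k : fieldType} (char0 : [pchar k] =i pred0).

Lemma natr_inj0 : injective (fun n => n%:R : k).
Proof.
move=> m n; wlog lemn : m n / (m <= n)%N => [wl|] /eqP eqmn.
  by have [/wl|/ltnW/wl h] := leqP m n; [apply; apply/eqP | symmetry; apply/h/esym/eqP].
move: eqmn; rewrite eq_sym -subr_eq0 -natrB // (pcharf0P k).1 // subn_eq0 => le.
by apply/eqP; rewrite eqn_leq lemn.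
Qed.

Lemma natr_neq0 n : (n.+1%:R : k) != 0.
Proof. by rewrite (pcharf0P k).1. Qed.

Lemma poly_nat_eq (p q : {poly k}) :
  (forall n, p.[n%:R] = q.[n%:R]) -> p = q.
Proof.
move=> pq; apply/eqP; rewrite -subr_eq0; apply/negPn/negP => d0.
pose rs : seq k := [seq n%:R | n <- iota 0 (size (p - q))].
have := @max_poly_roots _ _ rs d0; rewrite size_map size_iota ltnn.
rewrite (map_inj_uniq natr_inj0) iota_uniq => h.
suff /h/(_ isT) : all (root (p - q)) rs by [].
apply/allP => _ /mapP[n _ ->].
by rewrite /root hornerD hornerN pq subrr.
Qed.

(** A Vandermonde argument: a functional vanishing on [W] but not at [v j] would give a nonzero
    polynomial with every natural as a root. *)
Lemma coef_in_subspace (V : lmodType k) (W : V -> Prop) N (v : nat -> V) :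
    subspace W -> (forall n, W (\sum_(j < N) n%:R ^+ j *: v j)) ->
  forall j, (j < N)%N -> W (v j).
Proof.
move=> sW Wv j ltj; apply: contrapT => nW.
have [f [f1 f0]] := functional_exists sW nW.
have : \poly_(i < N) (f (v i) : k) = 0.
  apply: poly_nat_eq => n; rewrite horner_poly horner0 -[RHS](f0 _ (Wv n)).
  rewrite linear_sum; apply: eq_bigr => i _.
  by rewrite linearZ /= mulrC.
by move/(congr1 (fun p : {poly k} => p`_j))/eqP; rewrite coef_poly ltj coef0 f1 oner_eq0.
Qed.

End NatPolynomials.

Section TensorLift.
Context {k : fieldType}.
Implicit Types (U V W : lmodType k).

Lemma tens_lift_map U V U' V' W (B : U' -> V' -> W)
    (f : {linear U -> U'}) (g : {linear V -> V'}) t : bilin B ->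
  tens_lift B (tens_map f g t) = tens_lift (fun a b => B (f a) (g b)) t.
Proof.
move=> bB; have bBfg : bilin (fun a b => B (f a) (g b)).
  by split=> [v a x y|u a x y]; rewrite linearP; [apply: bB.1|apply: bB.2].
move: t; apply: tens_linear_eq => [a x y||u v].
- by rewrite linearP (tens_lift_is_linear bB).
- exact: tens_lift_is_linear.
by rewrite tens_mapE !tens_liftE.
Qed.

Lemma tens_lift_swap U V W (B : U -> V -> W) t : bilin B ->
  tens_lift B (tens_swap V U t) = tens_lift (fun b a => B a b) t.
Proof.
move=> bB; move: t; apply: tens_linear_eq => [a x y||u v].
- by rewrite linearP (tens_lift_is_linear bB).
- exact/tens_lift_is_linear/bilinC.
by rewrite tens_swapE !tens_liftE //; apply: bilinC.
Qed.

Section Additivity.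
Variables (U V W : lmodType k) (B : U -> V -> W).
Hypothesis bB : bilin B.
Let L : {linear U ⊗ V -> W} := linear_of (tens_lift_is_linear bB).

Lemma tens_liftD s t : tens_lift B (s + t) = tens_lift B s + tens_lift B t.
Proof. exact: (linearD L). Qed.

Lemma tens_liftMn t n : tens_lift B (t *+ n) = tens_lift B t *+ n.
Proof. exact: (linearMn L). Qed.

Lemma tens_lift_sum (I : Type) (r : seq I) (P : pred I) (F : I -> U ⊗ V) :
  tens_lift B (\sum_(i <- r | P i) F i) = \sum_(i <- r | P i) tens_lift B (F i).
Proof. exact: (linear_sum L). Qed.

End Additivity.

End TensorLift.

(** * The convolution algebra Hom(H, A) *)

Section Convolution.
Context {k : fieldType} (H : hopfAlgType k) (A : algType k).

(** A type of its own for linear maps, so that its ring product can be convolution and the generic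
    lemmas on powers and commuting elements apply. *)
Record conv := Conv { conv_fun :> H -> A; conv_linear : linear conv_fun }.

HB.instance Definition _ := gen_eqMixin conv.
HB.instance Definition _ := gen_choiceMixin conv.
HB.instance Definition _ (F : conv) :=
  GRing.isLinear.Build k H A *:%R (conv_fun F) (conv_linear F).

Lemma convP (F G : conv) : conv_fun F =1 conv_fun G -> F = G.
Proof.
case: F G => [f lf] [g lg] /= /funext eqfg; rewrite -{g}eqfg in lg *.
by congr Conv; apply: Prop_irrelevance.
Qed.

Fact conv_zero_linear : linear (fun _ : H => 0 : A).
Proof. by move=> a x y; rewrite scaler0 addr0. Qed.
Fact conv_add_linear (F G : conv) : linear (fun h => F h + G h).
Proof. by move=> a x y; rewrite !linearP scalerDr addrACA. Qed.
Fact conv_opp_linear (F : conv) : linear (fun h => - F h).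
Proof. by move=> a x y; rewrite linearP opprD scalerN. Qed.
Fact conv_scale_linear (c : k) (F : conv) : linear (fun h => c *: F h).
Proof. by move=> a x y; rewrite linearP scalerDr !scalerA mulrC. Qed.
Fact conv_one_linear : linear (fun h : H => counit h *: (1 : A)).
Proof. by move=> a x y; rewrite linearP scalerDl scalerA. Qed.
Fact conv_mul_linear (F G : conv) :
  linear (fun h => tens_lift (fun a b => F a * G b) (comul h)).
Proof.
by move=> a x y; rewrite linearP; apply/tens_lift_is_linear/bilinM.
Qed.

Let zero := Conv conv_zero_linear.
Let add F G := Conv (conv_add_linear F G).
Let opp F := Conv (conv_opp_linear F).
Let scale c F := Conv (conv_scale_linear c F).
Let one := Conv conv_one_linear.
Let mul F G := Conv (conv_mul_linear F G).

Fact conv_addA : associative add.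
Proof. by move=> F G K; apply: convP => h /=; rewrite addrA. Qed.
Fact conv_addC : commutative add.
Proof. by move=> F G; apply: convP => h /=; rewrite addrC. Qed.
Fact conv_add0 : left_id zero add.
Proof. by move=> F; apply: convP => h /=; rewrite add0r. Qed.
Fact conv_addN : left_inverse zero opp add.
Proof. by move=> F; apply: convP => h /=; rewrite addNr. Qed.

HB.instance Definition _ := GRing.isZmodule.Build conv
  conv_addA conv_addC conv_add0 conv_addN.

Fact conv_scaleA a b F : scale a (scale b F) = scale (a * b) F.
Proof. by apply: convP => h /=; rewrite scalerA. Qed.
Fact conv_scale1 : left_id 1 scale.
Proof. by move=> F; apply: convP => h /=; rewrite scale1r. Qed.
Fact conv_scaleDr : right_distributive scale +%R.
Proof. by move=> a F G; apply: convP => h /=; rewrite scalerDr. Qed.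
Fact conv_scaleDl F : {morph scale^~ F : a b / a + b}.
Proof. by move=> a b; apply: convP => h /=; rewrite scalerDl. Qed.

HB.instance Definition _ := GRing.Zmodule_isLmodule.Build k conv
  conv_scaleA conv_scale1 conv_scaleDr conv_scaleDl.

Let bil2 (F G : conv) : bilin (fun a b => F a * G b).
Proof. exact: bilinM. Qed.

Fact conv_mulA : associative mul.
Proof.
move=> F G K; apply: convP => h /=.
pose L := fun (a : H) (t : H ⊗ H) => F a * tens_lift (fun b c => G b * K c) t.
pose M := fun (t : H ⊗ H) (c : H) => tens_lift (fun a b => F a * G b) t * K c.
have bL : bilin L.
  split=> [t a x y | x a s t]; rewrite /L ?linearP ?mulrDl -?scalerAl //.
  by rewrite (tens_lift_is_linear (bil2 G K)) mulrDr scalerAr.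
have bM : bilin M.
  split=> [x a s t | t a x y]; rewrite /M ?linearP ?mulrDr -?scalerAr //.
  by rewrite (tens_lift_is_linear (bil2 F G)) mulrDl scalerAl.
rewrite -(tens_lift_map idfun comul _ bL) -(tens_lift_map comul idfun _ bM).
rewrite -comulA; move: (tens_map _ _ _).
apply: tens_linear_eq => [|a s t|a]; first exact: tens_lift_is_linear.
  by rewrite linearP (tens_lift_is_linear bM).
apply: tens_linear_eq => [c s t|c s t|b c].
- by rewrite (tens_bilin _ _).2 (tens_lift_is_linear bL).
- by rewrite (tens_bilin _ _).2 linearP (tens_lift_is_linear bM).
by rewrite tens_assocE !tens_liftE // /L /M !tens_liftE // mulrA.
Qed.

Fact conv_mul1 : left_id one mul.
Proof.
move=> F; apply: convP => h /=; rewrite -[in RHS](counitl h) linear_tens_lift.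
by apply: eq_tens_lift => a b; rewrite linearZ /= -scalerAl mul1r.
Qed.

Fact conv_mulr1 : right_id one mul.
Proof.
move=> F; apply: convP => h /=; rewrite -[in RHS](counitr h) linear_tens_lift.
by apply: eq_tens_lift => a b; rewrite linearZ /= -scalerAr mulr1.
Qed.

Fact conv_mulDl : left_distributive mul +%R.
Proof.
move=> F G K; apply: convP => h /=; rewrite -[X in X + _]scale1r.
by apply: tens_liftP => a b; rewrite /= mulrDl scale1r.
Qed.

Fact conv_mulDr : right_distributive mul +%R.
Proof.
move=> F G K; apply: convP => h /=; rewrite -[X in X + _]scale1r.
by apply: tens_liftP => a b; rewrite /= mulrDr scale1r.
Qed.

Fact conv_oner_neq0 : one != 0 :> conv.
Proof.
apply/eqP => /(congr1 (fun F => conv_fun F 1)) /= /eqP.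
by rewrite rmorph1 scale1r oner_eq0.
Qed.

HB.instance Definition _ := GRing.Zmodule_isNzRing.Build conv
  conv_mulA conv_mul1 conv_mulr1 conv_mulDl conv_mulDr conv_oner_neq0.

Fact conv_scaleAl (a : k) (F G : conv) : a *: (F * G) = (a *: F) * G.
Proof.
apply: convP => h; have z : (0 * G) h = 0 by rewrite mul0r.
rewrite -[LHS]addr0 -[in LHS]z; symmetry.
by apply: tens_liftP => x y; rewrite /= mul0r addr0 scalerAl.
Qed.
HB.instance Definition _ := GRing.Lmodule_isLalgebra.Build k conv conv_scaleAl.

Fact conv_scaleAr (a : k) (F G : conv) : a *: (F * G) = F * (a *: G).
Proof.
apply: convP => h; have z : (0 * G) h = 0 by rewrite mul0r.
rewrite -[LHS]addr0 -[in LHS]z; symmetry.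
by apply: tens_liftP => x y; rewrite /= mul0r addr0 scalerAr.
Qed.
HB.instance Definition _ := GRing.Lalgebra_isAlgebra.Build k conv conv_scaleAr.

Lemma convDE (F G : conv) h : (F + G) h = F h + G h. Proof. by []. Qed.
Lemma convBE (F G : conv) h : (F - G) h = F h - G h. Proof. by []. Qed.
Lemma convZE c (F : conv) h : (c *: F) h = c *: F h. Proof. by []. Qed.
Lemma conv1E h : (1 : conv) h = counit h *: 1. Proof. by []. Qed.
Lemma convME (F G : conv) h :
  (F * G) h = tens_lift (fun a b => F a * G b) (comul h).
Proof. by []. Qed.

Lemma conv_sumE (I : Type) (r : seq I) (P : pred I) (F : I -> conv) h :
  (\sum_(i <- r | P i) F i) h = \sum_(i <- r | P i) F i h.
Proof. by apply: (big_morph (fun F : conv => F h)). Qed.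

Definition conv_of (f : {linear H -> A}) : conv := Conv (linearP f).

Lemma conv_ofK (F : conv) : conv_of F = F.
Proof. exact: convP. Qed.

End Convolution.

Arguments conv_of {k H A} f.

Section ConvolutionMorphism.
Context {k : fieldType} {H : hopfAlgType k} {A B : algType k}.
Variable phi : {lrmorphism A -> B}.

Definition conv_comp (F : conv H A) : conv H B := conv_of (phi \o F).

Lemma conv_compE F h : conv_comp F h = phi (F h). Proof. by []. Qed.

Fact conv_comp_is_linear : linear conv_comp.
Proof. by move=> a F G; apply: convP => h /=; rewrite linearP. Qed.
HB.instance Definition _ :=
  GRing.isLinear.Build k (conv H A) (conv H B) *:%R conv_comp conv_comp_is_linear.

Fact conv_comp_is_monoid_morphism : monoid_morphism conv_comp.
Proof.
split=> [|F G]; apply: convP => h.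
  by rewrite conv_compE conv1E linearZ /= rmorph1.
rewrite conv_compE !convME linear_tens_lift.
by apply: eq_tens_lift => a b; rewrite rmorphM.
Qed.
HB.instance Definition _ := GRing.isMonoidMorphism.Build (conv H A) (conv H B)
  conv_comp conv_comp_is_monoid_morphism.

End ConvolutionMorphism.

Section Contraction.
Context {k : fieldType} {H : hopfAlgType k}.
Implicit Types (f : {linear H -> k^o}) (A : algType k).

(* h |-> f(h_(1)) h_(2). *)
Definition act f (h : H) : H := contr f (comul h).

HB.instance Definition _ f := GRing.Linear.copy (act f) (contr f \o comul).

Lemma contr_map (U V V' : lmodType k) (f : {linear U -> k^o}) (g : {linear V -> V'}) t :
  contr f (tens_map idfun g t) = g (contr f t).
Proof.
move: t; apply: tens_linear_eq => [a x y|a x y|u v]; rewrite ?linearP //.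
by rewrite tens_mapE !contrE linearZ.
Qed.

(** Since contractions separate tensors, the hypothesis means that [id ⊗ G] sends [comul h] to
    [u ⊗t y]. *)
Lemma conv_contr_r A (F G : conv H A) h u y :
  (forall f, G (act f h) = f u *: y) -> (F * G) h = F u * y.
Proof.
move=> Gh; have E : tens_map idfun G (comul h) = u ⊗t y.
  by apply: tens_contr_inj => f; rewrite contr_map contrE; apply: Gh.
have bB : bilin (fun (a : H) (b : A) => F a * b) by exact: (bilinM F idfun).
by rewrite convME -(tens_lift_map idfun G _ bB) E tens_liftE.
Qed.

(** Contractions act on left factors, so cocommutativity is used to exchange the factors of
    [comul h]. *)
Lemma conv_contr_l A (F G : conv H A) h u y : cocommutative H ->
  (forall f, F (act f h) = f u *: y) -> (F * G) h = y * G u.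
Proof.
move=> coH Fh; have E : tens_map idfun F (comul h) = u ⊗t y.
  by apply: tens_contr_inj => f; rewrite contr_map contrE; apply: Fh.
have bB : bilin (fun (b : H) (a : A) => a * G b).
  exact/bilinC/(bilinM idfun G).
rewrite convME -coH tens_lift_swap; last exact: bilinM.
by rewrite -(tens_lift_map idfun F _ bB) E tens_liftE.
Qed.

End Contraction.

(** * Generalized eigenvectors of locally finite commuting operators *)

Section Shift.
Context {k : fieldType} {V : lmodType k}.
Implicit Types (L : {linear V -> V}) (X : V -> Prop) (c : k).

Definition shift L c (x : V) : V := L x - c *: x.

Fact shift_is_linear L c : linear (shift L c).
Proof.
move=> a x y; rewrite /shift linearP scalerDr scalerBr opprD addrACA !scalerA.
by rewrite mulrC.
Qed.
HB.instance Definition _ L c :=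
  GRing.isLinear.Build k V V *:%R (shift L c) (shift_is_linear L c).

Fact iter_is_linear (N : {linear V -> V}) m : linear (iter m N).
Proof. by move=> a x y; elim: m => //= m ->; rewrite linearP. Qed.
HB.instance Definition _ (N : {linear V -> V}) m :=
  GRing.isLinear.Build k V V *:%R (iter m N) (iter_is_linear N m).

Lemma iter_eq0 (N : {linear V -> V}) m n x : (m <= n)%N -> iter m N x = 0 -> iter n N x = 0.
Proof. by move=> le; rewrite -(subnK le) iterD => ->; rewrite linear0. Qed.

Definition geneig L c x := exists m, iter m (shift L c) x = 0.

Lemma geneig_subspace L c : subspace (geneig L c).
Proof.
split=> [|a x y [m xm] [n yn]]; first by exists 0%N.
exists (maxn m n); rewrite linearP /= !(iter_eq0 _ xm, iter_eq0 _ yn) ?leq_maxl ?leq_maxr //.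
by rewrite scaler0 addr0.
Qed.

Definition stable X L := forall x, X x -> X (L x).

Lemma shift_stable X L c : subspace X -> stable X L -> stable X (shift L c).
Proof. by move=> sX XL x Xx; apply: subspaceB => //; [apply: XL|apply: subspaceZ]. Qed.

(** Induction on the nilpotency order of [shift L d] at [x]: if [shift L c y = shift L d x], then
    [shift L c (y - x) = (c - d) *: x]. *)
Lemma shift_inv X L c d x : subspace X -> stable X L -> c != d ->
  X x -> geneig L d x -> exists y, [/\ X y, geneig L d y & shift L c y = x].
Proof.
move=> sX XL ncd Xx [m]; elim: m x Xx => [|m IHm] x Xx.
  by move=> /= ->; exists 0; rewrite linear0; split; [exact: subspace0|exists 0%N|].
rewrite iterSr => xm0; have [y [Xy Gy yE]] := IHm _ (@shift_stable X L d sX XL _ Xx) xm0.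
exists ((c - d)^-1 *: (y - x)); split.
- by apply: subspaceZ => //; apply: subspaceB.
- have sG := geneig_subspace L d; apply: subspaceZ => //; apply: subspaceB => //.
  by exists m.+1; rewrite iterSr.
- rewrite linearZ linearB /= yE /shift /= opprB [X in _ *: X]addrC addrA subrK -scalerBl.
  by rewrite scalerA mulVf ?scale1r // subr_eq0.
Qed.

(** One linear factor at a time: in a decomposition of [shift L c x], the parts with eigenvalue
    other than [c] lift along [shift L c] to some [y], and a power of [shift L c] kills [x - y]. *)
Lemma geneig_split X L (s : seq k) x : subspace X -> stable X L -> X x ->
    foldl (fun y c => shift L c y) x s = 0 ->
  span (fun y => X y /\ exists c, geneig L c y) x.
Proof.
move=> sX XL; pose GE y := X y /\ exists c, geneig L c y; have sGE := @span_subspace _ _ GE.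
have XGE y : span GE y -> X y by apply: span_min => // z [].
rewrite -/GE; elim: s x => [|c s IHs] x Xx /=; first by move=> ->; apply: SpanNil.
move/IHs => /(_ (@shift_stable X L c sX XL _ Xx)) Gx.
have [y [Gy [m ym]]] : exists y, span GE y /\ geneig L c (shift L c x - shift L c y).
  elim: Gx => [|a x1 z [Xx1 [d Gx1]] _ [y [Gy Gc]]].
    by exists 0; split; [exact: SpanNil|exists 0%N; rewrite linear0 subr0].
  have sGc := geneig_subspace L c.
  have [eqd | ncd] := eqVneq c d.
    exists y; split=> //; rewrite -addrA; apply: sGc.2 => //; by rewrite eqd.
  have [y1 [Xy1 Gy1 y1E]] := shift_inv sX XL ncd Xx1 Gx1.
  exists (a *: y1 + y); split; first by apply: SpanCons => //; split=> //; exists d.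
  by rewrite linearP /= y1E opprD addrACA subrr add0r.
rewrite -(subrK y x); apply: (subspaceD sGE) => //; apply: spanS; split.
  by apply: subspaceB => //; apply: XGE.
by exists c, m.+1; rewrite iterSr [shift L c _]linearB.
Qed.

Definition comb n (d : 'I_n -> V) (x : V) := exists c : 'I_n -> k, x = \sum_i c i *: d i.

Lemma comb_subspace n (d : 'I_n -> V) : subspace (comb d).
Proof.
split=> [|a x y [c ->] [e ->]].
  by exists (fun=> 0); rewrite big1 // => i _; rewrite scale0r.
exists (fun i => a * c i + e i); rewrite scaler_sumr -big_split.
by apply: eq_bigr => i _ /=; rewrite scalerDl scalerA.
Qed.

Lemma comb_gen n (d : 'I_n -> V) i : comb d (d i).
Proof.
exists (fun j => (j == i)%:R); rewrite (bigD1 i) //= eqxx scale1r big1 ?addr0 // => j.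
by move/negPf->; rewrite scale0r.
Qed.

(** The splitting hypothesis ranges over all stable subspaces [Y] of [X] because it is applied to
    the intersection of generalized eigenspaces of the operators already treated, which is stable by
    commutation. *)
Lemma common_geneig (I : finType) (Ls : I -> {linear V -> V}) X x :
    (forall i j y, Ls i (Ls j y) = Ls j (Ls i y)) ->
    (forall i Y, (forall y, Y y -> X y) -> subspace Y -> stable Y (Ls i) ->
      forall y, Y y -> span (fun z => Y z /\ exists c, geneig (Ls i) c z) y) ->
    subspace X -> (forall i, stable X (Ls i)) -> X x ->
  span (fun y => X y /\ forall i, exists c, geneig (Ls i) c y) x.
Proof.
move=> Lcomm Lsplit sX XL Xx.
have iter_comm i j c m y : iter m (shift (Ls i) c) (Ls j y) = Ls j (iter m (shift (Ls i) c) y).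
  elim: m => //= m ->; move: (iter m _ y) => z.
  by rewrite /shift [RHS]linearB [X in _ = _ - X]linearZ /= Lcomm.
suff {x Xx} h (r : seq I) x : X x ->
    span (fun y => X y /\ forall i, i \in r -> exists c, geneig (Ls i) c y) x.
  refine (span_mono (h (enum I) x Xx) _) => y [Xy Gy]; apply: spanS; split=> // i.
  by apply: Gy; rewrite mem_enum.
elim: r => [|i r IHr] Xx; first by apply: spanS.
refine (span_mono (IHr Xx) _) => y [Xy Gy].
have /choice[c cP] j : exists c, j \in r -> geneig (Ls j) c y.
  have [/Gy[c]|nj] := boolP (j \in r); by [exists c | exists 0].
pose Y z := X z /\ forall j, j \in r -> geneig (Ls j) (c j) z.
have sY : subspace Y.
  split=> [|a u v [Xu Gu] [Xv Gv]].
    by split=> [|j _]; [apply: subspace0 | apply: (subspace0 (geneig_subspace (Ls j) (c j)))].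
  split=> [|j jr]; first exact: sX.2.
  by apply: (geneig_subspace _ _).2; [apply: Gu | apply: Gv].
have YL : stable Y (Ls i).
  move=> z [Xz Gz]; split=> [|j /Gz[m zm]]; first exact: XL.
  by exists m; rewrite iter_comm zm linear0.
have YX z : Y z -> X z by case.
refine (span_mono (Lsplit i Y YX sY YL y (conj Xy cP)) _) => z [[Xz Gz] Gi].
apply: spanS; split=> // j; rewrite inE => /predU1P[-> //|jr].
by exists (c j); apply: Gz.
Qed.

End Shift.

Section FiniteSplit.
Context {k : closedFieldType} {V : lmodType k}.

(** The [d i] may be dependent, so the matrix of [L] is merely chosen. Its characteristic polynomial
    splits over [k], and by Cayley-Hamilton the product of the shifts by its roots kills every
    combination. *)
Lemma comb_split n (d : 'I_n.+1 -> V) (L : {linear V -> V}) : stable (comb d) L ->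
  exists s : seq k, forall x, comb d x -> foldl (fun y c => shift L c y) x s = 0.
Proof.
move=> dL; have [A AE] := choice (fun i => dL _ (comb_gen d i)).
pose M := \matrix_(i < n.+1, j < n.+1) A i j.
pose lc (v : 'rV[k]_n.+1) := \sum_i v 0 i *: d i.
have Llc v : L (lc v) = lc (v *m M).
  rewrite /lc linear_sum /=; under eq_bigr => i _ do rewrite linearZ /= AE scaler_sumr.
  rewrite exchange_big; apply: eq_bigr => j _ /=; rewrite mxE scaler_suml.
  by apply: eq_bigr => i _; rewrite scalerA mxE.
have lcB c v : shift L c (lc v) = lc (v *m (M - c%:M)).
  rewrite /shift Llc mulmxBr mul_mx_scalar /lc scaler_sumr -sumrB.
  by apply: eq_bigr => i _; rewrite !mxE scalerA -scalerBl.
have [s sE] := closed_field_poly_normal (char_poly M).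
rewrite (monicP (char_poly_monic M)) scale1r in sE.
exists s => _ [c ->]; have -> : \sum_i c i *: d i = lc (\row_i c i).
  by apply: eq_bigr => i _; rewrite mxE.
move: (\row_i c i) => v.
have -> : foldl (fun y c => shift L c y) (lc v) s = lc (v *m \prod_(c <- s) (M - c%:M)).
  elim: s v {sE} => [|e s IHs] v /=; first by rewrite big_nil mulmx1.
  by rewrite lcB IHs big_cons mulmxA.
have -> : \prod_(c <- s) (M - c%:M) = horner_mx M (char_poly M).
  by rewrite sE rmorph_prod; apply: eq_bigr => e _; rewrite rmorphB /= horner_mx_X horner_mx_C.
by rewrite Cayley_Hamilton mulmx0 /lc big1 // => i _; rewrite mxE scale0r.
Qed.

End FiniteSplit.

(** * Grouplike elements as weights *)

Section CoradicalFiltration.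
Context {k : fieldType} {H : hopfAlgType k}.
Implicit Types (f e : {linear H -> k^o}) (g h : H).

Lemma functional_act f e h : e (act f h) = (conv_of f * conv_of e : conv H k^o) h.
Proof.
rewrite convME /act /contr linear_tens_lift; apply: eq_tens_lift => a b.
by rewrite linearZ.
Qed.

Lemma act_counit h : act counit h = h.
Proof. exact: counitl. Qed.

Lemma counit_act f h : counit (act f h) = f h.
Proof.
rewrite functional_act (_ : conv_of counit = 1) ?mulr1 //.
by apply: convP => x; rewrite conv1E /= [RHS]mulr1.
Qed.

Lemma act_act f e h : act f (act e h) = act (conv_of e * conv_of f : conv H k^o) h.
Proof.
apply: functional_inj => d; rewrite !functional_act.
by rewrite !conv_ofK mulrA.
Qed.

Hypothesis coH : cocommutative H.

Lemma conv_comm (F G : conv H k^o) : F * G = G * F.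
Proof.
apply: convP => x; rewrite !convME -[in LHS]coH tens_lift_swap; last exact: bilinM.
by apply: eq_tens_lift => a b; rewrite mulrC.
Qed.

Lemma act_comm f e h : act f (act e h) = act e (act f h).
Proof. by rewrite !act_act conv_comm. Qed.

(* For g grouplike, the union over n of Fil g n is the irreducible component of g,
   i.e. the generalized weight space of the commuting operators [act f] at f |-> f(g). *)
Fixpoint Fil g n h : Prop :=
  if n is n'.+1 then forall f, Fil g n' (act f h - (f g : k) *: h) else h = 0.

Lemma Fil_subspace g n : subspace (Fil g n).
Proof.
elim: n => [|n IHn]; first exact: subspace_eq0.
split=> [|a x y Fx Fy] f /=; first by rewrite linear0 scaler0 subrr; apply: subspace0.
rewrite linearP scalerDr opprD addrACA scalerA [_ * a]mulrC -scalerA -scalerBr.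
by apply: IHn.2; [apply: Fx | apply: Fy].
Qed.

Lemma Fil_act g n h f : Fil g n h -> Fil g n (act f h).
Proof.
elim: n h => [|n IHn] h /=; first by move->; rewrite linear0.
by move=> Fh e; rewrite act_comm -linearZ -linearB; apply: IHn.
Qed.

Lemma FilS g n h : Fil g n h -> Fil g n.+1 h.
Proof.
move=> Fh f; have sF := Fil_subspace g n.
by apply: subspaceB => //; [apply: Fil_act | apply: subspaceZ].
Qed.

Lemma Fil_mono g m n h : (m <= n)%N -> Fil g m h -> Fil g n h.
Proof. by move/subnK<-; elim: (n - m)%N => // d IHd /IHd; apply: FilS. Qed.

Lemma Fil_grouplike g : is_grouplike g -> Fil g 1 g.
Proof.
by case/grouplikeP=> Dg _ f /=; rewrite /act Dg contrE subrr.
Qed.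

(** From [f v = counit (act f v) = c * counit v] for all [f], the counit is nonzero at [v]; dividing
    by it makes the eigenvalue of [act f] equal to the value of [f]. *)
Lemma weight_vector_grouplike (v : H) : v != 0 ->
    (forall f, exists c, act f v = c *: v) ->
  exists2 g, is_grouplike g & exists2 a, a != 0 & v = a *: g.
Proof.
move=> v0 vP; have ev0 : counit v != 0.
  apply: contra_neq v0 => ev; apply: functional_sep => f.
  by have [c fv] := vP f; rewrite -(counit_act f v) fv linearZ /= ev scaler0.
exists ((counit v : k)^-1 *: v); last first.
  by exists (counit v : k) => //; rewrite scalerA mulfV // scale1r.
apply/grouplikeP; split; last by rewrite linearZ /= [LHS]mulVf.
apply: tens_contr_inj => f; rewrite linearZ /= contrE linearZ /= -/(act f v).
have [c fv] := vP f; rewrite fv.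
have -> : f ((counit v : k)^-1 *: v) = c.
  by rewrite linearZ -(counit_act f v) fv linearZ /= [_ *: _]mulrCA mulVf ?mulr1.
by rewrite !scalerA mulrC.
Qed.

Section LocallyFinite.
Variables (n : nat) (fs : 'I_n -> {linear H -> k^o}) (D : H -> Prop).
Hypothesis fsP : forall f, exists c : 'I_n -> k,
  forall y, D y -> act f y = \sum_i c i *: act (fs i) y.
Hypothesis D_subspace : subspace D.
Hypothesis D_act : forall f y, D y -> D (act f y).
Variable lam : 'I_n -> k.
Let N i : {linear H -> H} := shift (act (fs i)) (lam i).

(** The analogue of [Fil] for the finitely many operators [N i], before any grouplike element is
    known. *)
Fixpoint joint_nil m (y : H) : Prop := if m is m'.+1 then forall i, joint_nil m' (N i y) else y = 0.

Let joint_nil0 m : joint_nil m 0.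
Proof. by elim: m => //= m IHm i; rewrite linear0. Qed.

Let N_comm i j y : N i (N j y) = N j (N i y).
Proof.
rewrite /N /= /shift !linearB !linearZ /= act_comm.
by rewrite -!addrA; congr (_ + _); rewrite addrCA !scalerA [lam i * _]mulrC.
Qed.

(** The operators commute, so applying [N i] lowers the order [m i] by one and keeps the others; if
    [m i = 0], the vector is already zero. *)
Lemma joint_nilP y (m : 'I_n -> nat) : (forall i, iter (m i) (N i) y = 0) ->
  joint_nil (\sum_i m i).+1 y.
Proof.
move: {2}(\sum_i m i)%N (erefl (\sum_i m i)%N) => M.
elim: M m y => [|M IHM] m y mM ym i.
  have m0 : m i = 0%N by move/eqP: mM; rewrite sum_nat_eq0 => /forallP/(_ i)/eqP.
  by have := ym i; rewrite m0 /= => ->; rewrite mM /= linear0.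
rewrite mM; case mi: (m i) => [|mi'].
  by have := ym i; rewrite mi /= => ->; rewrite linear0; exact (joint_nil0 M.+1).
pose m' j := if j == i then mi' else m j.
have m'M : (\sum_j m' j = M)%N.
  apply: succn_inj; rewrite -mM (bigD1 i) //= [in RHS](bigD1 i) //= /m' eqxx mi addSn.
  by congr (_ + _).+1; apply: eq_bigr => j /negPf->.
rewrite -m'M; apply: IHM => // j; rewrite /m'.
have [-> | _] := eqVneq j i; first by rewrite -iterSr -mi ym.
suff -> : iter (m j) (N j) (N i y) = N i (iter (m j) (N j) y) by rewrite ym linear0.
by elim: (m j) => //= p ->; apply: N_comm.
Qed.

Lemma joint_nil_weight m (y : H) : y != 0 -> D y -> joint_nil m y ->
  exists v, [/\ v != 0, D v & forall i, N i v = 0].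
Proof.
elim: m y => [|m IHm] y y0 Dy /=; first by move/eqP; rewrite (negPf y0).
move=> Ny; have [[i Niy] | nN] := pselect (exists i, N i y != 0).
  apply: IHm Niy _ (Ny i).
  by apply: subspaceB => //; [apply: D_act | apply: subspaceZ].
exists y; split=> // i; apply/eqP/negPn/negP => Niy.
by apply: nN; exists i.
Qed.

(** A common eigenvector supplies [g]. If [act f] is the combination of the [act (fs i)] with
    coefficients [c i] on [D], then [f g] is that of the [lam i], so [act f - f g] is on [D] the
    same combination of the [N i]. *)
Lemma joint_nil_Fil m (y : H) : y != 0 -> D y -> joint_nil m y ->
  exists2 g, is_grouplike g & Fil g m y.
Proof.
move=> y0 Dy Ny; have [v [v0 Dv Nv]] := joint_nil_weight y0 Dy Ny.
have actv f c : (forall y, D y -> act f y = \sum_i c i *: act (fs i) y) ->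
    act f v = (\sum_i c i * lam i) *: v.
  move/(_ v Dv) ->; rewrite scaler_suml; apply: eq_bigr => i _.
  by have /eqP := Nv i; rewrite /N /shift subr_eq0 => /eqP->; rewrite scalerA.
have [|g Gg [a a0 vE]] := weight_vector_grouplike v0.
  by move=> f; have [c /actv cE] := fsP f; exists (\sum_i c i * lam i).
exists g => //; have [Dg eg] := grouplikeP _ Gg.
have fg f c : (forall y, D y -> act f y = \sum_i c i *: act (fs i) y) ->
    f g = \sum_i c i * lam i.
  move/actv; rewrite vE linearZ /= /act Dg contrE => /eqP.
  rewrite !scalerA -subr_eq0 -scalerBl scaler_eq0 => /orP[|/eqP g0].
    by rewrite mulrC -mulrBl mulf_eq0 (negPf a0) orbF subr_eq0 => /eqP.
  by move/eqP: eg; rewrite g0 linear0 eq_sym oner_eq0.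
elim: m y {y0} Dy Ny => [|m IHm] y Dy //= Ny f.
have [c cP] := fsP f; rewrite (fg f c cP) cP // scaler_suml -sumrB.
apply: subspace_sum => [|i _]; first exact: Fil_subspace.
rewrite -scalerA -scalerBr; apply: subspaceZ; first exact: Fil_subspace.
apply: IHm; last exact: Ny.
by apply: subspaceB => //; [apply: D_act | apply: subspaceZ].
Qed.

End LocallyFinite.

End CoradicalFiltration.

Section FilSpan.
Context {k : closedFieldType} {H : hopfAlgType k} (coH : cocommutative H).

(** Local finiteness: [comul h] is a finite sum, so the vectors [act f h] fill a finitely generated
    space [D], stable under all [act f] and containing [h] through [f = counit]. *)
Lemma Fil_span (h : H) : span (fun y => exists g n, is_grouplike g /\ Fil g n y) h.
Proof.
have [s hE] := tens_seqP (comul h).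
have [n [fs fsP]] := functional_fin (map fst s).
pose d i := act (fs i) h; pose D := comb d.
have fsh f : exists c : 'I_n.+1 -> k, act f h = \sum_i c i *: d i.
  have [c cP] := fsP f; exists c; rewrite /d /act hE linear_sum /=.
  under [RHS]eq_bigr => i _ do rewrite linear_sum scaler_sumr.
  rewrite exchange_big big_seq [RHS]big_seq; apply: eq_bigr => p sp /=.
  rewrite contrE cP ?map_f // scaler_suml; apply: eq_bigr => i _.
  by rewrite contrE scalerA.
have sD : subspace D by apply: comb_subspace.
have Dh : D h by rewrite -[h]act_counit; have [c ->] := fsh counit; exists c.
have D_act f y : D y -> D (act f y).
  move=> [c ->]; rewrite linear_sum; apply: subspace_sum => // i _.
  rewrite linearZ; apply: subspaceZ => //=; rewrite /d act_act.
  by have [e ->] := fsh (conv_of (fs i) * conv_of f : conv H k^o); exists e.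
(* The coefficients valid at [h] remain valid on all of [D], since [D] arises from [h] by operators
   commuting with [act f]. *)
have fsD f : exists c : 'I_n.+1 -> k,
    forall y, D y -> act f y = \sum_i c i *: act (fs i) y.
  have [c cP] := fsh f; exists c => _ [e ->]; rewrite linear_sum.
  under [RHS]eq_bigr => i _ do rewrite linear_sum scaler_sumr.
  rewrite exchange_big; apply: eq_bigr => j _ /=.
  rewrite linearZ /= /d act_comm // cP linear_sum scaler_sumr.
  apply: eq_bigr => i _; rewrite !linearZ /= [in RHS]act_comm //.
  by rewrite !scalerA mulrC.
have Lcomm i j y : act (fs i) (act (fs j) y) = act (fs j) (act (fs i) y).
  exact: act_comm.
have := common_geneig (Ls := fun i => act (fs i)) Lcomm _ sD _ Dh.
move=> /(_ _ _)/span_mono; apply.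
- move=> i Y YD sY YL y Yy.
  have [r rP] := comb_split (d := d) (L := act (fs i)) (D_act (fs i)).
  by apply: (geneig_split sY YL Yy); apply: rP; apply: YD.
- by move=> i y; apply: D_act.
move=> y [Dy Gy]; have [-> | y0] := eqVneq y 0; first exact: SpanNil.
have /choice[lam lamP] := Gy; have /choice[m mP] := lamP.
have [g Gg Fg] := joint_nil_Fil fsD sD D_act y0 Dy (joint_nilP coH mP).
by apply: spanS; exists g, (\sum_i m i).+1.
Qed.

End FilSpan.

Section TensorProductAlgebra.
Context {k : fieldType}.
Implicit Types (A B : algType k).

(** An alias carrying the componentwise product, so that plain [A ⊗ B] stays a module on which
    [smash_mul] can be considered. *)
Definition tens_alg A B : Type := A ⊗ B.

HB.instance Definition _ A B := GRing.Lmodule.on (tens_alg A B).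

Section Ring.
Variables A B : algType k.
Implicit Types x y z : tens_alg A B.

Let mulZDl z a x y : tens_mul (a *: x + y) z = a *: tens_mul x z + tens_mul y z :> A ⊗ B.
Proof. exact: (tens_mul_bilin A B).1. Qed.
Let mulZDr z a x y : tens_mul z (a *: x + y) = a *: tens_mul z x + tens_mul z y :> A ⊗ B.
Proof. exact: (tens_mul_bilin A B).2. Qed.

Fact tens_alg_mulDl : left_distributive (@tens_mul k A B) +%R.
Proof. by move=> x y z; have := mulZDl z 1 x y; rewrite !scale1r. Qed.
Fact tens_alg_mulDr : right_distributive (@tens_mul k A B) +%R.
Proof. by move=> x y z; have := mulZDr x 1 y z; rewrite !scale1r. Qed.

Fact tens_alg_oner_neq0 : (1 : A) ⊗t (1 : B) != 0.
Proof.
have [|f [f1 _]] := @functional_exists k A _ 1 subspace_eq0; first exact/eqP/oner_neq0.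
by apply/eqP => /(congr1 (contr f))/eqP; rewrite contrE f1 scale1r linear0 oner_eq0.
Qed.

HB.instance Definition _ := GRing.Zmodule_isNzRing.Build (tens_alg A B)
  (@tens_mulA k A B) (@tens_mul1 k A B) (@tens_mulr1 k A B)
  tens_alg_mulDl tens_alg_mulDr tens_alg_oner_neq0.

Fact tens_alg_scaleAl (a : k) x y : a *: (x * y) = (a *: x) * y.
Proof. by have := mulZDl y a x 0; rewrite (mul0r y : tens_mul 0 y = 0) !addr0. Qed.
HB.instance Definition _ :=
  GRing.Lmodule_isLalgebra.Build k (tens_alg A B) tens_alg_scaleAl.

Fact tens_alg_scaleAr (a : k) x y : a *: (x * y) = x * (a *: y).
Proof. by have := mulZDr x a y 0; rewrite (mulr0 x : tens_mul x 0 = 0) !addr0. Qed.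
HB.instance Definition _ :=
  GRing.Lalgebra_isAlgebra.Build k (tens_alg A B) tens_alg_scaleAr.

Lemma tens_algM (a a' : A) (b b' : B) :
  (a ⊗t b : tens_alg A B) * (a' ⊗t b' : tens_alg A B) = (a * a') ⊗t (b * b').
Proof. exact: tens_mulE. Qed.

Fact tens_elem_linear (b : B) : linear (fun a : A => a ⊗t b : tens_alg A B).
Proof. exact: (tens_bilin A B).1. Qed.
Definition tens_elem (b : B) : {linear A -> tens_alg A B} := linear_of (tens_elem_linear b).

Lemma tens_elemM b b' a a' :
  tens_elem b a * tens_elem b' a' = tens_elem (b * b') (a * a').
Proof. exact: tens_algM. Qed.

Definition tens_inl (a : A) : tens_alg A B := a ⊗t 1.
Definition tens_inr (b : B) : tens_alg A B := 1 ⊗t b.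

Fact tens_inl_linear : linear tens_inl.
Proof. exact: (tens_bilin A B).1. Qed.
Fact tens_inr_linear : linear tens_inr.
Proof. exact: (tens_bilin A B).2. Qed.
HB.instance Definition _ := GRing.isLinear.Build k A (tens_alg A B) *:%R
  tens_inl tens_inl_linear.
HB.instance Definition _ := GRing.isLinear.Build k B (tens_alg A B) *:%R
  tens_inr tens_inr_linear.

Fact tens_inl_monoid_morphism : monoid_morphism tens_inl.
Proof. by split=> // x y; rewrite /tens_inl tens_algM mulr1. Qed.
Fact tens_inr_monoid_morphism : monoid_morphism tens_inr.
Proof. by split=> // x y; rewrite /tens_inr tens_algM mulr1. Qed.
HB.instance Definition _ := GRing.isMonoidMorphism.Build A (tens_alg A B)
  tens_inl tens_inl_monoid_morphism.
HB.instance Definition _ := GRing.isMonoidMorphism.Build B (tens_alg A B)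
  tens_inr tens_inr_monoid_morphism.

End Ring.

Definition comul_alg (H : hopfAlgType k) (h : H) : tens_alg H H := comul h.

Fact comul_alg_monoid_morphism (H : hopfAlgType k) : monoid_morphism (@comul_alg H).
Proof. by split=> [|x y]; [apply: comul1 | apply: comulM]. Qed.
HB.instance Definition _ (H : hopfAlgType k) := GRing.Linear.copy (@comul_alg H)
  (comul : H -> H ⊗ H).
HB.instance Definition _ (H : hopfAlgType k) := GRing.isMonoidMorphism.Build H (tens_alg H H)
  (@comul_alg H) (@comul_alg_monoid_morphism H).

Lemma tens_lift_in (U V W : lmodType k) (f : U -> V -> W) (X : W -> Prop) t :
  bilin f -> subspace X -> (forall u v, X (f u v)) -> X (tens_lift f t).
Proof.
move=> bf sX Xf; move: t; apply: tens_ind => [|a u v t Xt].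
  by have := tens_lift_is_linear bf (-1) 0 0; rewrite scaler0 addr0 scaleN1r addNr
    => ->; apply: subspace0.
by rewrite (tens_lift_is_linear bf) tens_liftE //; apply: sX.2.
Qed.

End TensorProductAlgebra.

(** * Independence of the generalized weight spaces *)

Section FilIndependence.
Context {k : fieldType} {H : hopfAlgType k} (coH : cocommutative H).
Implicit Types (f : {linear H -> k^o}) (g h : H).

Lemma Fil_iter f g n h : Fil g n h -> iter n (shift (act f) (f g)) h = 0.
Proof. by elim: n h => [|n IHn] h Fh //; rewrite iterSr; apply: IHn; apply: Fh. Qed.

Lemma Fil_iter_stable f c g m n h : Fil g n h -> Fil g n (iter m (shift (act f) c) h).
Proof.
have sF := Fil_subspace g n.
move=> Fh; elim: m => //= m Fm; apply: subspaceB => //; last exact: subspaceZ.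
exact: Fil_act.
Qed.

(** If [act f h = c *: h], then [(c - f g) *: h] equals [act f h - f g *: h], which lies one step
    lower in the filtration. *)
Lemma Fil_shift_inj f (c : k) g n h :
  f g != c -> Fil g n h -> shift (act f) c h = 0 -> h = 0.
Proof.
move=> fgc; elim: n h => //= n IHn h Fh h0; apply: IHn => //.
have sF := Fil_subspace g n.
have := Fh f; have /eqP := h0; rewrite /shift subr_eq0 => /eqP->.
rewrite -scalerBl => /(subspaceZ (c - (f g : k))^-1 sF).
by rewrite scalerA mulVf ?scale1r // subr_eq0 eq_sym.
Qed.

Lemma Fil_iter_inj f (c : k) g m n h :
  f g != c -> Fil g n h -> iter m (shift (act f) c) h = 0 -> h = 0.
Proof.
move=> fgc Fh; elim: m => //= m IHm /(Fil_shift_inj fgc (Fil_iter_stable f c m Fh)).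
exact: IHm.
Qed.

(** A functional [f] separates [g] from [g1]; a power of [act f - f g1] kills the term of [g1] and
    is injective on the component of [g], so induction applies to the shorter sum. *)
Lemma Fil_independent (s : seq (grouplike H)) (v : grouplike H -> H) : uniq s ->
    (forall g : grouplike H, g \in s -> exists n, Fil (gval g) n (v g)) ->
  \sum_(g <- s) v g = 0 -> forall g : grouplike H, g \in s -> v g = 0.
Proof.
elim: s v => [|g1 s IHs] v //= /andP[g1s us] Fv; rewrite big_cons => sum0.
have [n Fn] := Fv g1 (mem_head _ _).
have v0 (g : grouplike H) : g \in s -> v g = 0.
  move=> gs; have [f fg] : exists f, f (gval g) != f (gval g1).
    apply: contrapT => nf; case/negP: g1s; rewrite (_ : g1 = g) //.
    apply/val_inj/functional_inj => f; apply/eqP/negPn/negP => fg.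
    by apply: nf; exists f; rewrite eq_sym.
  have [m Fm] : exists m, Fil (gval g) m (v g) by apply: Fv; rewrite inE gs orbT.
  apply: (Fil_iter_inj (m := n) fg Fm).
  pose M : {linear H -> H} := iter n (shift (act f) (f (gval g1))).
  apply: (IHs (fun g : grouplike H => M (v g)) us _ _ g gs) => [g' gs'|].
    have [m' Fm'] : exists m, Fil (gval g') m (v g') by apply: Fv; rewrite inE gs' orbT.
    by exists m'; apply: Fil_iter_stable.
  have := congr1 M sum0; rewrite linear0 linearD linear_sum.
  by rewrite [X in X + _](Fil_iter f Fn) add0r.
move=> g; rewrite inE => /predU1P[-> | /v0 //].
by move: sum0; rewrite big_seq big1 ?addr0.
Qed.

End FilIndependence.

(** * The first Eulerian idempotent *)

Section BinomialPolynomials.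
Context {k : fieldType} (char0 : [pchar k] =i pred0).

(** For [i > 0] the coefficient of degree 1 is [(-1)^(i-1) / i], that of the logarithm series. *)
Definition binp i : {poly k} := (i`!%:R)^-1 *: \prod_(l < i) ('X - (l%:R)%:P).

Lemma binpE i n : (binp i).[n%:R] = 'C(n, i)%:R.
Proof.
have prodE : (\prod_(l < i) ('X - (l%:R : k)%:P)).[n%:R] = (n ^_ i)%:R.
  elim: i => [|i IHi]; first by rewrite big_ord0 hornerC.
  rewrite big_ord_recr hornerM IHi ffactnSr hornerXsubC natrM.
  have [lein | ltni] := leqP i n; first by rewrite natrB.
  by rewrite ffact_small // !mul0r.
rewrite hornerZ prodE -bin_ffact natrM mulrC mulfK //.
by rewrite -(prednK (fact_gt0 i)) natr_neq0.
Qed.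

Lemma binp_coef0 i : (binp i)`_0 = (i == 0%N)%:R.
Proof. by rewrite -horner_coef0 -[0]/(0%:R) binpE bin0n. Qed.

Lemma binp0_coef1 : (binp 0)`_1 = 0.
Proof. by rewrite /binp big_ord0 coefZ coef1 mulr0. Qed.

Lemma binp1_coef1 : (binp 1)`_1 = 1.
Proof. by rewrite /binp big_ord1 subr0 coefZ coefX mulr1 invr1. Qed.

End BinomialPolynomials.

Section Kill.
Context {k : fieldType} {H : hopfAlgType k} (coH : cocommutative H).
Context {A : algType k}.
Implicit Types (F G x y : conv H A) (h : H).

Definition kill n F := forall h, Fil 1 n h -> F h = 0.

Let killE n G f h : kill n G -> Fil 1 n.+1 h -> G (act f h) = (f 1 : k) *: G h.
Proof.
by move=> kG Fh; have /eqP := kG _ (Fh f); rewrite linearB linearZ subr_eq0 => /eqP.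
Qed.

(** On [Fil 1 n.+1], [act f h] is [f 1 *: h] modulo [Fil 1 n], which [G] kills; hence [F * G] takes
    the value [F 1 * G h] at [h]. *)
Lemma kill_mulr n F G : F 1 = 0 -> kill n G -> kill n.+1 (F * G).
Proof.
move=> F1 kG h Fh; rewrite (conv_contr_r F (u := 1) (y := G h)) ?F1 ?mul0r // => f.
exact: killE kG Fh.
Qed.

Lemma kill_mull n F G : kill n F -> G 1 = 0 -> kill n.+1 (F * G).
Proof.
move=> kF G1 h Fh; rewrite (conv_contr_l G (u := 1) (y := F h) coH) ?G1 ?mulr0 // => f.
exact: killE kF Fh.
Qed.

Lemma kill_mulr0 n F G : kill n G -> kill n (F * G).
Proof.
move=> kG h Fh; rewrite (conv_contr_r F (u := 1) (y := 0)) ?mulr0 // => f.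
by rewrite scaler0 kG //; apply: Fil_act.
Qed.

Lemma kill_exp n m x : x 1 = 0 -> (n <= m)%N -> kill n (x ^+ m).
Proof.
move=> x1; elim: n m => [|n IHn] [|m] // lenm h Fh.
- by rewrite Fh linear0.
- by rewrite Fh linear0.
by rewrite exprS; apply: (kill_mulr x1 (IHn m lenm)).
Qed.

Lemma conv_mul_1 F G : (F * G) 1 = F 1 * G 1.
Proof. by rewrite convME comul1 tens_liftE //; apply: bilinM. Qed.

Let sum_trunc (V : zmodType) (F : nat -> V) m n : (forall i, (m <= i)%N -> F i = 0) ->
  (m <= n)%N -> \sum_(i < n) F i = \sum_(i < m) F i.
Proof.
move=> F0 lemn; rewrite -!(big_mkord xpredT F) (big_cat_nat (leq0n m) lemn) //=.
by rewrite [X in _ + X]big_nat [X in _ + X]big1 ?addr0 // => i /andP[/F0].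
Qed.

Let sum_trunc2 (V : zmodType) (F : nat -> V) m n : (forall i, (m <= i)%N -> F i = 0) ->
  (forall i, (n <= i)%N -> F i = 0) -> \sum_(i < n) F i = \sum_(i < m) F i.
Proof.
move=> Fm Fn; rewrite -(sum_trunc Fn (leq_maxr m n)).
by rewrite (sum_trunc Fm (leq_maxl m n)).
Qed.

Hypothesis char0 : [pchar k] =i pred0.

(** The binomial formula, cut at a bound [N] that does not depend on [n] because [x ^+ i] kills
    [Fil 1 N] for [i >= N]: the value is thus polynomial in [n]. *)
Lemma exp1D_binp N n x z h : x 1 = 0 -> Fil 1 N h -> GRing.comm x z ->
  ((x + 1) ^+ n * z) h = \sum_(i < N) (binp i).[n%:R : k] *: (x ^+ i * z) h.
Proof.
move=> x1 Fh xz; rewrite exprD1n mulr_suml conv_sumE.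
pose T i := ((x ^+ i *+ 'C(n, i)) * z) h.
rewrite (sum_trunc2 (F := T) (m := N)) => [|i leNi|i ltni].
- apply: eq_bigr => i _; rewrite /T (binpE char0) -scaler_nat -scalerAl.
  by rewrite convZE.
- rewrite /T -scaler_nat -scalerAl convZE -(commrX i (commr_sym xz)).
  by rewrite (kill_mulr0 (n := N)) ?scaler0 //; apply: kill_exp.
- by rewrite /T bin_small // mulr0n mul0r.
Qed.

(* The truncated logarithm of 1 + x: the coefficient of n in (1 + x)^n, which is a
   polynomial in n at any h on which x is nilpotent. *)
Definition eulerian N x : conv H A := \sum_(i < N) (binp i)`_1 *: x ^+ i.

Lemma exp2D_binp N n x y h : x 1 = 0 -> y 1 = 0 -> GRing.comm x y -> Fil 1 N h ->
  ((x + 1) ^+ n * (y + 1) ^+ n) h =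
  \sum_(a < N) \sum_(b < N) (binp a * binp b).[n%:R : k] *: (x ^+ a * y ^+ b) h.
Proof.
move=> x1 y1 xy Fh; have cz : GRing.comm x ((y + 1) ^+ n).
  by apply/commrX/commrD => //; apply: commr1.
rewrite (exp1D_binp n x1 Fh cz); apply: eq_bigr => a _.
have -> : x ^+ a * (y + 1) ^+ n = (y + 1) ^+ n * x ^+ a.
  by symmetry; apply/commrX/commr_sym.
rewrite (exp1D_binp n y1 Fh); last exact/commrX/commr_sym.
rewrite scaler_sumr; apply: eq_bigr => b _; rewrite scalerA hornerM.
by congr (_ *: conv_fun _ _); apply/commrX/commr_sym/commrX.
Qed.

End Kill.

Arguments eulerian {k H A} N x.

Section EulerianPrimitive.
Context {k : fieldType} (char0 : [pchar k] =i pred0).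
Context {H : hopfAlgType k} (coH : cocommutative H).

Definition unipot : conv H H := conv_of idfun - 1.

Lemma unipotE h : unipot h = h - (counit h : k) *: 1.
Proof. by []. Qed.

Lemma unipotD1 : unipot + 1 = conv_of idfun.
Proof. exact: subrK. Qed.

Lemma unipot1 : unipot 1 = 0.
Proof. by rewrite unipotE rmorph1 scale1r subrr. Qed.

Lemma tens_lift_tensor (U V : lmodType k) (t : U ⊗ V) : tens_lift tensor t = t.
Proof.
move: t; apply: tens_linear_eq => //; first exact/tens_lift_is_linear/tens_bilin.
by move=> u v; apply/tens_liftE/tens_bilin.
Qed.

Let inlid : conv H (tens_alg H H) := conv_comp (@tens_inl k H H) (conv_of idfun).
Let inrid : conv H (tens_alg H H) := conv_comp (@tens_inr k H H) (conv_of idfun).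

Let comulE : conv_comp (@comul_alg k H) (conv_of idfun) = inlid * inrid.
Proof.
apply: convP => h; rewrite convME -[LHS]tens_lift_tensor /=.
by apply: eq_tens_lift => a b; rewrite /tens_inl /tens_inr tens_algM mulr1 mul1r.
Qed.

Let inl_inr_comm : GRing.comm inlid inrid.
Proof.
rewrite /GRing.comm -comulE; apply: convP => h; rewrite convME /= /comul_alg -[LHS]coH.
by apply: eq_tens_lift => a b; rewrite /tens_inl /tens_inr tens_algM mulr1 mul1r.
Qed.

Lemma conv_comp_eulerian (A B : algType k) (phi : {lrmorphism A -> B}) N (x : conv H A) :
  conv_comp phi (eulerian N x) = eulerian N (conv_comp phi x).
Proof.
rewrite linear_sum; apply: eq_bigr => i _ /=.
by rewrite linearZ /= rmorphXn.
Qed.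

(* With x = J (x) 1 and y = 1 (x) J for J = id - eta epsilon, cocommutativity makes
   Delta = (1 + x) * (1 + y) a product of commuting factors, so that the coefficient of n
   in Delta^n = (1 + x)^n * (1 + y)^n splits as a sum. *)
Lemma eulerian_primitive N h :
  Fil 1 N.+1 h -> is_primitive (eulerian N.+1 unipot h).
Proof.
move=> Fh; apply/eqP.
pose x := conv_comp (@tens_inl k H H) unipot; pose y := conv_comp (@tens_inr k H H) unipot.
have x1 : x 1 = 0 by rewrite conv_compE unipot1 linear0.
have y1 : y 1 = 0 by rewrite conv_compE unipot1 linear0.
have xE : x + 1 = inlid by rewrite /x /unipot rmorphB rmorph1 subrK.
have yE : y + 1 = inrid by rewrite /y /unipot rmorphB rmorph1 subrK.
have xy : GRing.comm x y.
  rewrite -[x](addrK 1) -[y](addrK 1) xE yE.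
  apply: commrB; last exact: commr1.
  by apply/commr_sym/commrB; [apply: commr_sym | apply: commr1].
rewrite -[LHS]/(conv_comp (@comul_alg k H) (eulerian N.+1 unipot) h).
have -> : eulerian N.+1 unipot h ⊗t 1 = eulerian N.+1 x h.
  by rewrite -conv_comp_eulerian.
have -> : 1 ⊗t eulerian N.+1 unipot h = eulerian N.+1 y h.
  by rewrite -conv_comp_eulerian.
apply: (@functional_inj k (tens_alg H H)) => F.
pose d i := F (conv_comp (@comul_alg k H) (unipot ^+ i) h) : k.
pose c a b := F ((x ^+ a * y ^+ b) h) : k.
(* At each natural [n] both sides compute [F] of the [n]-th convolution power of the coproduct at
   [h]. *)
have pq : \sum_(i < N.+1) d i *: binp i =
          \sum_(a < N.+1) \sum_(b < N.+1) c a b *: (binp a * binp b).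
  apply: (poly_nat_eq char0) => n.
  transitivity (F (conv_comp (@comul_alg k H) ((unipot + 1) ^+ n * 1) h) : k).
    rewrite conv_compE (exp1D_binp coH char0 n unipot1 Fh (commr1 _)) !linear_sum horner_sum.
    apply: eq_bigr => i _; rewrite hornerZ mulr1 !linearZ /= mulrC.
    by [].
  rewrite mulr1 unipotD1 rmorphXn /= comulE exprMn_comm // -xE -yE.
  rewrite (exp2D_binp coH char0 n x1 y1 xy Fh) linear_sum horner_sum.
  apply: eq_bigr => a _; rewrite linear_sum horner_sum.
  by apply: eq_bigr => b _; rewrite hornerZ linearZ; apply: mulrC.
(* Since [binp a] has constant term 0 for [a > 0], only the pairs with [a = 0] or [b = 0] survive in
   degree 1. *)
have coefM1 (p q : {poly k}) : (p * q)`_1 = p`_0 * q`_1 + p`_1 * q`_0.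
  by rewrite coefM big_ord_recl big_ord1.
have eulE (B : algType k) (G : {linear B -> k^o}) (z : conv H B) :
    G (eulerian N.+1 z h) = \sum_(i < N.+1) (G ((z ^+ i) h) : k) * (binp i)`_1.
  rewrite conv_sumE linear_sum; apply: eq_bigr => i _.
  by rewrite convZE linearZ mulrC.
have := congr1 (fun p : {poly k} => p`_1) pq.
rewrite linearD conv_comp_eulerian !eulE coef_sum.
under eq_bigr => i _ do rewrite coefZ /d rmorphXn.
move=> ->; rewrite coef_sum.
under eq_bigr => a _.
  rewrite coef_sum; under eq_bigr => b _ do
    rewrite coefZ coefM1 !(binp_coef0 char0) mulrDr.
  rewrite big_split; over.
rewrite big_split /= addrC; congr (_ + _); last first.
  rewrite big_ord_recl [X in _ + X]big1 ?addr0 => [|a _].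
    by apply: eq_bigr => b _; rewrite mul1r /c expr0 mul1r.
  by rewrite big1 // => b _; rewrite mul0r mulr0.
apply: eq_bigr => a _; rewrite big_ord_recl [X in _ + X]big1 ?addr0 => [|b _].
  by rewrite mulr1 /c expr0 mulr1.
by rewrite mulr0 mulr0.
Qed.

End EulerianPrimitive.

(** * Injectivity and surjectivity of U(g) -> H^1 *)

Section Cartier.
Context {k : fieldType} (char0 : [pchar k] =i pred0).
Context {H : hopfAlgType k} (coH : cocommutative H).

Definition uea_im (h : H) := exists u, uea_incl H u = h.

Lemma uea_im_subspace : subspace uea_im.
Proof.
split=> [|a _ _ [u <-] [v <-]]; first by exists 0; rewrite linear0.
by exists (a *: u + v); rewrite linearP.
Qed.

Lemma uea_im1 : uea_im 1. Proof. by exists 1; rewrite rmorph1. Qed.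

Lemma uea_imM x y : uea_im x -> uea_im y -> uea_im (x * y).
Proof. by move=> [u <-] [v <-]; exists (u * v); rewrite rmorphM. Qed.

Lemma uea_incl_gen (x : primitive H) : uea_incl H (uea_gen x) = pval x.
Proof. exact: uea_liftE. Qed.

Lemma uea_im_primitive h : is_primitive h -> uea_im h.
Proof. by move=> Ph; exists (uea_gen (Primitive Ph)); rewrite uea_incl_gen. Qed.

(* Modulo the image of U(g), the element h is congruent to its primitive Eulerian part:
   by induction the higher convolution powers of id - eta epsilon take h into that image. *)
Lemma Fil1_uea_im N (h : H) : Fil 1 N h -> uea_im h.
Proof.
have sI := uea_im_subspace.
elim: N h => [|N IHN] h; first by move->; apply: subspace0.
(* The map [q] built from [p] agrees with [unipot] on [Fil 1 N] by induction, yet all its values,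
   and those of its convolution powers, lie in the image of U(g). *)
have [|p [pI pid _]] := projection_exists sI subspace_eq0; first by [].
pose q : conv H H := conv_of (p \o unipot).
have q1 : q 1 = 0 by rewrite -[q 1]/(p (unipot 1)) unipot1 linear0.
have kJ : kill N (unipot - q).
  move=> x Fx; rewrite convBE -[q x]/(p (unipot x)) pid ?subrr // unipotE.
  apply: subspaceB => //; first exact: IHN.
  exact: (subspaceZ _ sI uea_im1).
have qI i x : uea_im ((q ^+ i) x).
  elim: i x => [|i IHi] x; first by rewrite expr0 conv1E; apply: (subspaceZ _ sI uea_im1).
  rewrite exprS convME; apply: tens_lift_in sI _ => [|a b]; first exact: bilinM.
  by apply: uea_imM => //; apply: pI.
(* Telescoping: each term has a factor killing [Fil 1 N] and a factor vanishing at 1, which gains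
   one step. This requires exponent at least 2. *)
have kS i : kill N.+1 (unipot ^+ i.+2 - q ^+ i.+2).
  have kill0 n (F G : conv H H) : kill n F -> kill n G -> kill n (F + G).
    by move=> kF kG x Fx; rewrite convDE kF ?kG ?addr0.
  have E (j : nat) : unipot ^+ j.+1 - q ^+ j.+1 =
      unipot * (unipot ^+ j - q ^+ j) + (unipot - q) * q ^+ j.
    by move: unipot => J; rewrite mulrBl mulrBr !exprS addrA subrK.
  elim: i => [|i IHi]; rewrite E; apply: kill0.
  - by apply: kill_mulr; [exact: unipot1 | rewrite !expr1].
  - by apply: kill_mull; rewrite ?expr1.
  - by apply: kill_mulr; [exact: unipot1 | move=> x Fx; apply/IHi/FilS].
  - by apply: kill_mull => //; rewrite exprS conv_mul_1 q1 mul0r.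
move=> Fh.
(* One step is added so that the truncated logarithm contains its terms of degree 0 and 1 even when
   [N = 0]. *)
have Fh3 : Fil 1 N.+2 h by apply: FilS.
have := eulerian_primitive char0 coH Fh3 => /uea_im_primitive.
rewrite /eulerian -(big_mkord xpredT (fun i => (binp i : {poly k})`_1 *: unipot ^+ i)).
rewrite 2?big_nat_recl // binp0_coef1 binp1_coef1 // scale0r add0r scale1r expr1 big_mkord.
rewrite convDE conv_sumE; set S := \sum_(i < N) _ => Ie.
have SI : uea_im S.
  apply: subspace_sum => // i _; rewrite convZE; apply: subspaceZ => //.
  by rewrite -[_ h](subrK ((q ^+ i.+2) h)) -convBE kS // add0r.
have JI : uea_im (unipot h) by rewrite -[unipot h](addrK S); apply: subspaceB.
rewrite -[h](subrK ((counit h : k) *: 1)) -unipotE; apply: subspaceD => //.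
exact: (subspaceZ _ sI uea_im1).
Qed.

End Cartier.

Section Induction.
Context {k : fieldType}.

Lemma monoid_alg_ind (M : monoidType) (P : monoid_alg k M -> Prop) :
  subspace P -> (forall m, P (mbase k m)) -> forall a, P a.
Proof.
rewrite mbase.unlock => sP PU a; rewrite [a]malg_scaleE.
by apply: (subspace_sum _ sP) => x _; apply: (subspaceZ _ sP).
Qed.

Lemma talg_ind (V : lmodType k) (P : talg V -> Prop) : subspace P -> P 1 ->
  (forall v t, P t -> P (talg_gen v * t)) -> forall t, P t.
Proof.
move=> sP P1 PM; apply: alg_ind => a.
pose Q (a : monoid_alg k (free_monoid V)) := P (alg_class (@talg_rel_proper k V) a).
apply: (monoid_alg_ind (P := Q)) => {a} [|m].
  split=> [|a x y Px Py]; rewrite /Q ?linear0 ?linearP; first exact: subspace0.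
  exact: sP.2.
elim: m => [|v m IHm]; first by rewrite /Q mbase1 rmorph1.
have -> : v :: m = (([:: v] : free_monoid V) * m)%g by [].
by rewrite /Q mbaseM rmorphM; apply: PM.
Qed.

Lemma quot_talg_ind (V : lmodType k) (S : talg V -> Prop) (pS : proper_rel S)
    (P : quotalg pS -> Prop) : subspace P -> P 1 ->
  (forall v t, P t -> P (alg_class pS (talg_gen v) * t)) -> forall t, P t.
Proof.
move=> sP P1 PM; apply: alg_ind => t.
move: t; apply: talg_ind => [||v t Pt]; rewrite ?rmorph1 //.
  split=> [|a x y Px Py]; rewrite ?linear0 ?linearP; first exact: subspace0.
  exact: sP.2.
by rewrite rmorphM; apply: PM.
Qed.

Lemma uea_ind (L : lieAlgType k) (P : uea L -> Prop) : subspace P -> P 1 ->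
  (forall x u, P u -> P (uea_gen x * u)) -> forall u, P u.
Proof. exact: quot_talg_ind. Qed.

Lemma par_hopf_ind (H : hopfAlgType k) (P : par_hopf H -> Prop) : subspace P -> P 1 ->
  (forall h t, P t -> P (par_class h * t)) -> forall t, P t.
Proof. exact: quot_talg_ind. Qed.

(* Powers of Lie algebra elements span U(g) *)
End Induction.

Section LinearTerm.
Context {k : fieldType} (char0 : [pchar k] =i pred0) {A : algType k}.
Implicit Types a b : A.

(* The coefficient of t in (a + t b)^n. *)
Fixpoint dexp a b n : A := if n is m.+1 then a * dexp a b m + b * a ^+ m else 0.

Lemma dexp_in_subspace (W : A -> Prop) a b n : subspace W ->
  (forall t, W ((a + b *+ t) ^+ n)) -> W (dexp a b n).
Proof.
move=> sW Wab; pose P m : {poly A} := (a%:P + b%:P * 'X) ^+ m.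
have P0 m : (P m)`_0 = a ^+ m.
  elim: m => [|m IHm]; first by rewrite /P expr0 coef1.
  by rewrite /P !exprS -/(P m) mulrDl coefD -mulrA !coefCM coefXM mulr0 addr0 IHm.
have <- : (P n)`_1 = dexp a b n.
  elim: {Wab} n => [|m IHm]; first by rewrite /P expr0 coef1.
  by rewrite /P exprS -/(P m) mulrDl coefD -mulrA !coefCM coefXM /= P0 IHm.
have [lt1 | ] := ltnP 1 (size (P n)); last by move/leq_sizeP->; first exact: subspace0.
apply: (coef_in_subspace char0 (v := fun j => (P n)`_j) sW _ lt1) => t.
have -> : \sum_(j < size (P n)) t%:R ^+ j *: (P n)`_j = (P n).[t%:R].
  rewrite horner_coef; apply: eq_bigr => j _.
  by rewrite -!natrX scaler_nat mulr_natr.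
have lE : (a%:P + b%:P * 'X).[t%:R] = a + b *+ t.
  by rewrite hornerD hornerMX !hornerC mulr_natr.
have lC : comm_poly (a%:P + b%:P * 'X) t%:R by exact/commr_sym/commr_nat.
by rewrite /P (horner_exp_comm n lC) lE.
Qed.

End LinearTerm.

Section UeaPowers.
Context {k : fieldType} (char0 : [pchar k] =i pred0) {L : lieAlgType k}.
Implicit Types (x y : L) (u : uea L).
Local Notation gen := (@uea_gen k L).

Lemma uea_gen_bracket x y : gen (lie_bracket x y) = gen x * gen y - gen y * gen x.
Proof.
have /(alg_class0 (@uea_rel_proper k L)) := UeaRel x y.
rewrite linearB /= linearB /= !rmorphM /= => /eqP.
by rewrite subr_eq0 => /eqP E; apply: esym.
Qed.

Definition uea_pow n : uea L -> Prop :=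
  span (fun u => exists x j, (j <= n)%N /\ u = gen x ^+ j).

Lemma uea_pow_subspace n : subspace (uea_pow n).
Proof. exact: span_subspace. Qed.

Lemma uea_pow_gen x n : uea_pow n (gen x ^+ n).
Proof. by apply: spanS; exists x, n. Qed.

Lemma uea_pow_mono m n u : (m <= n)%N -> uea_pow m u -> uea_pow n u.
Proof.
move=> lemn; apply: span_min (uea_pow_subspace n) _ => _ [x [j [lejm ->]]].
by apply: spanS; exists x, j; rewrite (leq_trans lejm).
Qed.

(** Polarization: the coefficient of t in [(x + t y)^(n+1)] lies in the span of powers. Moving [y]
    to the left in it produces brackets, which induction places in lower degree, so it is
    [(n+1) y x^n] modulo [uea_pow n]; then divide by [n+1]. *)
Lemma uea_pow_mul n y u : uea_pow n u -> uea_pow n.+1 (gen y * u).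
Proof.
elim/ltn_ind: n y u => n IHn y u.
have sS := uea_pow_subspace n.+1.
have : subspace (fun u => uea_pow n.+1 (gen y * u)).
  split=> [|a v w Wv Ww]; first by rewrite mulr0; apply: subspace0.
  by rewrite mulrDr -scalerAr; apply: sS.2.
move/span_min; apply=> {u} _ [x [j [lejn ->]]].
have [ltjn | /(conj lejn)/andP] := ltnP j n.
  by apply: (@uea_pow_mono j.+1) => //; apply/(IHn j ltjn)/uea_pow_gen.
rewrite -eqn_leq => /eqP->{j lejn}.
pose D := dexp (gen x) (gen y).
have DS m : D m.+1 = gen x * D m + gen y * gen x ^+ m by [].
have Wrest m : (m <= n)%N -> uea_pow m (D m.+1 - (gen y * gen x ^+ m) *+ m.+1).
  elim: m => [|m IHm] lemn.
    rewrite DS mulr0 add0r mulr1n subrr; exact: (subspace0 (uea_pow_subspace 0)).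
  have sm := uea_pow_subspace m.+1.
  have -> : D m.+2 - (gen y * gen x ^+ m.+1) *+ m.+2 =
      gen x * (D m.+1 - (gen y * gen x ^+ m) *+ m.+1) +
      (gen (lie_bracket x y) * gen x ^+ m) *+ m.+1.
    rewrite DS mulrS opprD addrA addrK mulrBr uea_gen_bracket mulrBl mulrnBl.
    by rewrite mulrnAr -!mulrA -exprS addrA subrK.
  apply: subspaceD => //; first by apply: IHn => //; apply/IHm/ltnW.
  by rewrite -scaler_nat; apply: subspaceZ => //; apply: IHn (uea_pow_gen _ _).
have WD : uea_pow n.+1 (D n.+1).
  apply: (dexp_in_subspace char0 sS) => t.
  by rewrite -linearMn -linearD; apply: uea_pow_gen.
have WyS : uea_pow n.+1 ((gen y * gen x ^+ n) *+ n.+1).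
  rewrite -[_ *+ _](subKr (D n.+1)); apply: subspaceB => //.
  by apply: uea_pow_mono (Wrest n _).
have /(subspaceZ (n.+1%:R)^-1 sS) := WyS.
by rewrite -scaler_nat scalerA mulVf ?scale1r // natr_neq0.
Qed.

(** The spanning half of the Poincaré-Birkhoff-Witt theorem, in symmetrized form. *)
Lemma uea_pow_span u : exists n, uea_pow n u.
Proof.
move: u; apply: uea_ind => [||x u [n Wu]].
- split=> [|a u v [m Wu] [n Wv]]; first by exists 0%N; apply: SpanNil.
  exists (maxn m n); apply: (uea_pow_subspace _).2.
    by apply: uea_pow_mono Wu; apply: leq_maxl.
  by apply: uea_pow_mono Wv; apply: leq_maxr.
- by exists 0%N; apply: (uea_pow_gen 0 0).
- by exists n.+1; apply: uea_pow_mul.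
Qed.

End UeaPowers.

Section Injectivity.
Context {k : fieldType} (char0 : [pchar k] =i pred0).
Context {H : hopfAlgType k}.
Local Notation U := (uea (primitive H)).

Lemma counit_primitive (x : primitive H) : counit (pval x) = 0.
Proof.
have /eqP Dx := pvalP x.
have cb : bilin (fun a b : H => (counit a : k) *: b) by exact: (bilinZ counit idfun).
have := counitl (pval x).
rewrite Dx (tens_liftD cb) !tens_liftE // rmorph1 scale1r.
move/eqP; rewrite -subr_eq0 addrK => /eqP/(congr1 counit)/eqP.
rewrite linearZ rmorph1 linear0 => /eqP E; rewrite -[LHS]mulr1; exact: E.
Qed.

Lemma comul_primitive_exp (x : primitive H) n : comul (pval x ^+ n) =
  \sum_(i < n.+1) (pval x ^+ (n - i) ⊗t pval x ^+ i) *+ 'C(n, i).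
Proof.
have /eqP Dx := pvalP x.
rewrite -[LHS]/(comul_alg (pval x ^+ n)) rmorphXn /=.
have -> : comul_alg (pval x) = tens_inl H (pval x) + tens_inr H (pval x) by [].
rewrite exprDn_comm; last first.
  by rewrite /GRing.comm /tens_inl /tens_inr !tens_algM !mulr1 !mul1r.
apply: eq_bigr => i _; congr (_ *+ _).
by rewrite -!rmorphXn /tens_inl /tens_inr tens_algM mulr1 mul1r.
Qed.

Lemma conv_primitive_exp (A : algType k) (F G : conv H A) (x : primitive H) n :
  (F * G) (pval x ^+ n) =
  \sum_(i < n.+1) (F (pval x ^+ (n - i)) * G (pval x ^+ i)) *+ 'C(n, i).
Proof.
rewrite convME comul_primitive_exp.
have bFG : bilin (fun a b => F a * G b) by exact: bilinM.
rewrite (tens_lift_sum bFG); apply: eq_bigr => i _.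
by rewrite (tens_liftMn bFG) tens_liftE.
Qed.

(** Induction on [t]: one more convolution factor turns [t ^ n] into [(1 + t) ^ n] by the binomial
    theorem. *)
Lemma adams_primitive_exp t (x : primitive H) n :
  (conv_of idfun ^+ t : conv H H) (pval x ^+ n) = (t%:R : k) ^+ n *: pval x ^+ n.
Proof.
elim: t n => [|t IHt] n.
  rewrite expr0 conv1E rmorphXn /= counit_primitive.
  by case: n => [|n]; rewrite ?expr0 // !expr0n /= !scale0r.
rewrite exprS conv_primitive_exp -[in RHS]natr1 addrC exprDn scaler_suml.
apply: eq_bigr => i _; rewrite IHt /= -scalerAr -exprD subnK ?leq_ord //.
by rewrite expr1n mul1r scalerMnl.
Qed.

Definition nonlinear_powers : H -> Prop :=
  span (fun w => exists (x : primitive H) n, n != 1%N /\ w = pval x ^+ n).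

(* The Adams operation id^t multiplies x^n by t^n, so a combination of powers with n != 1
   on which it acts as t must vanish. *)
Lemma primitive_nonlinear w : is_primitive w -> nonlinear_powers w -> w = 0.
Proof.
move=> Pw Nw; apply: functional_sep => f.
have [p [p1 pE]] : exists p : {poly k}, p`_1 = 0 /\
    forall t, f ((conv_of idfun ^+ t : conv H H) w) = p.[t%:R].
  elim: Nw => [|a _ z [x [n [n1 ->]]] _ [p [p1 pE]]].
    by exists 0; split=> [|t]; rewrite ?coef0 // horner0 !linear0.
  exists ((a * f (pval x ^+ n)) *: 'X^n + p); split=> [|t].
    by rewrite coefD coefZ coefXn p1 addr0 eq_sym (negPf n1) mulr0.
  pose T := conv_of idfun ^+ t : conv H H.
  have -> : T (a *: pval x ^+ n + z) = a *: T (pval x ^+ n) + T z by rewrite linearP.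
  rewrite /T adams_primitive_exp linearP linearZ pE hornerD hornerZ hornerXn.
  by congr (_ + _); rewrite [LHS]mulrA; apply: mulrAC.
have /(congr1 (fun p : {poly k} => p`_1)) : p = f w *: 'X.
  apply: (poly_nat_eq char0) => t; rewrite -pE hornerZ hornerX.
  have := adams_primitive_exp t (Primitive Pw) 1; rewrite !expr1 /= => ->.
  by rewrite linearZ; apply: mulrC.
by rewrite p1 coefZ coefX mulr1.
Qed.

Lemma primitive_subspace : subspace (@is_primitive k H).
Proof.
have [P0 PD] := @primitive_submod_closed k H.
by split=> // a x y; apply: PD.
Qed.

(* If p projects H onto g and kills x^n for n != 1, the n-th convolution power of p with
   values in U(g) sends x^m to n! x^n when m = n and to 0 otherwise, so the sum of these
   powers over n! is a left inverse of the inclusion on the span of the x^n. *)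
Lemma uea_incl_inj : injective (uea_incl H).
Proof.
have [|p [pP pid p0]] := projection_exists primitive_subspace
    (@span_subspace _ _ _ : subspace nonlinear_powers).
  exact: primitive_nonlinear.
pose g (h : H) := uea_gen (Primitive (pP h)) : U.
have lg : linear g.
  by move=> a x y; rewrite /g -linearP; congr uea_gen; apply: val_inj; rewrite /= linearP.
have gx (x : primitive H) : g (pval x) = uea_gen x.
  by congr uea_gen; apply: val_inj; apply: pid; apply: pvalP.
have g0 (x : primitive H) n : n != 1%N -> g (pval x ^+ n) = 0.
  move=> n1; rewrite -[RHS](linear0 (@uea_gen k (primitive H))); congr uea_gen.
  by apply: val_inj; rewrite /= p0 //; apply: spanS; exists x, n.
pose G : conv H U := Conv lg.
have Gn n m (x : primitive H) : (G ^+ n) (pval x ^+ m) = (n`! * (m == n))%:R *: uea_gen x ^+ n.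
  elim: n m => [|n IHn] m.
    rewrite expr0 conv1E rmorphXn /= counit_primitive expr0 mul1n.
    by case: m => [|m]; rewrite ?expr0 // expr0n.
  rewrite exprS conv_primitive_exp.
  (* The left factor vanishes unless [m - i = 1], the right one unless [i = n]; the surviving term
     carries the binomial coefficient [n.+1]. *)
  have [-> | nmn] := eqVneq m n.+1.
    rewrite muln1 (bigD1 (inord n)) //= inordK // big1 ?addr0 => [|i /eqP ni].
      rewrite IHn eqxx muln1 subSn // subnn expr1 /= gx -scalerAr -exprS.
      by rewrite binSn -scaler_nat scalerA -natrM factS.
    have [ | nin] := eqVneq (n.+1 - i)%N 1%N; last by rewrite /= g0 // mul0r mul0rn.
    move=> E; case: ni; apply: val_inj; rewrite /= inordK //.
    by apply: succn_inj; rewrite -[RHS](subnK (leq_ord i)) E.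
  rewrite muln0 scale0r big1 // => i _; rewrite /= IHn.
  have [ | nin] := eqVneq (m - i)%N 1%N; last by rewrite g0 // mul0r mul0rn.
  have [eqin | nni] := eqVneq (i : nat) n; last by rewrite muln0 scale0r mulr0 mul0rn.
  by move=> E; case/eqP: nmn; rewrite -(subnK (leq_ord i)) E eqin.
(* The convolution exponential of [G], truncated beyond the exponents that occur. *)
pose R N : conv H U := \sum_(n < N) ((n`!%:R : k)^-1) *: G ^+ n.
have RE N u : uea_pow N u -> R N.+1 (uea_incl H u) = u.
  have sR : subspace (fun u => R N.+1 (uea_incl H u) = u).
    split=> [|a v w Rv Rw]; first by rewrite !linear0.
    by rewrite linearP [LHS]linearP; congr (_ *: _ + _).
  apply: span_min sR _ => _ [x [j [lejN ->]]].
  rewrite rmorphXn /= uea_incl_gen conv_sumE (bigD1 (inord j)) // inordK //.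
  rewrite convZE Gn eqxx muln1 scalerA mulVf ?scale1r; last first.
    by rewrite -(prednK (fact_gt0 j)) natr_neq0.
  rewrite big1 => [|i]; first exact: addr0.
  rewrite andTb => /eqP ji; rewrite convZE Gn.
  have [E | _] := eqVneq j i; last by rewrite muln0 scale0r scaler0.
  by case: ji; apply: val_inj; rewrite /= inordK.
move=> u v uv; have [n nuv] := uea_pow_span char0 (u - v).
have := RE _ _ nuv; rewrite linearB /= uv subrr linear0 => /esym/eqP.
by rewrite subr_eq0 => /eqP.
Qed.

End Injectivity.

(** * The decomposition of H into the components U(g) g *)

Section Multiplication.
Context {k : fieldType} {A : algType k}.
Implicit Type x : A.

Fact comp_mull_linear_id x : linear (fun y => x * y).
Proof. by move=> a y z; rewrite mulrDr scalerAr. Qed.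
Fact comp_mulr_linear_id x : linear (fun y => y * x).
Proof. by move=> a y z; rewrite mulrDl scalerAl. Qed.

Definition mull_lin x : {linear A -> A} := linear_of (comp_mull_linear_id x).
Definition mulr_lin x : {linear A -> A} := linear_of (comp_mulr_linear_id x).

End Multiplication.

Section Translation.
Context {k : fieldType} {H : hopfAlgType k}.
Implicit Types (f : {linear H -> k^o}) (g h x : H).

Lemma act_primitive_mul f x h : is_primitive x ->
  act f (x * h) = act (f \o mull_lin x) h + x * act f h.
Proof.
move=> /eqP Dx; rewrite /act -[comul _]/(comul_alg (x * h)) rmorphM /=.
rewrite -[comul_alg x]/(comul x) Dx -[comul h]/(comul_alg h).
move: (comul_alg h); apply: tens_linear_eq => [a s t|a s t|u v].
- by rewrite mulrDr -scalerAr linearP.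
- by rewrite !linearP mulrDr -scalerAr scalerDr addrACA.
rewrite mulrDl !tens_algM !mul1r linearD /= !contrE /=.
by rewrite -scalerAr.
Qed.

Lemma act_mul_grouplike f g h : is_grouplike g ->
  act f (h * g) = act (f \o mulr_lin g) h * g.
Proof.
move=> /grouplikeP[Dg _]; rewrite /act -[comul _]/(comul_alg (h * g)) rmorphM /=.
rewrite -[comul_alg g]/(comul g) Dg -[comul h]/(comul_alg h).
move: (comul_alg h); apply: tens_linear_eq => [a s t|a s t|u v].
- by rewrite mulrDl -scalerAl linearP.
- by rewrite !linearP mulrDl -scalerAl.
by rewrite tens_algM !contrE /= -scalerAl.
Qed.

Lemma Fil_primitive_mul (coH : cocommutative H) g n x h :
  is_primitive x -> Fil g n h -> Fil g n.+1 (x * h).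
Proof.
move=> Px; elim: n h => [|n IHn] h Fh f.
  by rewrite Fh mulr0 linear0 scaler0 subrr.
rewrite act_primitive_mul // -addrA scalerAr -mulrBr.
apply: (subspaceD (Fil_subspace g n.+1)).
- exact: Fil_act.
- exact/IHn/Fh.
Qed.

(** With [g'] the inverse of [g], this carries the component of [g] to that of 1, where
    [Fil1_uea_im] applies. *)
Lemma Fil_mul_grouplike g g' n h : is_grouplike g' ->
  Fil g n h -> Fil (g * g') n (h * g').
Proof.
move=> Gg'; elim: n h => [|n IHn] h Fh; first by rewrite Fh mul0r.
move=> f; rewrite act_mul_grouplike // scalerAl -mulrBl.
exact/IHn/(Fh (f \o mulr_lin g')).
Qed.

End Translation.

Lemma sum_regroup (I J : eqType) (V : nmodType) (r : seq I) (p : I -> J) (F : I -> V) :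
  \sum_(i <- r) F i = \sum_(j <- undup (map p r)) \sum_(i <- r | p i == j) F i.
Proof.
rewrite (exchange_big_dep xpredT) //= big_seq [RHS]big_seq; apply: eq_bigr => i ir.
rewrite (eq_bigl (pred1 (p i))) => [|j]; last exact: eq_sym.
by rewrite -big_filter filter_pred1_uniq ?undup_uniq ?mem_undup ?map_f // big_seq1.
Qed.

Section Component.
Context {k : fieldType} {H : hopfAlgType k}.
Local Notation inc := (uea_incl H).
Implicit Types (g : grouplike H).

Definition component g (h : H) := exists u, h = inc u * gval g.

Lemma component_subspace g : subspace (component g).
Proof.
split=> [|a _ _ [u ->] [v ->]]; first by exists 0; rewrite linear0 mul0r.
by exists (a *: u + v); rewrite linearP mulrDl -scalerAl.
Qed.

End Component.

Section CartierKostant.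
Context {k : closedFieldType} (char0 : [pchar k] =i pred0).
Context {H : hopfAlgType k} (coH : cocommutative H).
Local Notation G := (grouplike H).
Local Notation U := (uea (primitive H)).
Local Notation inc := (uea_incl H).
Implicit Types (g : G) (u v : U).

Lemma component_Fil g h : component g h -> exists n, Fil (gval g) n h.
Proof.
move=> [u ->]; move: u; apply: uea_ind => [||x u [n Fu]].
- split=> [|a u v [m Fu] [n Fv]].
    by exists 0%N; rewrite linear0 mul0r.
  exists (maxn m n); rewrite linearP mulrDl -scalerAl; apply: (Fil_subspace _ _).2.
    exact: (Fil_mono coH (leq_maxl m n)).
  exact: (Fil_mono coH (leq_maxr m n)).
- by exists 1%N; rewrite rmorph1 mul1r; apply/Fil_grouplike/gvalP.
- exists n.+1; rewrite rmorphM /= uea_incl_gen -mulrA.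
  exact: (Fil_primitive_mul coH (pvalP x)).
Qed.

Lemma component_span h : span (fun y => exists g, component g y) h.
Proof.
refine (span_mono (Fil_span coH h) _) => y [g [n [Gg Fg]]].
apply: spanS; exists (Grouplike Gg).
pose gi : G := ((Grouplike Gg)^-1)%g.
have ggi : g * gval gi = 1 by have := congr1 gval (mulgV (Grouplike Gg)).
have gig : gval gi * g = 1 by have := congr1 gval (mulVg (Grouplike Gg)).
have := Fil_mul_grouplike (gvalP gi) Fg; rewrite ggi => /(Fil1_uea_im char0 coH)[u uE].
by exists u; rewrite uE -mulrA gig mulr1.
Qed.

Lemma component_independent (s : seq (G * U)) :
    \sum_(p <- s) inc p.2 * gval p.1 = 0 ->
  forall g, \sum_(p <- s | p.1 == g) p.2 = 0.
Proof.
move=> s0 g; pose S := undup (map fst s).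
pose v g := \sum_(p <- s | p.1 == g) p.2.
have [gS | gS] := boolP (g \in S); last first.
  rewrite big_seq_cond big1 // => p /andP[ps /eqP pg].
  by case/negP: gS; rewrite mem_undup -pg map_f.
have sumv : \sum_(g <- S) inc (v g) * gval g = 0.
  rewrite -[RHS]s0 (sum_regroup _ fst); apply: eq_bigr => g' _.
  by rewrite linear_sum mulr_suml; apply: eq_bigr => p /eqP->.
have := Fil_independent coH (undup_uniq _) _ sumv gS.
move=> h; apply: (uea_incl_inj char0); rewrite linear0 -[LHS]mulr1.
have <- : gval g * gval (g^-1)%g = 1 by have := congr1 gval (mulgV g).
rewrite mulrA h ?mul0r // => g' _; apply: component_Fil; exists (v g').
by [].
Qed.

Local Notation kG := (monoid_alg k G).

(** Its bijectivity is the Cartier-Kostant decomposition of [H] as a vector space. *)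
Definition from_tens : U ⊗ kG -> H := tens_lift (fun u c => inc u * mext gval c).

Lemma from_tens_bilin : bilin (fun u (c : kG) => inc u * mext gval c).
Proof. exact: bilinM. Qed.

HB.instance Definition _ := GRing.isLinear.Build k (U ⊗ kG) H *:%R
  from_tens (tens_lift_is_linear from_tens_bilin).

Lemma from_tensE u g : from_tens (u ⊗t mbase k g) = inc u * gval g.
Proof. by rewrite /from_tens (tens_liftE from_tens_bilin) mextE. Qed.

Lemma tens_kG_seq (t : U ⊗ kG) :
  exists s : seq (G * U), t = \sum_(p <- s) p.2 ⊗t mbase k p.1.
Proof.
pose P (t : U ⊗ kG) := exists s : seq (G * U), t = \sum_(p <- s) p.2 ⊗t mbase k p.1.
have sP : subspace P.
  split=> [|a _ _ [s ->] [s' ->]]; first by exists [::]; rewrite big_nil.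
  exists ([seq (p.1, a *: p.2) | p <- s] ++ s'); rewrite big_cat big_map scaler_sumr.
  by congr (_ + _); apply: eq_bigr => p _; rewrite tensZl.
move: t; apply: tens_ind => [|a u c t Pt]; first exact: (subspace0 sP).
apply: sP.2 => //; move: c; apply: monoid_alg_ind => [|g].
  split=> [|b c d Pc Pd]; first by rewrite -(scale0r (0 : kG)) tensZr scale0r; apply: (subspace0 sP).
  by rewrite tensDr tensZr; apply: sP.2.
by exists [:: (g, u)]; rewrite big_seq1.
Qed.

Lemma from_tens_inj : injective from_tens.
Proof.
move=> t t' tt'; apply/eqP; rewrite -subr_eq0; apply/eqP.
have : from_tens (t - t') = 0 by rewrite linearB /= tt' subrr.
have [s ->] := tens_kG_seq (t - t'); rewrite linear_sum.
under eq_bigr => p _ do rewrite /= from_tensE.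
move=> /component_independent s0.
pose S := undup (map fst s).
transitivity (\sum_(g <- S) (\sum_(p <- s | p.1 == g) p.2) ⊗t mbase k g).
  have tsum g r : (\sum_(p <- r | p.1 == g) p.2) ⊗t mbase k g =
      \sum_(p <- r | p.1 == g) (p.2 : U) ⊗t mbase k (p.1 : G).
    pose T : {linear U -> U ⊗ kG} := linear_of ((tens_bilin U kG).1 (mbase k g)).
    rewrite -[LHS]/(T _) linear_sum.
    by apply: eq_bigr => p /eqP->.
  under [RHS]eq_bigr => g _ do rewrite tsum.
  exact: sum_regroup.
by rewrite big1 // => g _; rewrite s0 -(scale0r (0 : U)) tensZl scale0r.
Qed.

Lemma from_tens_surj h : exists t, from_tens t = h.
Proof.
pose W h := exists t, from_tens t = h.
refine (span_min (W := W) _ _ (component_span h)) => [|y [g [u ->]]].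
  split=> [|a _ _ [s <-] [t <-]]; first by exists 0; rewrite linear0.
  by exists (a *: s + t); rewrite linearP.
by exists (u ⊗t mbase k g); rewrite from_tensE.
Qed.

(** The form in which the decomposition is used: linear maps out of [H] can be prescribed freely on
    each component. *)
Lemma component_ext (W : lmodType k) (F : G -> {linear U -> W}) :
  exists Phi : {linear H -> W}, forall g u, Phi (inc u * gval g) = F g u.
Proof.
have [inv invK] := choice from_tens_surj.
have linv : linear inv.
  by move=> a x y; apply: from_tens_inj; rewrite linearP /= !invK.
pose B u c := mext (fun g => F g u) (c : kG).
have bB : bilin B.
  split=> [c a u v|u a c d]; rewrite /B /=; last by rewrite linearP.
  by apply: mextP => g; rewrite linearP.
exists (linear_of (tens_lift_is_linear bB) \o linear_of linv) => g u /=.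
have -> : inv (inc u * gval g) = u ⊗t mbase k g.
  by apply: from_tens_inj; rewrite invK from_tensE.
by rewrite tens_liftE // /B mextE.
Qed.

End CartierKostant.

(** * The components as a grading compatible with product, coproduct and antipode *)

Section Components.
Context {k : fieldType} {H : hopfAlgType k}.
Local Notation G := (grouplike H).
Local Notation U := (uea (primitive H)).
Local Notation inc := (uea_incl H).
Implicit Types (g : G) (u v : U) (x : primitive H).

Lemma gvalM g g' : gval (g * g')%g = gval g * gval g'. Proof. by []. Qed.
Lemma gval1 : gval (1%g : G) = 1. Proof. by []. Qed.
Lemma gvalV g : gval (g^-1)%g = antipode (gval g). Proof. by []. Qed.
Lemma gval_mulV g : gval g * gval (g^-1)%g = 1.
Proof. by rewrite -gvalM mulgV. Qed.
Lemma gval_Vmul g : gval (g^-1)%g * gval g = 1.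
Proof. by rewrite -gvalM mulVg. Qed.

Lemma comul_primitive_mul x (h : H) :
  comul (pval x * h) = (pval x ⊗t 1 + 1 ⊗t pval x : tens_alg H H) * comul_alg h :> tens_alg H H.
Proof.
have /eqP Dx := pvalP x.
by rewrite -Dx -[LHS]/(comul_alg (pval x * h)) rmorphM.
Qed.

Lemma conj_primitive g x : is_primitive (gval g * pval x * gval (g^-1)%g).
Proof.
have /eqP Dx := pvalP x.
have /grouplikeP[Dg _] := gvalP g; have /grouplikeP[Dgi _] := gvalP (g^-1)%g.
apply/eqP; rewrite -[LHS]/(comul_alg _) !rmorphM /=.
rewrite -[comul_alg (gval g)]/(comul (gval g)) -[comul_alg (gval (g^-1)%g)]/(comul (gval (g^-1)%g)).
rewrite -[comul_alg (pval x)]/(comul (pval x)) Dx Dg Dgi.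
by rewrite mulrDr mulrDl !tens_algM !mulr1 gval_mulV.
Qed.

Definition conjp g x : primitive H := Primitive (conj_primitive g x).

Lemma conjpE g x : gval g * pval x = pval (conjp g x) * gval g.
Proof. by rewrite /= -mulrA gval_Vmul mulr1. Qed.

Lemma uea_conj g v : exists v', gval g * inc v = inc v' * gval g.
Proof.
move: v; apply: uea_ind => [||x v [v' E]].
- split=> [|a u v [u' Eu] [v' Ev]]; first by exists 0; rewrite !linear0 mulr0 mul0r.
  by exists (a *: u' + v'); rewrite !linearP mulrDr mulrDl -scalerAr -scalerAl Eu Ev.
- by exists 1; rewrite !rmorph1 mulr1 mul1r.
- exists (uea_gen (conjp g x) * v'); rewrite !rmorphM /= !uea_incl_gen mulrA conjpE.
  by rewrite -!mulrA E.
Qed.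

Lemma componentM g g' (a b : H) :
  component g a -> component g' b -> component (g * g')%g (a * b).
Proof.
move=> [u ->] [v ->]; have [v' E] := uea_conj g v.
by exists (u * v'); rewrite rmorphM /= mulrA -[_ * gval g * _]mulrA E !mulrA.
Qed.

Lemma component_primitive x : component 1%g (pval x).
Proof. by exists (uea_gen x); rewrite gval1 mulr1 uea_incl_gen. Qed.

Lemma component_comul g (h : H) : component g h ->
  span (fun t => exists a b, [/\ component g a, component g b & t = a ⊗t b]) (comul h).
Proof.
set S := fun t => _; have sS := @span_subspace _ _ S.
move=> [u ->]; move: u; apply: uea_ind => [||x u Su].
- split=> [|a u v Su Sv]; first by rewrite linear0 mul0r linear0; apply: SpanNil.
  by rewrite linearP mulrDl -scalerAl linearP; apply: sS.2.
- rewrite rmorph1 mul1r; have /grouplikeP[-> _] := gvalP g.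
  have cg : component g (gval g) by exists 1; rewrite rmorph1 mul1r.
  by apply: spanS; exists (gval g), (gval g).
rewrite rmorphM /= uea_incl_gen -mulrA comul_primitive_mul.
have mS (t : tens_alg H H) : span S t ->
    span S ((pval x ⊗t 1 + 1 ⊗t pval x : tens_alg H H) * t).
  elim=> [|c _ t' [a [b [ca cb ->]]] _ St']; first by rewrite mulr0; apply: SpanNil.
  rewrite mulrDr -scalerAr; apply: sS.2 => //.
  rewrite mulrDl !tens_algM !mul1r.
  have cx z : component g z -> component g (pval x * z).
    by move=> cz; rewrite -[g]mul1g; apply: componentM => //; apply: component_primitive.
  by apply: subspaceD => //; apply: spanS; [exists (pval x * a), b | exists a, (pval x * b)];
     split=> //; apply: cx.
exact: mS.
Qed.

Fact antipode_defect_linear x :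
  linear (fun h : H => antipode (pval x * h) + antipode h * pval x).
Proof.
move=> a u v; rewrite mulrDr -scalerAr !linearP mulrDl -scalerAl scalerDr.
by rewrite addrACA.
Qed.

(* The defect F of the identity satisfies F * id = 0 in the convolution algebra, where
   id is invertible with inverse the antipode. *)
Lemma antipode_primitive_mul x (h : H) :
  antipode (pval x * h) = - (antipode h * pval x).
Proof.
pose F : conv H H := Conv (antipode_defect_linear x).
have Fid : F * conv_of idfun = 0.
  apply: convP => y; rewrite convME.
  have bS : bilin (fun a b : H => antipode a * b) by exact: (bilinM antipode idfun).
  have := antipodel (pval x * y); rewrite comul_primitive_mul rmorphM /= counit_primitive.
  rewrite mul0r scale0r => <-; rewrite -[comul y]/(comul_alg y).
  move: (comul_alg y); apply: tens_linear_eq => [||a b].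
  - exact/tens_lift_is_linear/(bilinM F idfun).
  - by move=> a s t; rewrite mulrDr -scalerAr (tens_lift_is_linear bS).
  rewrite mulrDl !tens_algM !mul1r (tens_liftD bS) !tens_liftE //; last exact: (bilinM F idfun).
  by rewrite /= mulrDl mulrA.
have idS : conv_of idfun * conv_of (antipode : {linear H -> H}) = 1.
  by apply: convP => y; rewrite convME conv1E -antipoder.
have F0 : F = 0 by rewrite -[F]mulr1 -idS mulrA Fid mul0r.
apply/eqP; rewrite -addr_eq0; apply/eqP.
by rewrite -[LHS]/(F h) F0.
Qed.

Lemma component_antipode g (h : H) : component g h -> component (g^-1)%g (antipode h).
Proof.
have sC := component_subspace (g^-1)%g.
move=> [u ->]; move: u; apply: uea_ind => [||x u Cu].
- split=> [|a u v Su Sv]; first by rewrite linear0 mul0r linear0; apply: (subspace0 sC).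
  by rewrite linearP mulrDl -scalerAl linearP; apply: sC.2.
- by rewrite rmorph1 mul1r -gvalV; exists 1; rewrite rmorph1 mul1r.
rewrite rmorphM /= uea_incl_gen -mulrA antipode_primitive_mul.
apply: (subspaceN sC); rewrite -[(g^-1)%g]mulg1.
exact/componentM/component_primitive.
Qed.

End Components.

(** * Partial Hopf algebras *)

Section PartialHopfTheory.
Context {k : fieldType} {H : hopfAlgType k}.
Implicit Types (h x : H).
Local Notation cls := (@par_class k H).

Lemma par_class1 : cls 1 = 1.
Proof.
have /(alg_class0 (@par_rel_proper k H)) := ParOne H.
by rewrite linearB /= rmorph1 => /eqP; rewrite subr_eq0 => /eqP.
Qed.

Local Notation q := (alg_class (@par_rel_proper k H)).

Lemma par_class_right h x :
  cls h * tens_lift (fun a b => cls a * cls (antipode b)) (comul x) =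
  tens_lift (fun a b => cls (h * a) * cls (antipode b)) (comul x).
Proof.
have /(alg_class0 (@par_rel_proper k H))/eqP := ParRight h x.
rewrite linearB subr_eq0 rmorphM => /eqP /= E.
transitivity (q (tens_lift (fun a b => talg_gen (h * a) * talg_gen (antipode b)) (comul x))).
  rewrite -E; congr (_ * _); rewrite linear_tens_lift.
  by apply: eq_tens_lift => a b; rewrite rmorphM.
by rewrite linear_tens_lift; apply: eq_tens_lift => a b; rewrite rmorphM.
Qed.

Lemma par_class_left h x :
  tens_lift (fun a b => cls a * cls (antipode b)) (comul h) * cls x =
  tens_lift (fun a b => cls a * cls (antipode b * x)) (comul h).
Proof.
have /(alg_class0 (@par_rel_proper k H))/eqP := ParLeft h x.
rewrite linearB subr_eq0 rmorphM => /eqP /= E.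
transitivity (q (tens_lift (fun a b => talg_gen a * talg_gen (antipode b * x)) (comul h))).
  rewrite -E; congr (_ * _); rewrite linear_tens_lift.
  by apply: eq_tens_lift => a b; rewrite rmorphM.
by rewrite linear_tens_lift; apply: eq_tens_lift => a b; rewrite rmorphM.
Qed.

(** The universal property of [par_hopf]: the hypotheses say that [f] is a partial
    representation. *)
Lemma par_lift_exists (A : algType k) (f : {linear H -> A}) : f 1 = 1 ->
    (forall h x, f h * tens_lift (fun a b => f a * f (antipode b)) (comul x) =
       tens_lift (fun a b => f (h * a) * f (antipode b)) (comul x)) ->
    (forall h x, tens_lift (fun a b => f a * f (antipode b)) (comul h) * f x =
       tens_lift (fun a b => f a * f (antipode b * x)) (comul h)) ->
  exists Phi : {lrmorphism par_hopf H -> A}, forall h, Phi (cls h) = f h.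
Proof.
move=> f1 fr fl; have f0 t : par_rel t -> talg_lift f t = 0.
  case=> [|h x|h x].
  - by rewrite linearB /= talg_liftE f1 rmorph1 subrr.
  - apply/eqP; rewrite linearB subr_eq0 rmorphM /= talg_liftE; apply/eqP.
    have := fr h x; congr (_ * _ = _); rewrite linear_tens_lift;
    by apply: eq_tens_lift => a b; rewrite rmorphM /= !talg_liftE.
  - apply/eqP; rewrite linearB subr_eq0 rmorphM /= talg_liftE; apply/eqP.
    have := fl h x; congr (_ * _ = _); rewrite linear_tens_lift;
    by apply: eq_tens_lift => a b; rewrite rmorphM /= !talg_liftE.
exists (alg_lift (properS := @par_rel_proper k H) f0) => h.
exact: (etrans (alg_liftE (@par_rel_proper k H) f0 (talg_gen h)) (talg_liftE f h)).
Qed.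

Let bSr : bilin (fun a b : H => cls a * cls (antipode b)).
Proof. exact: (bilinM cls (cls \o antipode)). Qed.

Lemma antipode1 : antipode (1 : H) = 1.
Proof.
have := antipodel (1 : H); rewrite comul1 tens_liftE; last exact: (bilinM antipode idfun).
by rewrite mulr1 rmorph1 scale1r.
Qed.

Lemma antipode_primitive (x : primitive H) : antipode (pval x) = - pval x.
Proof.
by have := antipode_primitive_mul x 1; rewrite mulr1 antipode1 mul1r.
Qed.

(** As [antipode x = - x], the relation reads [[h] ([x] - [x]) = [h x] - [h] [x]]. *)
Lemma par_class_mul_primitive h (x : primitive H) :
  cls (h * pval x) = cls h * cls (pval x).
Proof.
have /eqP Dx := pvalP x.
have bh : bilin (fun a b : H => cls (h * a) * cls (antipode b)).
  exact: (bilinM (cls \o mull_lin h) (cls \o antipode)).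
have := par_class_right h (pval x).
rewrite Dx (tens_liftD bSr) (tens_liftD bh) !tens_liftE //.
rewrite antipode1 antipode_primitive par_class1 !mulr1 mul1r !linearN /= addrC.
rewrite mulrDr mulrN addrC addrN => /esym/eqP; rewrite subr_eq0 => /eqP.
by [].
Qed.

Lemma par_class_primitive_mul (x : primitive H) h :
  cls (pval x * h) = cls (pval x) * cls h.
Proof.
have /eqP Dx := pvalP x.
have bh : bilin (fun a b : H => cls a * cls (antipode b * h)).
  exact: (bilinM cls (cls \o mulr_lin h \o antipode)).
have := par_class_left (pval x) h.
rewrite Dx (tens_liftD bSr) (tens_liftD bh) !tens_liftE //.
rewrite antipode1 antipode_primitive par_class1 mulr1 !mul1r mulNr !linearN /=.
by rewrite subrr mul0r => /esym/eqP; rewrite subr_eq0 => /eqP.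
Qed.

Lemma par_class_grouplike_right h (g : grouplike H) :
  cls h * (cls (gval g) * cls (gval (g^-1)%g)) =
  cls (h * gval g) * cls (gval (g^-1)%g).
Proof.
have bh : bilin (fun a b : H => cls (h * a) * cls (antipode b)).
  exact: (bilinM (cls \o mull_lin h) (cls \o antipode)).
have /grouplikeP[Dg _] := gvalP g.
by have := par_class_right h (gval g); rewrite Dg !tens_liftE.
Qed.

Lemma par_class_grouplike_left h (g : grouplike H) :
  cls (gval g) * cls (gval (g^-1)%g) * cls h =
  cls (gval g) * cls (gval (g^-1)%g * h).
Proof.
have bh : bilin (fun a b : H => cls a * cls (antipode b * h)).
  exact: (bilinM cls (cls \o mulr_lin h \o antipode)).
have /grouplikeP[Dg _] := gvalP g.
by have := par_class_left (gval g) h; rewrite Dg !tens_liftE.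
Qed.

End PartialHopfTheory.

Section PartialGroupAlgebra.
Context {k : fieldType} {G : groupType}.
Local Notation kG := (monoid_alg k G).
Local Notation C := (par_group_alg k G).
Local Notation pg := (@par_group_class k G).
Implicit Types g : G.

Lemma comul_mbase g : comul (mbase k g : kG) = mbase k g ⊗t mbase k g.
Proof. exact: mextE. Qed.

Lemma antipode_mbase g : antipode (mbase k g : kG) = mbase k (g^-1)%g.
Proof. exact: mextE. Qed.

Let bSr (A : algType k) (f : {linear kG -> A}) :
  bilin (fun a b : kG => f a * f (antipode b)).
Proof. exact: (bilinM f (f \o antipode)). Qed.

Let bRr (A : algType k) (f : {linear kG -> A}) h :
  bilin (fun a b : kG => f (h * a) * f (antipode b)).
Proof. exact: (bilinM (f \o mull_lin h) (f \o antipode)). Qed.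

Let bLr (A : algType k) (f : {linear kG -> A}) h :
  bilin (fun a b : kG => f a * f (antipode b * h)).
Proof. exact: (bilinM f (f \o mulr_lin h \o antipode)). Qed.

Lemma par_group_class1 : pg 1%g = 1.
Proof. by rewrite /par_group_class mbase1 par_class1. Qed.

Lemma par_group_class_right h g : pg h * pg g * pg (g^-1)%g = pg (h * g)%g * pg (g^-1)%g.
Proof.
have := par_class_right (mbase k h : kG) (mbase k g).
rewrite comul_mbase !tens_liftE; [|exact: (bRr (@par_class k kG))|exact: bSr].
by rewrite antipode_mbase -mbaseM mulrA.
Qed.

Lemma par_group_class_left h g : pg g * pg (g^-1)%g * pg h = pg g * pg (g^-1 * h)%g.
Proof.
have := par_class_left (mbase k g : kG) (mbase k h).
rewrite comul_mbase !tens_liftE; [|exact: (bLr (@par_class k kG))|exact: bSr].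
by rewrite antipode_mbase -mbaseM.
Qed.

Lemma par_group_lift_exists (A : algType k) (f : G -> A) : f 1%g = 1 ->
    (forall h g, f h * f g * f (g^-1)%g = f (h * g)%g * f (g^-1)%g) ->
    (forall h g, f g * f (g^-1)%g * f h = f g * f (g^-1 * h)%g) ->
  exists Phi : {lrmorphism C -> A}, forall g, Phi (pg g) = f g.
Proof.
move=> f1 fr fl; pose F : {linear kG -> A} := mext f.
have FE g : F (mbase k g) = f g by exact: mextE.
have [||h x|Phi PhiE] := @par_lift_exists k kG A F.
- by rewrite -[f 1%g]FE mbase1 in f1.
- move=> h x; move: h; apply: monoid_alg_linear_eq => [a u v|a u v|h].
  + by rewrite linearP mulrDl scalerAl.
  + apply: tens_liftP => c d /=.
    by rewrite mulrDl -scalerAl linearP mulrDl -scalerAl.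
  move: x; apply: monoid_alg_linear_eq => [a u v|a u v|g].
  + by rewrite linearP (tens_lift_is_linear (bSr F)) mulrDr -scalerAr.
  + by rewrite linearP (tens_lift_is_linear (bRr F _)).
  rewrite comul_mbase (tens_liftE (bSr F)) (tens_liftE (bRr F _)).
  by rewrite antipode_mbase -mbaseM !FE mulrA fr.
- move: h; apply: monoid_alg_linear_eq => [a u v|a u v|h].
  + by rewrite linearP (tens_lift_is_linear (bSr F)) mulrDl -scalerAl.
  + by rewrite linearP (tens_lift_is_linear (bLr F _)).
  move: x; apply: monoid_alg_linear_eq => [a u v|a u v|g].
  + by rewrite linearP mulrDr -scalerAr.
  + by rewrite comul_mbase !(tens_liftE (bLr F _)) mulrDr -scalerAr linearP mulrDr -scalerAr.
  rewrite comul_mbase (tens_liftE (bSr F)) (tens_liftE (bLr F _)).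
  by rewrite antipode_mbase -mbaseM !FE fl.
by exists Phi => g; rewrite -FE -PhiE.
Qed.

Lemma par_group_ind (P : C -> Prop) : subspace P ->
  (forall gs : seq G, P (\prod_(g <- gs) pg g)) -> forall c, P c.
Proof.
move=> sP Pp c; pose S (c : C) := exists gs : seq G, c = \prod_(g <- gs) pg g.
suff : span S c by apply: span_min => // _ [gs ->].
have sS := @span_subspace _ _ S.
move: c; apply: par_hopf_ind => // [|h t St].
  by apply: spanS; exists [::]; rewrite big_nil.
elim: St => [|a _ t' [gs ->] _ St']; first by rewrite mulr0; apply: SpanNil.
rewrite mulrDr -scalerAr; apply: sS.2 => // {t' St'}.
move: h; apply: monoid_alg_ind => [|g].
  split=> [|b x y Sx Sy]; first by rewrite linear0 mul0r; apply: SpanNil.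
  by rewrite linearP mulrDl -scalerAl; apply: sS.2.
by apply: spanS; exists (g :: gs); rewrite big_cons.
Qed.

End PartialGroupAlgebra.

Section GradedLift.
Context {k : closedFieldType} (char0 : [pchar k] =i pred0).
Context {H : hopfAlgType k} (coH : cocommutative H).
Local Notation G := (grouplike H).
Local Notation inc := (uea_incl H).
Local Notation cls := (@par_class k H).
Context {B : algType k} (e : G -> {linear H -> B}).
Hypothesis e1 : e 1%g 1 = 1.
Hypothesis e_right : forall h g x y z,
  e h x * (e g y * e (g^-1)%g z) = e (h * g)%g (x * y) * e (g^-1)%g z.
Hypothesis e_left : forall h g x y z,
  e g x * e (g^-1)%g y * e h z = e g x * e (g^-1 * h)%g (y * z).

(** The relations are bilinear in [h] and [x], and every Sweedler term of a homogeneous element is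
    homogeneous of the same degree, so checking them on components reduces to [e_right] and
    [e_left]. *)
Lemma graded_par_lift_exists : exists Phi : {lrmorphism par_hopf H -> B},
  forall g (h : H), component g h -> Phi (cls h) = e g h.
Proof.
have [phi phiE] := component_ext char0 coH
  (fun g => e g \o (mulr_lin (gval g) \o inc)).
have phiC g h : component g h -> phi h = e g h by case=> u ->; rewrite phiE.
have span_ext (P : H -> Prop) : subspace P -> (forall g h, component g h -> P h) ->
    forall h, P h.
  move=> sP Pc h; apply: (span_min sP _ (component_span char0 coH h)) => y [g cy].
  exact: Pc cy.
have eq_sub (V W : lmodType k) (F1 F2 : V -> W) : linear F1 -> linear F2 ->
    subspace (fun v => F1 v = F2 v).
  by move=> l1 l2; apply: (eq_subspace (linear_of l1) (linear_of l2)).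
have bS : bilin (fun a b : H => phi a * phi (antipode b)).
  exact: (bilinM phi (phi \o antipode)).
have bR h : bilin (fun a b : H => phi (h * a) * phi (antipode b)).
  exact: (bilinM (phi \o mull_lin h) (phi \o antipode)).
have bL h : bilin (fun a b : H => phi a * phi (antipode b * h)).
  exact: (bilinM phi (phi \o mulr_lin h \o antipode)).
have [|h x|h x|Phi PhiE] := par_lift_exists (f := phi); last first.
- by exists Phi => g h ch; rewrite PhiE (phiC g).
- move: x; apply: (span_ext _) => [|g' x cx].
    apply: eq_sub => [a u v|a u v].
      by rewrite linearP mulrDr scalerAr.
    apply: tens_liftP => c d /=.
    by rewrite mulrDr -scalerAr linearP mulrDr -scalerAr.
  move: h; apply: (span_ext _) => [|g h ch].
    apply: eq_sub => [a u v|a u v].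
      by rewrite linearP (tens_lift_is_linear bS) mulrDl scalerAl.
    by rewrite linearP (tens_lift_is_linear (bL _)).
  have sE : subspace (fun t => tens_lift (fun a b => phi a * phi (antipode b)) t * phi x =
      tens_lift (fun a b => phi a * phi (antipode b * x)) t).
    apply: eq_sub => [a u v|]; last exact: tens_lift_is_linear.
    by rewrite (tens_lift_is_linear bS) mulrDl scalerAl.
  apply: (span_min sE _ (component_comul ch)) => _ [a [b [ca cb ->]]].
  have cSb := component_antipode cb.
  rewrite (tens_liftE bS) (tens_liftE (bL _)) (phiC _ _ ca) (phiC _ _ cSb) (phiC _ _ cx).
  rewrite (phiC _ _ (componentM cSb cx)).
  exact: e_left.
- move: h; apply: (span_ext _) => [|g h ch].
    apply: eq_sub => [a u v|a u v].
      by rewrite linearP mulrDl scalerAl.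
    apply: tens_liftP => c d /=.
    by rewrite mulrDl -scalerAl linearP mulrDl -scalerAl.
  move: x; apply: (span_ext _) => [|g' x cx].
    apply: eq_sub => [a u v|a u v].
      by rewrite linearP (tens_lift_is_linear bS) mulrDr scalerAr.
    by rewrite linearP (tens_lift_is_linear (bR _)).
  have sE : subspace (fun t => phi h * tens_lift (fun a b => phi a * phi (antipode b)) t =
      tens_lift (fun a b => phi (h * a) * phi (antipode b)) t).
    apply: eq_sub => [a u v|]; last exact: tens_lift_is_linear.
    by rewrite (tens_lift_is_linear bS) mulrDr scalerAr.
  apply: (span_min sE _ (component_comul cx)) => _ [a [b [ca cb ->]]].
  have cSb := component_antipode cb.
  rewrite (tens_liftE bS) (tens_liftE (bR _)) (phiC _ _ ch) (phiC _ _ ca) (phiC _ _ cSb).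
  rewrite (phiC _ _ (componentM ch ca)).
  exact: e_right.
- have c1 : component (1%g : G) (1 : H) by exists 1; rewrite rmorph1 mulr1.
  by rewrite (phiC _ _ c1) e1.
Qed.

End GradedLift.

(** * The comparison map *)

Section Comparison.
Context {k : closedFieldType} (char0 : [pchar k] =i pred0).
Context {H : hopfAlgType k} (coH : cocommutative H).
Local Notation G := (grouplike H).
Local Notation U := (uea (primitive H)).
Local Notation inc := (uea_incl H).
Local Notation cls := (@par_class k H).

Fact par_class_bracket (x y : primitive H) :
  (cls \o @pval k H) (lie_bracket x y) =
  (cls \o @pval k H) x * (cls \o @pval k H) y - (cls \o @pval k H) y * (cls \o @pval k H) x.
Proof. by rewrite /= linearB /= !par_class_mul_primitive. Qed.

Definition uea_par : U -> par_hopf H := uea_lift par_class_bracket.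
HB.instance Definition _ := GRing.LRMorphism.copy uea_par (uea_lift par_class_bracket).

Lemma uea_par_gen x : uea_par (uea_gen x) = cls (pval x).
Proof. exact: (uea_liftE par_class_bracket). Qed.

Lemma par_class_uea_mul u h : cls (inc u * h) = uea_par u * cls h.
Proof.
move: u; apply: uea_ind => [||x u E].
- exact: (eq_subspace (cls \o (mulr_lin h \o inc)) (mulr_lin (cls h) \o uea_par)).
- by rewrite !rmorph1 !mul1r.
- by rewrite !rmorphM /= uea_incl_gen uea_par_gen -mulrA par_class_primitive_mul E mulrA.
Qed.

(** One [v'] serves both equations: the first identifies it as a conjugate in [H]; the second is the
    corresponding commutation rule in H_par, where [[g]] need not be invertible. *)
Lemma par_class_conj (g : G) v : exists2 v',
  inc v' = gval g * inc v * gval (g^-1)%g & cls (gval g) * uea_par v = uea_par v' * cls (gval g).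
Proof.
move: v; apply: uea_ind => [||x v [v' E1 E2]].
- split=> [|a u v [u' Eu Eu'] [v' Ev Ev']].
    by exists 0; rewrite !linear0 ?mulr0 ?mul0r.
  exists (a *: u' + v').
    by rewrite !linearP /= Eu Ev mulrDr mulrDl -scalerAr -scalerAl.
  by rewrite !linearP /= mulrDr mulrDl -scalerAr -scalerAl Eu' Ev'.
- by exists 1; rewrite !rmorph1 mulr1 ?gval_mulV ?mul1r.
exists (uea_gen (conjp g x) * v').
  rewrite !rmorphM /= !uea_incl_gen E1 /= !mulrA.
  by rewrite -[_ * gval (g^-1)%g * gval g]mulrA gval_Vmul mulr1.
rewrite !rmorphM /= !uea_par_gen mulrA -par_class_mul_primitive conjpE.
by rewrite par_class_primitive_mul -!mulrA E2.
Qed.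

Local Notation C := (par_group_alg k G).
Local Notation pg := (@par_group_class k G).
Lemma par_hopf_smash : exists T : {linear C ⊗ U -> U ⊗ C},
  (forall (gs : seq G) (x : U), exists2 y : U,
     inc y = (\prod_(g <- gs) gval g) * inc x * (\prod_(g <- rev gs) gval (g^-1)%g)
   & T ((\prod_(g <- gs) pg g) ⊗t x) = y ⊗t (\prod_(g <- gs) pg g)) /\
  exists phi : {linear par_hopf H -> U ⊗ C},
    [/\ bijective phi, phi 1 = 1 ⊗t 1
      & forall a b, phi (a * b) = smash_mul T (phi a) (phi b)].
Proof.
have [iota iotaE] : exists iota : {lrmorphism C -> par_hopf H},
    forall g, iota (pg g) = cls (gval g).
  apply: (par_group_lift_exists (f := fun g => cls (gval g))) => [|h g|h g].
  - exact: par_class1.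
  - by rewrite -mulrA par_class_grouplike_right.
  - by rewrite par_class_grouplike_left.
have [Phi PhiE] : exists Phi : {lrmorphism par_hopf H -> tens_alg H C},
    forall g (h : H), component g h -> Phi (cls h) = tens_elem H (pg g) h.
  apply: (graded_par_lift_exists char0 coH) => [|h g x y z|h g x y z].
  - by rewrite par_group_class1.
  - by rewrite !tens_elemM !mulrA par_group_class_right.
  - by rewrite !tens_elemM par_group_class_left -!mulrA.
have [E EE] := component_ext char0 coH (fun _ : G => (idfun : {linear U -> U})).
have lphi : linear (fun y => tens_map E idfun (Phi y : H ⊗ C)).
  by move=> a y z; rewrite linearP; apply: linearP.
pose phi : {linear par_hopf H -> U ⊗ C} := linear_of lphi.
have bpsi : bilin (fun (u : U) (c : C) => uea_par u * iota c) by exact: bilinM.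
pose psi : {linear U ⊗ C -> par_hopf H} := linear_of (tens_lift_is_linear bpsi).
have psiE u c : psi (u ⊗t c) = uea_par u * iota c by exact: (tens_liftE bpsi).
have Phi_uea u : Phi (uea_par u) = tens_elem H 1 (inc u).
  move: u; apply: uea_ind => [||x u Eu].
  - exact: (eq_subspace (Phi \o uea_par) (tens_elem H 1 \o inc)).
  - by rewrite !rmorph1.
  - rewrite !rmorphM /= Eu uea_par_gen (PhiE _ _ (component_primitive x)) par_group_class1.
    by rewrite tens_elemM mul1r uea_incl_gen.
have Phi_iota gs : Phi (iota (\prod_(g <- gs) pg g)) =
    tens_elem H (\prod_(g <- gs) pg g) (\prod_(g <- gs) gval g).
  elim: gs => [|g gs IHgs]; first by rewrite !big_nil !rmorph1.
  rewrite !big_cons !rmorphM /= IHgs iotaE (PhiE g) ?tens_elemM //.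
  by exists 1; rewrite rmorph1 mul1r.
have gvals gs : exists g : G, gval g = \prod_(g <- gs) gval g.
  elim: gs => [|g gs [h hE]]; first by exists 1%g; rewrite big_nil.
  by exists (g * h)%g; rewrite big_cons gvalM hE.
have psiK : cancel psi phi.
  apply: tens_linear_eq => [a s t|//|u c]; first by rewrite !linearP.
  move: c; apply: par_group_ind => [|gs].
    split=> [|a c d Ec Ed].
      by rewrite -(scale0r (0 : C)) tensZr scale0r !linear0.
    by rewrite tensDr tensZr !linearP Ec Ed.
  have [g gE] := gvals gs.
  have -> : phi (psi (u ⊗t \prod_(g <- gs) pg g)) =
      tens_map E idfun ((inc u * gval g) ⊗t (\prod_(g <- gs) pg g)).
    by rewrite psiE /= rmorphM /= Phi_uea Phi_iota tens_elemM mul1r gE.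
  by rewrite tens_mapE EE.
(* The image contains 1 and is stable under left multiplication by every class: for [h = u g], the
   class of [g] moves past [v] at the cost of replacing [v] by its conjugate. *)
have psi_surj y : exists t, psi t = y.
  have sI : subspace (fun y => exists t, psi t = y).
    split=> [|a _ _ [s <-] [t <-]]; first by exists 0; rewrite linear0.
    by exists (a *: s + t); rewrite linearP.
  move: y; apply: par_hopf_ind => [//||h _ [t <-]].
    by exists (1 ⊗t 1); rewrite psiE !rmorph1 mulr1.
  move: t; apply: tens_ind => [|a v c t It].
    by exists 0; rewrite linear0 mulr0.
  rewrite linearP mulrDr -scalerAr; apply: sI.2 => // {t It a}; rewrite psiE.
  have sJ : subspace (fun h => exists t, psi t = cls h * (uea_par v * iota c)).
    split=> [|a x y [s Es] [t Et]]; first by exists 0; rewrite !linear0 mul0r.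
    by exists (a *: s + t); rewrite !linearP Es Et mulrDl -scalerAl.
  apply: (span_min sJ _ (component_span char0 coH h)) => _ [g [u ->]].
  have [v' _ Ev] := par_class_conj g v.
  exists ((u * v') ⊗t (pg g * c)); rewrite psiE par_class_uea_mul !rmorphM /= iotaE.
  by rewrite -!mulrA; congr (_ * _); rewrite !mulrA Ev.
have phiK : cancel phi psi by move=> y; have [t <-] := psi_surj y; rewrite psiK.
have bT : bilin (fun (c : C) (u : U) => phi (iota c * uea_par u)).
  have [bl br] : bilin (fun (c : C) (u : U) => iota c * uea_par u) by exact: bilinM.
  split=> [u a c d|c a u v]; first exact: (etrans (congr1 phi (bl u a c d)) (linearP phi _ _ _)).
  exact: (etrans (congr1 phi (br c a u v)) (linearP phi _ _ _)).
(* Well defined on [C] by construction, and [psi (T (c ⊗t u)) = iota c * uea_par u] is exactly what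
   multiplicativity of [psi] requires. *)
pose T : {linear C ⊗ U -> U ⊗ C} := linear_of (tens_lift_is_linear bT).
have TE c u : T (c ⊗t u) = phi (iota c * uea_par u) by exact: (tens_liftE bT).
have psi_smash s t : psi (smash_mul T s t) = psi s * psi t.
  have [bl br] := smash_mul_bilin T.
  move: s; apply: tens_linear_eq => [a x y|a x y|u c].
  - by rewrite bl linearP.
  - by rewrite linearP mulrDl -scalerAl.
  move: t; apply: tens_linear_eq => [a x y|a x y|u' c'].
  - by rewrite br linearP.
  - by rewrite linearP mulrDr -scalerAr.
  rewrite smash_mulE.
  have psi_sides w : psi (tens_map (mull_lin u) (mulr_lin c') w) =
      uea_par u * psi w * iota c'.
    move: w; apply: tens_linear_eq => [a x y|a x y|v d].
    - by rewrite !linearP.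
    - by rewrite linearP mulrDr mulrDl -scalerAr -scalerAl.
    by rewrite tens_mapE !psiE !rmorphM !mulrA.
  rewrite -[tens_lift _ _]/(tens_map (mull_lin u) (mulr_lin c') _) psi_sides.
  by rewrite TE phiK !psiE !mulrA.
exists T; split; last first.
  exists phi; split; first by exists psi.
    by apply: (can_inj psiK); rewrite phiK psiE !rmorph1 mulr1.
  by move=> a b; apply: (can_inj psiK); rewrite psi_smash !phiK.
move=> gs x; have [y Ey Ey'] : exists2 y,
    inc y = (\prod_(g <- gs) gval g) * inc x * (\prod_(g <- rev gs) gval (g^-1)%g)
  & iota (\prod_(g <- gs) pg g) * uea_par x = uea_par y * iota (\prod_(g <- gs) pg g).
  elim: gs => [|g gs [y Ey Ey']].
    by exists x; rewrite ?big_nil ?rmorph1 ?mulr1 mul1r.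
  have [z Ez Ez'] := par_class_conj g y.
  exists z; rewrite !big_cons.
    by rewrite rev_cons -cats1 big_cat big_seq1 Ez Ey !mulrA.
  by rewrite rmorphM /= iotaE -mulrA Ey' mulrA Ez' !mulrA.
exists y; first exact: Ey.
rewrite TE Ey' -psiE.
exact: psiK.
Qed.

End Comparison.

(** Injectivity of [uea_incl] justifies identifying U(g) with a subalgebra of [H] and makes the
    conjugate [y] unique; as the words span k_par G, the formula then determines [T]. *)
Theorem mainTheorem7 (k : closedFieldType) (char0 : [pchar k] =i pred0)
    (H : hopfAlgType k) (coH : cocommutative H) :
  let G := grouplike H in
  let U := uea (primitive H) in
  let C := par_group_alg k G in
  injective (uea_incl H) /\
  exists T : {linear C ⊗ U -> U ⊗ C},
    (forall (gs : seq G) (x : U),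
       exists2 y : U,
         uea_incl H y =
           (\prod_(g <- gs) gval g) * uea_incl H x *
           (\prod_(g <- rev gs) gval (g^-1)%g)
       & T ((\prod_(g <- gs) par_group_class k g) ⊗t x) =
           y ⊗t (\prod_(g <- gs) par_group_class k g)) /\
    exists phi : {linear par_hopf H -> U ⊗ C},
      [/\ bijective phi,
          phi 1 = 1 ⊗t 1
        & forall a b, phi (a * b) = smash_mul T (phi a) (phi b)].
Proof.
move=> G U C; split; first exact: uea_incl_inj.
exact (par_hopf_smash char0 coH).
Qed.
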